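(* Suppose that $\tau_i=N(f_i)$ for $i=1,\dots,n$, where $N$ is a Poisson random measure on $\mathscr V$ with intensity $\nu$. Then the joint posterior distribution of $(\mathbf V,\mathbf W)|\mathbf X$ in the augmented model is $$\mathscr P_{\mathbf X}(d\mathbf v,d\mathbf w)\propto\Big[\prod_{i=1}^n f_i(v_i)\Big]\mathscr M(d\mathbf v|\nu_{\Omega_n})\,e^{-\Lambda(\Omega_n)}\prod_{i=1}^n\phi(X_i|\mu\Delta+\beta w_i^{-1},w_i^{-1})\,dw_i .$$ In particular: (i) $\displaystyle \pi(d\mathbf w|\mathbf v,\mathbf X)\propto e^{-\Lambda(\Omega_n)}\prod_{i=1}^n f_{GIG}\Big(w_i\,\Big|\,3/2,\,|\beta|,\,\sqrt{A_i^2+2\sum_{j=1}^{n(\mathbf p)}f_i(v_j^* )}\Big)\,dw_i$; (ii) $\displaystyle \pi(d\mathbf v|\mathbf w,\mathbf X)\propto\Big[\prod_{i=1}^n f_i(v_i)\Big]\mathscr M(d\mathbf v|\nu_{\Omega_n})=\Big[\prod_{j=1}^{n(\mathbf p)}\prod_{i\in C_j}f_i(v_j^* )\Big]\mathscr M(d\mathbf v|\nu_{\Omega_n})$; (iii) the posterior distribution of $\mathbf W|\mathbf X$ is $$\mathscr P_{\mathbf X}(d\mathbf w)=\mathscr B(\mathbf w)\,e^{-\Lambda(\Omega_n)}\prod_{i=1}^n\phi(X_i|\mu\Delta+\beta w_i^{-1},w_i^{-1})\,dw_i\Big/\mathscr L(\mathbf X|\mu,\beta,\theta).$$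
   Context: Let $\mathscr V$ be a Polish space, $\nu$ a boundedly finite measure on $\mathscr V$, and $N$ a Poisson random measure on $\mathscr V$ with mean intensity $\nu$ and law $\mathbb P(dN|\nu)$. Write $N(f)=\int f\,dN$ and $\Lambda(f)=\int_{\mathscr V}(1-e^{-f(v)})\,\nu(dv)$. Let $n\ge1$ and $f_1,\dots,f_n:\mathscr V\to[0,\infty)$ be measurable with $\Lambda(\sum_i w_if_i)<\infty$ for all non-negative $w_1,\dots,w_n$. Put $\Omega_n(v)=\sum_{i=1}^n w_if_i(v)$ and $\nu_{\Omega_n}(dv)=e^{-\Omega_n(v)}\nu(dv)$. $\phi(x|m,s^2)$ is the Normal density with mean $m$ and variance $s^2$. $\Delta>0$, $\mu,\beta\in\mathbb R$ are fixed, $\theta$ denotes the parameters of the law of $N$, $\mathbf X=(X_1,\dots,X_n)$ are the observations, and $A_i=X_i-\mu\Delta$. The model is $X_i\overset{d}{=}\mu\Delta+(\tau_i/Z_i)\beta+(\tau_i/Z_i)^{1/2}\epsilon_i$, conditionally independent given $N$, with $Z_i$ i.i.d. exponential of mean 1 and $\epsilon_i$ i.i.d. standard Normal independent of the $Z_i$; with $W_i=Z_i/\tau_i$ the likelihood is $$\mathscr L(\mathbf X|\mu,\beta,\theta)=\int_{\mathbb R_+^n}\Big[\prod_{i=1}^n\phi(X_i|\mu\Delta+\beta w_i^{-1},w_i^{-1})\Big]\mathbb E\Big[\prod_{i=1}^ne^{-w_i\tau_i}\tau_i\Big]\prod_{i=1}^n dw_i,$$ assumed finite and positive at the observed $\mathbf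 X$. Augmented model: writing $\tau_i=\int f_i(v_i)N(dv_i)$ and removing the integrals, $\mathbf V=(V_1,\dots,V_n)\in\mathscr V^n$ are treated as missing values, i.e. the joint measure of $(\mathbf V,\mathbf W,N,\mathbf X)$ is $$\mathbb P(dN|\nu)\prod_{i=1}^n\big[f_i(v_i)N(dv_i)\,e^{-w_iN(f_i)}\phi(X_i|\mu\Delta+\beta w_i^{-1},w_i^{-1})\,dw_i\big]\,d\mathbf X,$$ and posterior laws are obtained from it by conditioning on $\mathbf X$ and normalizing. $\mathbf p=\{C_1,\dots,C_{n(\mathbf p)}\}$ is the partition of $\{1,\dots,n\}$ induced by $\mathbf V$: $V_1^*,\dots,V^*_{n(\mathbf p)}$ are the distinct values and $C_j=\{i:V_i=V_j^*\}$ (if $\nu$ has atoms, indices share a cell when they select the same point of $N$, points of $N$ counted with multiplicity being regarded as distinct). $\mathscr M(d\mathbf v|\nu_{\Omega_n})$ is the $n$-th moment measure of a Poisson random measure with intensity $\nu_{\Omega_n}$; on vectors $\mathbf v$ with partition $\mathbf p$ and distinct values $v_j^*$ it equals $\prod_{j=1}^{n(\mathbf p)}\nu_{\Omega_n}(dv_j^* )$ (integrating a function over $\mathscr V^n$ sums over all $\mathbf p$). $\mathscr B(\mathbf w)=\sum_{\mathbf p}\prod_{j=1}^{n(\mathbf p)}\int_{\mathscr V}[\prod_{i\in C_j}f_i(v)]\,\nu_{\Omega_n}(dv)$, the sum being over all partitions of $\{1,\dots,n\}$. $f_{GIG}(t|\lambda,\delta,v)=\frac{(v/\delta)^\lambda}{2K_\lambda(\delta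 v)}t^{\lambda-1}\exp\{-\frac12(\delta^2t^{-1}+v^2t)\}$, $t>0$, with $K_\lambda$ the modified Bessel function of the second kind; for $\delta=0$, $\lambda>0$, $v>0$ it is the limiting Gamma density proportional to $t^{\lambda-1}e^{-v^2t/2}$. *)

(* Defs.v *)
From HB Require Import structures.
From mathcomp Require Import all_boot all_order all_algebra.
From mathcomp Require Import all_classical all_reals all_analysis.
Set Implicit Arguments.
Unset Strict Implicit.
Unset Printing Implicit Defensive.
Import Order.TTheory GRing.Theory Num.Theory.
Import numFieldNormedType.Exports.
Local Open Scope classical_set_scope.
Local Open Scope ring_scope.
Local Open Scope ereal_scope.

(* Boundedness, hence "boundedly finite", refers to a fixed complete metric;
   a Polish space is a separable such space. *)
#[short(type="completeMetricType")]
HB.structure Definition CompleteMetric (R : numDomainType) :=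
  {T of Metric R T & Complete T}.

Definition separable (T : topologicalType) : Prop :=
  exists2 D : set T, countable D & dense D.

Notation borel V := (g_sigma_algebraType (@open V)).

Section random_measure.
Context {R : realType} {V : completeMetricType R}.

Definition bounded_subset (A : set V) : Prop :=
  exists x : V, exists r : R, A `<=` ball x r.

Definition boundedly_finite (nu : set (borel V) -> \bar R) : Prop :=
  forall A : set (borel V), measurable A -> bounded_subset A -> nu A < +oo.

(* A point process (boundedly finite, integer-valued) with Poisson counts and
   independent increments. The probability mass function is written out
   because [poisson_pmf] is constantly 1 at rate 0. *)
Record poisson_random_measure d (Om : measurableType d) (P : probability Om R)
    (nu : set (borel V) -> \bar R) (N : R.-ker Om ~> borel V) : Prop := {
  prm_integer : forall om (A : set (borel V)),
    measurable A -> bounded_subset A -> exists k : nat, N om A = k%:R%:E ;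
  prm_poisson : forall (A : set (borel V)) (k : nat),
    measurable A -> bounded_subset A ->
    P [set om | N om A = k%:R%:E] =
      (fine (nu A) ^+ k / k`!%:R * expR (- fine (nu A)))%:E ;
  prm_indep : forall (m : nat) (A : 'I_m -> set (borel V)) (k : 'I_m -> nat),
    (forall j, measurable (A j)) -> (forall j, bounded_subset (A j)) ->
    trivIset setT A ->
    P [set om | forall j, N om (A j) = (k j)%:R%:E] =
      \prod_(j < m) P [set om | N om (A j) = (k j)%:R%:E] }.

(* The points of an integer-valued measure counted with multiplicity: an atom
   [x] of mass [k] gives the [k] distinct points [(x, 0), ..., (x, k.-1)]. *)
Definition points (m : set (borel V) -> \bar R) : set (borel V * nat) :=
  [set q | q.2%:R%:E < m [set q.1]].

Definition point_tuples n (m : set (borel V) -> \bar R) :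
    set (n.-tuple (borel V * nat)%type) :=
  [set s | forall i, points m (tnth s i)].

End random_measure.

Section iterated_integral.
Context d {T : measurableType d} {R : realType}.
Variables (mu : set T -> \bar R) (D : set T).

(* Integral over [D^k] against the [k]-fold product of [mu]. *)
Fixpoint iter_integral k : (k.-tuple T -> \bar R) -> \bar R :=
  if k is k'.+1
  then fun g => \int[mu]_(x in D) iter_integral (fun t => g (cons_tuple x t))
  else fun g => g [tuple].

End iterated_integral.

Section orthant.
Context {R : realType}.

Notation Rn n := (n.-tuple (measurableTypeR R)).

(* Integral against [dw_1 ... dw_n] over the open positive orthant. *)
Definition orthant_integral n (g : Rn n -> \bar R) : \bar R :=
  iter_integral (@lebesgue_measure R) `]0%R, +oo[%classic g.

End orthant.

Definition set_partition n : Type :=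
  {p : {set {set 'I_n}} | finset.partition p (finset.setTfor 'I_n)}.

Section set_partition.
Variable n : nat.

HB.instance Definition _ := Finite.on (set_partition n).

Definition induced_partition (T : eqType) (s : n.-tuple T) : set_partition n :=
  exist _ (finset.preim_partition (tnth s) (finset.setTfor 'I_n))
          (finset.preim_partitionP _ _).

HB.instance Definition _ := isPointed.Build (set_partition n)
  (induced_partition (ord_tuple n)).

HB.instance Definition _ := @isMeasurable.Build default_measure_display
  (set_partition n) discrete_measurable discrete_measurable0
  discrete_measurableC discrete_measurableU.

End set_partition.

Section moment_measure.
Context {R : realType} d {T : measurableType d}.
Variable n : nat.
Implicit Types (p : set_partition n) (v : n.-tuple T).

(* The missing values are pairs [(p, v)] of the vector [V] and of the partition
   recording which coordinates select the same point of [N]. Almost surely [p]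
   is a function of [v] when the intensity has no atoms; it carries additional
   information otherwise. *)

(* The vector with partition [p] whose value on the [j]-th cell is
   [v_j^*]. *)
Definition spread p (vstar : #|val p|.-tuple T) : n.-tuple T :=
  [tuple nth point vstar (index (finset.pblock (val p) i) (enum (val p)))
    | i < n].
Arguments spread : clear implicits.

(* Integral of [g] against the [n]-th moment measure of a Poisson random
   measure with intensity [mu]. *)
Definition moment_integral (mu : set T -> \bar R)
    (g : set_partition n * n.-tuple T -> \bar R) : \bar R :=
  \sum_p iter_integral mu setT (fun vstar => g (p, spread p vstar)).

(* [h v_j^*] for the cell [C = C_j]; on the vectors of interest [v] is constant
   on [C], so that any representative of [C] gives [v_j^*]. *)
Definition at_cell (U : Type) (u0 : U) (h : T -> U) v (C : {set 'I_n}) : U :=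
  oapp (fun k => h (tnth v k)) u0 [pick k in C].

End moment_measure.

Definition propto {R : realType} d (T : measurableType d)
    (m1 m2 : set T -> \bar R) : Prop :=
  exists2 c : R, (0 < c)%R &
    forall A, measurable A -> m1 A = c%:E * m2 A.

Section conditional_laws.
Context {R : realType} d1 d2 {T1 : measurableType d1} {T2 : measurableType d2}.
Variable Q : probability (T1 * T2)%type R.

(* Regular conditional laws under [Q] of the second coordinate given the first
   one, and conversely. *)
Definition cond_law_snd (k : R.-pker T1 ~> T2) : Prop :=
  forall A B, measurable A -> measurable B ->
    Q (A `*` B) = \int[Q]_(y in A `*` setT) k y.1 B.

Definition cond_law_fst (k : R.-pker T2 ~> T1) : Prop :=
  forall A B, measurable A -> measurable B ->
    Q (A `*` B) = \int[Q]_(y in setT `*` B) k y.2 A.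

End conditional_laws.

Section densities.
Context {R : realType}.
Local Open Scope ring_scope.
Notation leb := (@lebesgue_measure R).

(* Parametrized by the variance, whereas [normal_pdf] takes the standard
   deviation. *)
Definition phi (x m s2 : R) : R := normal_pdf m (Num.sqrt s2) x.

(* Modified Bessel function of the second kind, for [z > 0]:
   K_l(z) = \int_0^oo exp(- z cosh t) cosh (l t) dt. *)
Definition besselK (l z : R) : R :=
  \int[leb]_(t in `[0, +oo[)
    (expR (- (z * ((expR t + expR (- t)) / 2)))
     * ((expR (l * t) + expR (- (l * t))) / 2)).

Definition gig_kernel (l delta v t : R) : R :=
  powR t (l - 1) * expR (- (delta ^+ 2 / t + v ^+ 2 * t) / 2).

(* For [delta = 0], the limiting Gamma density. *)
Definition gig_pdf (l delta v t : R) : R :=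
  if delta == 0
  then gig_kernel l 0 v t / (\int[leb]_(s in `]0, +oo[) gig_kernel l 0 v s)
  else powR (v / delta) l / (2 * besselK l (delta * v))
       * gig_kernel l delta v t.

End densities.

Section model.
Context {R : realType} {V : completeMetricType R}.
Variables (nu : {measure set (borel V) -> \bar R}) (n : nat).
Variable (f : 'I_n -> borel V -> R).
Variables (mu Delta beta : R) (X : 'I_n -> R).

Notation Rn := (n.-tuple (measurableTypeR R)).
Notation Vn := (n.-tuple (borel V)).

Definition Lambda (h : borel V -> R) : \bar R :=
  \int[nu]_v (1 - expR (- h v))%:E.

Definition Omega (w : Rn) (v : borel V) : R :=
  (\sum_(i < n) tnth w i * f i v)%R.

Definition nu_Omega (w : Rn) (A : set (borel V)) : \bar R :=
  \int[nu]_(v in A) (expR (- Omega w v))%:E.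

Definition normal_factor (w : Rn) (i : 'I_n) : R :=
  phi (X i) (mu * Delta + beta * (tnth w i)^-1)%R (tnth w i)^-1%R.

Definition normal_lik (w : Rn) : R := (\prod_(i < n) normal_factor w i)%R.

Definition prod_f (v : Vn) : R := (\prod_(i < n) f i (tnth v i))%R.

Definition prod_f_cells (p : set_partition n) (v : Vn) : R :=
  (\prod_(C in val p) \prod_(i in C) at_cell 1 (f i) v C)%R.

Definition sum_f_cells (i : 'I_n) (p : set_partition n) (v : Vn) : R :=
  (\sum_(C in val p) at_cell 0 (f i) v C)%R.

Definition B_coef (w : Rn) : \bar R :=
  \sum_(p : set_partition n) \prod_(C in val p)
    \int[nu_Omega w]_v (\prod_(i in C) f i v)%:E.

Section augmented.
Context d (Om : measurableType d).
Variables (P : probability Om R) (N : R.-ker Om ~> borel V).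

Definition tau (om : Om) (i : 'I_n) : \bar R := \int[N om]_v (f i v)%:E.

Definition likelihood : \bar R :=
  orthant_integral (fun w => (normal_lik w)%:E *
    \int[P]_om \prod_(i < n)
      (expeR (- ((tnth w i)%:E * tau om i)) * tau om i)).

(* Density with respect to [dX], at the observed [X], of the joint measure of
   the augmented model, integrated over [N]. The integral over
   [N(dv_1) ... N(dv_n)] is the sum over the [n]-tuples of points of [N]. *)
Definition joint_measure (B : set ((set_partition n * Vn) * Rn)) : \bar R :=
  \int[P]_om orthant_integral (fun w =>
    \esum_(s in point_tuples (N om))
      (\prod_(i < n) ((f i (tnth s i).1)%:E *
                      expeR (- ((tnth w i)%:E * tau om i)) *
                      (normal_factor w i)%:E)
       * (\1_B ((induced_partition s, map_tuple fst s), w))%:E)).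

Definition is_posterior
    (PX : probability ((set_partition n * Vn) * Rn)%type R) : Prop :=
  forall B, measurable B ->
    PX B = (fine (joint_measure setT))^-1%:E * joint_measure B.

End augmented.

Definition joint_formula (B : set ((set_partition n * Vn) * Rn)) : \bar R :=
  orthant_integral (fun w =>
    moment_integral (nu_Omega w)
      (fun pv => (prod_f pv.2)%:E * (\1_B (pv, w))%:E)
    * expeR (- Lambda (Omega w)) * (normal_lik w)%:E).

Definition w_formula (pv : set_partition n * Vn) (B : set Rn) : \bar R :=
  orthant_integral (fun w =>
    expeR (- Lambda (Omega w))
    * (\prod_(i < n)
        gig_pdf (3 / 2) `|beta|
          (Num.sqrt ((X i - mu * Delta) ^+ 2
                     + 2 * sum_f_cells i pv.1 pv.2)) (tnth w i))%:E
    * (\1_B w)%:E).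

Definition v_formula (w : Rn) (A : set (set_partition n * Vn)) : \bar R :=
  moment_integral (nu_Omega w)
    (fun pv => (prod_f pv.2)%:E * (\1_A pv)%:E).

Definition v_formula_cells (w : Rn) (A : set (set_partition n * Vn)) : \bar R :=
  moment_integral (nu_Omega w)
    (fun pv => (prod_f_cells pv.1 pv.2)%:E * (\1_A pv)%:E).

End model.

(* Main.v *)
(* With w fixed, the product of the tau_i is a sum over n-tuples of points of N,
   and grouping equal points turns it into a sum over partitions p of sums over
   tuples of distinct points.  The Slivnyak-Mecke formula tilted by exp(-N(h)),
   h = Omega_n, evaluates the expectation of each of these as exp(-Lambda(h))
   times an integral against a power of exp(-h) nu, that is, against one term of
   the moment measure of nu_Omega.  Hence the joint law of (V, W) has an explicit
   density with respect to a sigma-finite product measure, and the conditional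
   laws are read off by Bayes' rule; (i) is the identity
   phi(x|m + b/w, 1/w) exp(-w s) =
     const * w^(1/2) exp(-(b^2/w + ((x-m)^2 + 2s) w)/2).

   The Mecke formula itself is first proved for h simple and rectangles B_i:
   there everything is a function of the Poisson counts of finitely many disjoint
   sets, and it follows from E[N F(N - 1)] = lambda E[F(N)] for a Poisson
   variable; dominated convergence and uniqueness of measures do the rest. *)

Require Import Defs.
From HB Require Import structures.
From mathcomp Require Import all_boot all_order all_algebra.
From mathcomp Require Import finmap.
From mathcomp Require Import all_classical all_reals all_analysis.
From mathcomp Require Import measurable_realfun.
From mathcomp Require Import ring lra.
Set Implicit Arguments.
Unset Strict Implicit.
Unset Printing Implicit Defensive.
Import Order.TTheory GRing.Theory Num.Theory.
Import numFieldNormedType.Exports.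
Local Open Scope classical_set_scope.
Local Open Scope ring_scope.
Local Open Scope ereal_scope.

(** * Measures defined by their integrals *)

(** Point sums of [N], their expectations and iterated integrals all arrive as functionals of a test
    function, whereas Tonelli, uniqueness on rectangles and Bayes' rule speak of measures. Each
    functional is therefore turned into a measure, and sigma-finiteness comes from balls of growing
    radius about a fixed point, where [nu] is finite and [N] integer-valued. Separability enters
    once: it makes an integer-valued measure the sum of its atoms, so that integrals against [N]
    become sums over [points]. Two obstacles shape the density. Since [nu] may have atoms, the
    partition cannot be read off from [v]; the reference measure lives on pairs [(p, v)] and
    charges, for each [p], only vectors constant on its cells. And since [Lambda nu (Omega f w)] is
    controlled only for nonnegative weights, while Tonelli asks for measurability on the whole
    space, the factors are replaced by expressions that agree with them on the orthant and are
    measurable everywhere. *)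

Section measure_of_functional.
Context d (T : measurableType d) (R : realType).
Variable I : (T -> \bar R) -> \bar R.
Hypothesis I_ge0 : forall g : T -> \bar R, measurable_fun setT g -> (forall x, 0 <= g x) ->
  0 <= I g.
Hypothesis I_sum : forall g : (T -> \bar R)^nat,
  (forall n, measurable_fun setT (g n)) -> (forall n x, 0 <= g n x) ->
  I (fun x => \sum_(n <oo) g n x) = \sum_(n <oo) I (g n).
Hypothesis I_scale : forall (r : R) (g : T -> \bar R), (0 <= r)%R -> measurable_fun setT g ->
  (forall x, 0 <= g x) -> I (fun x => r%:E * g x) = r%:E * I g.

Let I0 : I (fun=> 0) = 0.
Proof.
rewrite -[LHS](_ : I (fun x : T => 0%:E * (fun=> 0) x) = _).
  by rewrite I_scale ?mul0e//; exact: measurable_cst.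
by congr I; apply/funext => x; rewrite mul0e.
Qed.

(** Countable additivity applied to the sequence [g1, g2, 0, 0, ...]. *)
Let I_add (g1 g2 : T -> \bar R) : measurable_fun setT g1 -> (forall x, 0 <= g1 x) ->
  measurable_fun setT g2 -> (forall x, 0 <= g2 x) ->
  I (fun x => g1 x + g2 x) = I g1 + I g2.
Proof.
move=> mg1 g10 mg2 g20.
pose g n := if n is 0%N then g1 else if n is 1%N then g2 else fun=> 0.
have mg n : measurable_fun setT (g n) by case: n => [|[|n]] //=; exact: measurable_cst.
have g0 n x : 0 <= g n x by case: n => [|[|n]].
have split2 (u : (\bar R)^nat) : (forall n, 0 <= u n) -> (forall n, u n.+2 = 0) ->
    \sum_(n <oo) u n = u 0%N + u 1%N.
  move=> u0 u2; rewrite (nneseries_split 0 2)//.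
  rewrite eseries0 ?adde0; last by move=> [|[|n]].
  by rewrite !big_nat_recr//= big_nil add0e.
have := I_sum mg g0; rewrite (_ : (fun x => \sum_(n <oo) g n x) = (fun x => g1 x + g2 x)).
  move=> ->; rewrite split2//= => n; exact: I_ge0.
by apply/funext => x; rewrite split2.
Qed.

Let I_finsum (J : Type) (s : seq J) (g : J -> T -> \bar R) :
  (forall j, measurable_fun setT (g j)) -> (forall j x, 0 <= g j x) ->
  I (fun x => \sum_(j <- s) g j x) = \sum_(j <- s) I (g j).
Proof.
move=> mg g0; elim: s => [|j s IH].
  by rewrite big_nil -[RHS]I0; congr I; apply/funext => x; rewrite big_nil.
rewrite big_cons -IH -I_add//.
- by congr I; apply/funext => x; rewrite big_cons.
- exact: emeasurable_sum.
- by move=> x; apply: sume_ge0.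
Qed.

Let m (A : set T) : \bar R := I (fun x : T => (\1_A x : R)%:E).

Let m0 : m set0 = 0.
Proof. by rewrite /m -[RHS]I0; congr I; apply/funext => x /=; rewrite indic0. Qed.

Let mindicE (A : set T) : measurable A -> measurable_fun setT (fun x : T => (\1_A x : R)%:E).
Proof. by move=> mA; apply/measurable_EFinP; exact: measurable_indic. Qed.

Let m_ge0 (A : set T) : measurable A -> 0 <= m A.
Proof.
move=> mA; apply: I_ge0; first exact: mindicE.
by move=> x /=; rewrite lee_fin.
Qed.

(** A measure must be nonnegative on every set, while [I] is controlled on measurable functions
    only; hence the value 0 on the other sets. *)
Let m1 (A : set T) : \bar R := if pselect (measurable A) then m A else 0.

Let m1E A : measurable A -> m1 A = m A.
Proof. by rewrite /m1; case: pselect. Qed.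

Let m10 : m1 set0 = 0.
Proof. by rewrite m1E. Qed.

Let m1_ge0 A : 0 <= m1 A.
Proof. by rewrite /m1; case: pselect => // mA; exact: m_ge0. Qed.

Let m1_sigma : semi_sigma_additive m1.
Proof.
move=> F mF tF mUF; rewrite m1E// /m.
(* Pointwise in [x] this is the countable additivity of the Dirac mass at [x]. *)
have -> : (fun x : T => (\1_(\bigcup_n F n) x : R)%:E) = (fun x : T => \sum_(n <oo) (\1_(F n) x : R)%:E).
  apply/funext => x /=; apply/esym/cvg_lim => //.
  exact: (@measure_semi_sigma_additive _ _ _ (\d_x : {measure set T -> \bar R}) F mF tF mUF).
rewrite I_sum//; last by move=> n; exact: mindicE (mF n).
under [X in _ --> X]eq_eseriesr do rewrite -/(m (F _)) -m1E//.
by apply: is_cvg_nneseries => n _ _; exact: m1_ge0.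
Qed.

Let mu : {measure set T -> \bar R} :=
  HB.pack m1 (isMeasure.Build _ _ _ m1 m10 m1_ge0 m1_sigma).

Import HBSimple HBNNSimple.

Let mu_sfun (h : {sfun T >-> R}) : (forall x, 0 <= h x)%R ->
  I (fun x => (h x)%:E) = \int[mu]_x (h x)%:E.
Proof.
move=> h0.
have hE x : (h x)%:E = \sum_(y <- fset_set (range h)) y%:E * (\1_(h @^-1` [set y]) x)%:E.
  by rewrite fimfunE fsbig_finite//= -sumEFin.
under [in RHS]eq_integral do rewrite hE.
rewrite (_ : (fun x => (h x)%:E) = (fun x => \sum_(y <- fset_set (range h)) y%:E * (\1_(h @^-1` [set y]) x)%:E)); last first.
  by apply/funext => x; rewrite hE.
(* [I_scale] covers nonnegative factors only; a negative value is never taken, so its term is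
   zero. *)
have yneg (y : R) : (y < 0)%R -> h @^-1` [set y] = set0.
  by move=> y0; apply/seteqP; split => x //= hxy; have := h0 x; rewrite hxy leNgt y0.
have pos y x : 0 <= y%:E * (\1_(h @^-1` [set y]) x)%:E :> \bar R.
  have [y0|y0] := leP 0%R y; first by rewrite mule_ge0// lee_fin.
  by rewrite yneg// indic0 mule0.
have meas (y : R) : measurable_fun setT (fun x => y%:E * (\1_(h @^-1` [set y]) x)%:E).
  by apply: measurable_funeM; apply/measurable_EFinP; exact: measurable_indic.
rewrite I_finsum// ge0_integral_sum//; apply: eq_bigr => y _.
have [y0|y0] := leP 0%R y.
  rewrite I_scale//; last exact: mindicE.
  rewrite ge0_integralZl//; last exact: mindicE.
  by rewrite integral_indic// setIT -/(m _) -m1E.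
rewrite integral0_eq; last by move=> x _; rewrite yneg// indic0 mule0.
rewrite (_ : (fun x => _) = fun=> 0)//.
by apply/funext => x; rewrite yneg// indic0 mule0.
Qed.

(* A nonnegative measurable function is a countable sum of nonnegative simple
   functions, the increments of its dyadic approximations. *)
Lemma measure_of_functional : exists mu : {measure set T -> \bar R},
  forall g : T -> \bar R, measurable_fun setT g -> (forall x, 0 <= g x) ->
  I g = \int[mu]_x g x.
Proof.
exists mu => g mg g0.
pose a := nnsfun_approx measurableT mg.
pose u n : {sfun T >-> R} := if n is k.+1
    then ((a k.+1 : {sfun T >-> R}) - (a k : {sfun T >-> R}))%R else a 0%N.
have u0 n x : (0 <= u n x)%R.
  case: n => [|n] /=; first exact: fun_ge0.
  by rewrite subr_ge0; exact/lefP/nd_nnsfun_approx.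
have gE x : g x = \sum_(n <oo) (u n x)%:E.
  have ag : (a n x)%:E @[n --> \oo] --> g x by exact: cvg_nnsfun_approx.
  apply/esym/cvg_lim => //; rewrite -(cvg_shiftS _).
  apply: cvg_trans ag; apply: near_eq_cvg; apply: nearW => n /=.
  elim: n => [|n IH]; first by rewrite big_nat1.
  by rewrite big_nat_recr//= -IH -EFinD addrC subrK.
have mu_ n : measurable_fun setT (fun x => (u n x)%:E) by exact/measurable_EFinP.
have u_0 n x : 0 <= (u n x)%:E by rewrite lee_fin.
rewrite (_ : g = fun x => \sum_(n <oo) (u n x)%:E); last by apply/funext => x.
rewrite I_sum// integral_nneseries//.
by apply: eq_eseriesr => n _; exact: mu_sfun.
Qed.

End measure_of_functional.

(** * Sums over arbitrary index sets, and the measures that they define *)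

Section esum_lemmas.
Context {R : realType}.

(** One inequality holds for every [c]; for [c] finite and positive the converse is the same
    inequality for the inverse of [c]. The values 0 and +oo are treated apart. *)
Lemma esumZl (I : choiceType) (D : set I) (c : \bar R) (a : I -> \bar R) :
  0 <= c -> (forall i, D i -> 0 <= a i) ->
  \esum_(i in D) (c * a i) = c * \esum_(i in D) a i.
Proof.
have le_esumZ (c' : \bar R) (a' : I -> \bar R) : 0 <= c' ->
    (forall i, D i -> 0 <= a' i) ->
    \esum_(i in D) (c' * a' i) <= c' * \esum_(i in D) a' i.
  move=> c0 a0; apply: ge_ereal_sup => _ [X [finX XD] <-].
  rewrite fsbig_finite//= big_seq.
  rewrite -ge0_sume_distrr; last first.
    by move=> i; rewrite in_fset_set// inE => /XD; exact: a0.
  rewrite lee_wpmul2l//; apply: ereal_sup_ubound; exists X => //.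
  by rewrite fsbig_finite//= big_seq.
move=> c0 a0; apply/eqP; rewrite eq_le le_esumZ//=.
case: c c0 => [c|_|//]; last first.
  have [[i Di ai]|na] := pselect (exists2 i, D i & 0 < a i).
    apply: (le_trans (leey _)); rewrite -[X in X <= _](gt0_mulye ai).
    apply: esum_ge; exists [set i]; last by rewrite fsbig_set1.
    by split; [exact: finite_set1|move=> _ ->].
  rewrite esum1 ?mule0 ?esum_ge0//; last first.
    move=> i Di; apply/eqP; rewrite eq_le a0// andbT leNgt.
    by apply/negP => ai; apply: na; exists i.
  by move=> i Di; rewrite mule_ge0 ?a0// leey.
rewrite lee_fin => c_ge0; have [->|cN0] := eqVneq c 0%R.
  by rewrite mul0e esum_ge0// => i Di; rewrite mul0e.
have {cN0 c_ge0}c0 : (0 < c)%R by rewrite lt_neqAle eq_sym cN0.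
rewrite muleC -lee_pdivlMr// muleC.
apply: le_trans (le_esumZ _ _ _ _); last 2 first.
- by rewrite lee_fin invr_ge0 ltW.
- by move=> i Di; rewrite mule_ge0 ?a0// lee_fin ltW.
apply: le_esum => i Di; rewrite muleA -EFinM mulVf ?mul1e//.
by rewrite gt_eqF.
Qed.

Lemma esum_exchange (I J : choiceType) (A : set I) (B : set J)
    (a : I -> J -> \bar R) : (forall i j, 0 <= a i j) ->
  \esum_(i in A) \esum_(j in B) a i j = \esum_(j in B) \esum_(i in A) a i j.
Proof.
move=> a0; rewrite !esum_esum//.
rewrite (reindex_esum (B `*`` (fun=> A)) _ (fun x => (x.2, x.1)))//; split=> //=.
- by move=> [i j] [/=].
- by move=> [i1 i2] [j1 j2] /= _ _ [] -> ->.
- by move=> [i1 i2] [Pi1 Qi2] /=; exists (i2, i1).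
Qed.

Lemma esum_nneseries (I : choiceType) (A : set I) (a : nat -> I -> \bar R) :
  (forall n i, 0 <= a n i) ->
  \esum_(i in A) \sum_(n <oo) a n i = \sum_(n <oo) \esum_(i in A) a n i.
Proof.
move=> a0; rewrite nneseries_esumT; last by move=> n; exact: esum_ge0.
rewrite esum_exchange//; apply: eq_esum => i _.
by rewrite nneseries_esumT.
Qed.

End esum_lemmas.

(** The sum of the Dirac masses at the [e i], repetitions included. As [D] is arbitrary, it applies
    to sums over tuples of points before anything is known about their number. *)
Lemma esum_measure d (T : measurableType d) (R : realType) (I : choiceType)
    (D : set I) (e : I -> T) : exists m : {measure set T -> \bar R},
  forall g : T -> \bar R, measurable_fun setT g -> (forall x, 0 <= g x) ->
  \int[m]_x g x = \esum_(i in D) g (e i).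
Proof.
have [|||m mE] := @measure_of_functional d T R (fun g => \esum_(i in D) g (e i)).
- by move=> g _ g0; exact: esum_ge0.
- by move=> g _ g0; rewrite esum_nneseries.
- by move=> r g r0 _ g0; rewrite esumZl.
- by exists m => g mg g0; rewrite -mE.
Qed.

(** The mixture of the measures [l x] with weight [h]. With Dirac masses for [l] it yields densities
    and image measures; with random point sums for [l] it yields the expectation in the Mecke
    formula. *)
Lemma mixture_measure d1 d2 (X : measurableType d1) (Y : measurableType d2)
    (R : realType) (mu : {measure set X -> \bar R}) (h : X -> R)
    (l : X -> {measure set Y -> \bar R}) :
  measurable_fun setT h -> (forall x, 0 <= h x)%R ->
  (forall U, measurable U -> measurable_fun setT (l ^~ U)) ->
  exists m : {measure set Y -> \bar R},
  forall g : Y -> \bar R, measurable_fun setT g -> (forall x, 0 <= g x) ->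
  \int[m]_y g y = \int[mu]_x ((h x)%:E * \int[l x]_y g y).
Proof.
move=> mh h0 ml.
have mint (g : Y -> \bar R) : measurable_fun setT g -> (forall x, 0 <= g x) ->
    measurable_fun setT (fun x => (h x)%:E * \int[l x]_y g y).
  move=> mg g0; apply: emeasurable_funM; first exact/measurable_EFinP.
  exact: measurable_fun_integral_kernel.
have int0 (g : Y -> \bar R) : (forall x, 0 <= g x) ->
    forall x, 0 <= (h x)%:E * \int[l x]_y g y.
  by move=> g0 x; rewrite mule_ge0 ?lee_fin ?integral_ge0.
have [|||m mE] := @measure_of_functional d2 Y R
  (fun g => \int[mu]_x ((h x)%:E * \int[l x]_y g y)).
- by move=> g mg g0; apply: integral_ge0 => x _; exact: int0.
- move=> g mg g0; rewrite -integral_nneseries//; last 2 first.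
    by move=> n; exact: mint.
    by move=> n x _; exact: int0.
  apply: eq_integral => x _; rewrite integral_nneseries// -nneseriesZl// => n _.
  exact: integral_ge0.
- move=> r g r0 mg g0; rewrite -ge0_integralZl//; last 2 first.
    exact: mint.
    by move=> x _; exact: int0.
  apply: eq_integral => x _; rewrite ge0_integralZl// muleCA//.
- by exists m => g mg g0; rewrite -mE.
Qed.

Lemma density_measure d (T : measurableType d) (R : realType)
    (mu : {measure set T -> \bar R}) (h : T -> R) :
  measurable_fun setT h -> (forall x, 0 <= h x)%R ->
  exists m : {measure set T -> \bar R},
  forall g : T -> \bar R, measurable_fun setT g -> (forall x, 0 <= g x) ->
  \int[m]_x g x = \int[mu]_x ((h x)%:E * g x).
Proof.
move=> mh h0.
have [||U mU|m mE] := @mixture_measure _ _ T T R mu h (fun x => \d_x) => //.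
  exact: measurable_fun_dirac.
exists m => g mg g0; rewrite mE//; apply: eq_integral => x _.
by rewrite integral_dirac// diracT mul1e.
Qed.

Lemma measure_integral d (T : measurableType d) (R : realType)
    (m : {measure set T -> \bar R}) (A : set T) : measurable A ->
  m A = \int[m]_x (\1_A x)%:E.
Proof. by move=> mA; rewrite integral_indic// setIT. Qed.

Section integral_cover.
Import HBNNSimple.

(** Sections cut by [E n] have measurable measure because each [l x] is finite there; then [n] tends
    to infinity. The bound may depend on [x], as it does for sums over tuples of points of [N],
    which are finite on bounded sets but not uniformly in the outcome. *)
Lemma measurable_fun_integral_cover d1 d2 (X : measurableType d1)
    (Y : measurableType d2) (R : realType) (l : X -> {measure set Y -> \bar R})
    (E : (set Y)^nat) :
  (forall U, measurable U -> measurable_fun setT (l ^~ U)) ->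
  (forall n, measurable (E n)) -> nondecreasing_seq E ->
  \bigcup_n E n = setT -> (forall x n, l x (E n) < +oo) ->
  forall k : X * Y -> \bar R, (forall z, 0 <= k z) -> measurable_fun setT k ->
  measurable_fun setT (fun x => \int[l x]_y k (x, y)).
Proof.
move=> ml mE ndE EU lE k k0 mk.
pose K : R.-ker X ~> Y := HB.pack l (isKernel.Build _ _ _ _ R l ml).
have mxs A : measurable A -> measurable_fun setT (fun x => l x (xsection A x)).
  move=> mA.
  have mn n : measurable_fun setT (fun x => mrestr (l x) (mE n) (xsection A x)).
    have [] := @measurable_prod_subset_xsection_kernel _ _ _ _ R K _ (mE n) _ A mA => //.
    move=> x; have := lE x n; rewrite -ge0_fin_numE// => fin.
    exists (fine (l x (E n)) + 1)%R => U mU.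
    rewrite (@le_lt_trans _ _ (l x (E n)))//.
      by rewrite /mrestr le_measure ?inE//; exact: measurableI.
    by rewrite EFinD fineK// lteDl// lte_fin.
  apply: (emeasurable_fun_cvg
    (fun n x => mrestr (l x) (mE n) (xsection A x))) => // x _.
  rewrite /mrestr -[X in _ --> l x X]setIT -EU setI_bigcupr.
  apply: nondecreasing_cvg_mu.
  - by move=> n; apply: measurableI => //; exact: measurable_xsection.
  - apply: bigcupT_measurable => n; apply: measurableI => //.
    exact: measurable_xsection.
  - move=> i j ij; apply/subsetPset; apply: setIS.
    exact/subsetPset/ndE.
pose k_ := nnsfun_approx measurableT mk.
apply: (@measurable_fun_xsection_integral _ _ _ _ _ _ _ k_).
- by move=> a b ab; exact/nd_nnsfun_approx.
- by move=> z; exact/cvg_nnsfun_approx.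
- by move=> n r; refine (mxs _ _); exact: measurable_funPTI.
Qed.

End integral_cover.

Section sigma_finite_measureP.
Context d (T : measurableType d) (R : realType).
Variables (m : {measure set T -> \bar R}) (sm : sigma_finite setT m).

Let m' : set T -> \bar R := m.
HB.instance Definition _ := Measure.on m'.
HB.instance Definition _ := Measure_isSigmaFinite.Build _ _ _ m' sm.

Lemma sigma_finite_measureP :
  exists mu : {sigma_finite_measure set T -> \bar R}, forall A, mu A = m A.
Proof. by exists m'. Qed.

End sigma_finite_measureP.

Lemma eq_integral_set_fun d (T : measurableType d) (R : realType)
    (mu : set T -> \bar R) (D : set T) (f g : T -> \bar R) :
  {in D, f =1 g} -> \int[mu]_(x in D) f x = \int[mu]_(x in D) g x.
Proof. by rewrite /integral => /eq_restrictP->. Qed.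

(** * Iterated integrals as integrals against sigma-finite measures *)

Section iter_integral.
Context d (T : measurableType d) (R : realType).

Lemma eq_iter_integral (mu : set T -> \bar R) (D : set T) k
    (g h : k.-tuple T -> \bar R) :
  (forall t, (forall i, D (tnth t i)) -> g t = h t) ->
  iter_integral mu D g = iter_integral mu D h.
Proof.
elim: k g h => [|k IH] g h gh /=; first by apply: gh => -[].
apply: eq_integral_set_fun => x /[!inE] Dx; apply: IH => t Dt; apply: gh => i.
by case: (unliftP ord0 i) => [j ->|->]; rewrite ?tnthS ?tnth0.
Qed.

Variables (mu : {sigma_finite_measure set T -> \bar R}).

Let consP k (z : T * k.-tuple T) : k.+1.-tuple T := cons_tuple z.1 z.2.

Let mconsP k : measurable_fun setT (@consP k).
Proof. exact: (measurable_cons measurable_fst measurable_snd). Qed.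

Let mcons k (x : T) : measurable_fun setT (fun t : k.-tuple T => cons_tuple x t).
Proof. exact: (measurable_cons (measurable_cst x) (@measurable_id _ _ _)). Qed.

(** The measure on [k.+1]-tuples is the image under [cons_tuple] of [mu \x m], weighted by the
    indicator of [D] in the first coordinate; Tonelli makes its integral the iterated one.
    Sigma-finiteness belongs to the claim because the induction forms the next product measure. *)
Lemma iter_measure (D : set T) k : measurable D ->
  exists m : {sigma_finite_measure set (k.-tuple T) -> \bar R},
    forall g : k.-tuple T -> \bar R, measurable_fun setT g ->
      (forall t, 0 <= g t) -> iter_integral mu D g = \int[m]_t g t.
Proof.
move=> mD; elim: k => [|k [m IH]].
  exists (\d_([tuple] : 0.-tuple T)) => g mg g0 /=.
  by rewrite integral_dirac// diracT mul1e.
have mh : measurable_fun setT (fun z : T * k.-tuple T => \1_D z.1 : R).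
  apply: (@measurableT_comp _ _ _ _ _ _ (\1_D : T -> R)) => //.
have h0 (z : T * k.-tuple T) : (0 <= (\1_D z.1 : R))%R by [].
have [U mU|m1 m1E] := @mixture_measure _ _ (T * k.-tuple T)%type _ R
    (mu \x m) (fun z => \1_D z.1) (fun z => \d_(consP z)) mh h0.
  have mdU : measurable_fun setT (fun t : k.+1.-tuple T => \d_t U : \bar R).
    exact: measurable_fun_dirac.
  exact: (measurableT_comp mdU (@mconsP k)).
have m1E' g : measurable_fun setT g -> (forall t, 0 <= g t) ->
    \int[m1]_t g t = \int[mu \x m]_z ((\1_D z.1)%:E * g (consP z)).
  move=> mg g0; rewrite m1E//; apply: eq_integral => z _.
  by rewrite integral_dirac// diracT mul1e.
have mth : measurable_fun setT
    (fun t : k.+1.-tuple T => (thead t, [tuple of behead t])).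
  apply: measurable_fun_pair; last exact: measurable_behead.
  exact: measurable_tnth.
(* Products of the two covers, pulled back by splitting a tuple into head and tail; the covers are
   monotone, so one index serves both. *)
have sf1 : sigma_finite setT m1.
  have /sigma_finiteP[F1 [TF ndF F1oo]] := sigma_finiteT mu.
  have /sigma_finiteP[F2 [TG ndG F2oo]] := sigma_finiteT m.
  pose F n := F1 n `*` F2 n.
  have mF n : measurable (F n).
    by apply: measurableX; [have [] := F1oo n|have [] := F2oo n].
  exists (fun n => (fun t : k.+1.-tuple T => (thead t, [tuple of behead t])) @^-1` F n).
    rewrite -preimage_bigcup; apply/esym; rewrite -subTset => t _ /=.
    have : setT (thead t) by []; rewrite TF => -[i _ Fi].
    have : setT ([tuple of behead t] : k.-tuple T) by []; rewrite TG => -[j _ Gj].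
    exists (maxn i j) => //; split => /=.
      by apply: (subsetPset _ _ (ndF _ _ (leq_maxl i j))).
    by apply: (subsetPset _ _ (ndG _ _ (leq_maxr i j))).
  move=> n; have Foo : (mu \x m) (F n) < +oo.
    have [? ?] := F1oo n; have [? ?] := F2oo n.
    by rewrite /F product_measure1E// lte_mul_pinfty// ge0_fin_numE.
  have mF' : measurable ((fun t : k.+1.-tuple T => (thead t, [tuple of behead t])) @^-1` F n).
    by rewrite -[X in measurable X]setTI; exact: mth.
  split=> //; rewrite measure_integral// m1E'//; last first.
    exact/measurable_EFinP/measurable_indic.
  apply: le_lt_trans Foo; rewrite measure_integral//; apply: ge0_le_integral => //.
  - apply: emeasurable_funM; first exact/measurable_EFinP.
    apply/measurable_EFinP.
    have mi := @measurable_indic _ _ R setT _ mF'.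
    exact: (measurableT_comp mi (@mconsP k)).
  - exact/measurable_EFinP/measurable_indic.
  - move=> z _; rewrite -EFinM lee_fin !indicE.
    rewrite (_ : (consP z \in _) = (z \in F n)).
      by case: (z.1 \in D); rewrite ?(mul1r, mul0r).
    apply/idP/idP; rewrite !inE /=; case: z => z1 z2 /=.
      by rewrite theadE; rewrite (_ : [tuple of _] = z2)//; exact: val_inj.
    by rewrite theadE; rewrite (_ : [tuple of _] = z2)//; exact: val_inj.
have [m2 m2E] := sigma_finite_measureP sf1.
exists m2 => g mg g0 /=.
rewrite (eq_measure_integral m1); last by move=> A _ _; rewrite m2E.
rewrite m1E'// fubini_tonelli1//=; last 2 first.
- apply: emeasurable_funM; first exact/measurable_EFinP.
  exact: (measurableT_comp mg (@mconsP k)).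
- by move=> z; rewrite mule_ge0// lee_fin.
rewrite [LHS]integral_mkcond; apply: eq_integral => x _.
rewrite /fubini_F /= ge0_integralZl//; last exact: (measurableT_comp mg (mcons x)).
rewrite patchE indicE; case: ifPn => xD; last by rewrite mul0e.
by rewrite mul1e IH//; exact: (measurableT_comp mg (mcons x)).
Qed.

Lemma measurable_iter_integral_cons (D : set T) k (g : k.+1.-tuple T -> \bar R) :
  measurable D -> measurable_fun setT g -> (forall t, 0 <= g t) ->
  measurable_fun setT (fun x => iter_integral mu D (fun t => g (cons_tuple x t))).
Proof.
move=> mD mg g0; have [m mE] := @iter_measure D k mD.
under eq_fun.
  move=> x; rewrite mE//; last exact: (measurableT_comp mg (mcons x)).
  over.
apply: (@measurable_fun_fubini_tonelli_F _ _ _ _ R m (fun z => g (consP z))) => //.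
exact: (measurableT_comp mg (@mconsP k)).
Qed.

Lemma iter_integralZl (D : set T) k (c : \bar R) (g : k.-tuple T -> \bar R) :
  measurable D -> 0 <= c -> measurable_fun setT g -> (forall t, 0 <= g t) ->
  iter_integral mu D (fun t => c * g t) = c * iter_integral mu D g.
Proof.
move=> mD c0 mg g0; have [m mE] := @iter_measure D k mD.
rewrite !mE ?ge0_integralZl//; first exact: measurable_funeM.
by move=> t; rewrite mule_ge0.
Qed.

Lemma measurable_prod_tnth j (e : 'I_j -> T -> \bar R) :
  (forall i, measurable_fun setT (e i)) -> (forall i x, 0 <= e i x) ->
  measurable_fun setT (fun t : j.-tuple T => \prod_(i < j) e i (tnth t i)).
Proof.
move=> me e0; elim: (index_enum _) => [|i s IH].
  by under eq_fun do rewrite big_nil; exact: measurable_cst.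
under eq_fun do rewrite big_cons.
apply: emeasurable_funM => //.
exact: (measurableT_comp (me i) (@measurable_tnth _ _ _ i)).
Qed.

Lemma iter_integral_prod (D : set T) k (h : 'I_k -> T -> \bar R) :
  measurable D -> (forall i, measurable_fun setT (h i)) ->
  (forall i x, 0 <= h i x) ->
  iter_integral mu D (fun t => \prod_(i < k) h i (tnth t i)) =
  \prod_(i < k) \int[mu]_(x in D) h i x.
Proof.
move=> mD; elim: k h => [|k IH] h mh h0 /=; first by rewrite !big_ord0.
rewrite big_ord_recl -IH// muleC -ge0_integralZl//; last 2 first.
- exact: measurable_funTS.
- rewrite (IH (fun i => h (lift ord0 i)))//; apply: prode_ge0 => i _.
  by apply: integral_ge0 => x _; exact: h0.
apply: eq_integral => x Dx; rewrite muleC -iter_integralZl//; last 2 first.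
- exact: (@measurable_prod_tnth _ (fun i => h (lift ord0 i))).
- by move=> t; apply: prode_ge0.
apply: eq_iter_integral => t _; rewrite big_ord_recl tnth0; congr (_ * _).
by apply: eq_bigr => i _; rewrite tnthS.
Qed.

Lemma iter_integral_density (mu' : {measure set T -> \bar R}) (h : T -> R) k
    (g : k.-tuple T -> \bar R) :
  measurable_fun setT h -> (forall x, 0 <= h x)%R ->
  (forall g : T -> \bar R, measurable_fun setT g -> (forall x, 0 <= g x) ->
    \int[mu']_x g x = \int[mu]_x ((h x)%:E * g x)) ->
  measurable_fun setT g -> (forall t, 0 <= g t) ->
  iter_integral mu' setT g =
  iter_integral mu setT (fun t => (\prod_(i < k) (h (tnth t i))%:E) * g t).
Proof.
move=> mh h0 mu'E; elim: k g => [|k IH] g mg g0 /=.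
  by rewrite big_ord0 mul1e.
have mph j : measurable_fun setT (fun t : j.-tuple T => \prod_(i < j) (h (tnth t i))%:E).
  apply: (@measurable_prod_tnth _ (fun=> EFin \o h)) => [i|i x /=].
    exact/measurable_EFinP.
  by rewrite lee_fin.
have ph0 j (t : j.-tuple T) : 0 <= \prod_(i < j) (h (tnth t i))%:E.
  by apply: prode_ge0 => i _; rewrite lee_fin.
under eq_integral => x _.
  rewrite IH//; last exact: (measurableT_comp mg (mcons x)).
  over.
rewrite mu'E; last 2 first.
(* [measurable_iter_integral_cons] wants a function of the whole tuple, so [t] is written as the
   tail of [cons_tuple x t]. *)
- rewrite (_ : (fun x => _) = fun x => iter_integral mu setT (fun t =>
      (\prod_(i < k) (h (tnth (behead_tuple (cons_tuple x t)) i))%:E) * g (cons_tuple x t))).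
    apply: (@measurable_iter_integral_cons setT k
      (fun t => (\prod_(i < k) (h (tnth (behead_tuple t) i))%:E) * g t)) => //; last first.
      by move=> t; rewrite mule_ge0.
    apply: emeasurable_funM => //.
    exact: (measurableT_comp (mph k) (@measurable_behead _ _ _)).
  apply/funext => x; apply: eq_iter_integral => t _.
  by rewrite (_ : behead_tuple (cons_tuple x t) = t)//; exact: val_inj.
- move=> x; have [m mE] := @iter_measure setT k measurableT.
  rewrite mE; first by apply: integral_ge0 => t _; rewrite mule_ge0.
    by apply: emeasurable_funM; [exact: mph|exact: (measurableT_comp mg (mcons x))].
  by move=> t; rewrite mule_ge0.
apply: eq_integral => x _; rewrite -iter_integralZl//; last 3 first.
- by rewrite lee_fin.
- by apply: emeasurable_funM; [exact: mph|exact: (measurableT_comp mg (mcons x))].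
- by move=> t; rewrite mule_ge0.
apply: eq_iter_integral => t _; rewrite muleA big_ord_recl tnth0; congr (_ * _ * _).
by apply: eq_bigr => i _; rewrite tnthS.
Qed.

End iter_integral.

(** * Rectangles and the sigma-algebra of tuples *)

Section tuple_sigma_algebra.
Context d (T : measurableType d) (R : realType) (k : nat).

Definition rect (B : 'I_k -> set T) : set (k.-tuple T) :=
  [set t | forall i, B i (tnth t i)].

Lemma measurable_rect (B : 'I_k -> set T) : (forall i, measurable (B i)) ->
  measurable (rect B).
Proof.
move=> mB; rewrite (_ : rect B = \big[setI/setT]_(i < k) ((@tnth k T)^~ i @^-1` B i)).
  apply: bigsetI_measurable => i _.
  by rewrite -[X in measurable X]setTI; exact: measurable_tnth.
rewrite -bigcap_seq; apply/seteqP; split => t /= h i; first by move=> _; exact: h.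
by apply: h => /=; exact: mem_index_enum.
Qed.

Let rects : set (set (k.-tuple T)) :=
  [set rect B | B in [set B | forall i, measurable (B i)]].

(** The generating cylinders are rectangles with all sides but one equal to [setT]. *)
Lemma measurable_tuple_rect : measurable = <<s rects >>.
Proof.
apply/seteqP; split; last first.
  apply: smallest_sub; first exact: sigma_algebra_measurable.
  by move=> _ [B mB <-]; exact: measurable_rect.
apply: smallest_sub; first exact: smallest_sigma_algebra.
move=> A; rewrite -bigcup_seq/= => -[i _ [B mB <-]].
apply: sub_sigma_algebra; exists (fun j => if j == i then B else setT).
  by move=> j; case: ifP.
rewrite setTI; apply/seteqP; split => t /=.
  by move=> /(_ i); rewrite eqxx.
by move=> Bt j; case: eqP => [->|].
Qed.

Let rectsI : setI_closed rects.
Proof.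
move=> _ _ [B mB <-] [C mC <-]; exists (fun i => B i `&` C i).
  by move=> i; exact: measurableI.
by apply/seteqP; split => t /=; [move=> h; split=> i; have [] := h i|move=> [h1 h2] i].
Qed.

Variables (E : (set T)^nat) (mE : forall n, measurable (E n)).
Hypotheses (ndE : nondecreasing_seq E) (EU : \bigcup_n E n = setT).

Lemma rect_cover : \bigcup_n rect (fun=> E n) = setT.
Proof.
rewrite -subTset => t _.
have /choice[e eP] i : exists n, E n (tnth t i).
  by have : setT (tnth t i) by []; rewrite -EU => -[n _ Ent]; exists n.
exists (\max_(i < k) e i)%N => //= i.
by apply: (subsetPset _ _ (ndE (leq_bigmax i))); exact: eP.
Qed.

Lemma nondecreasing_rect : nondecreasing_seq (fun n => rect (fun=> E n)).
Proof.
by move=> i j ij; apply/subsetPset => t h l; apply: (subsetPset _ _ (ndE ij)).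
Qed.

Lemma cvg_measure_rect (m : {measure set (k.-tuple T) -> \bar R}) A :
  measurable A -> m (A `&` rect (fun=> E n)) @[n --> \oo] --> m A.
Proof.
move=> mA; have rE n : measurable (rect (fun=> E n)) by exact: measurable_rect.
have := @nondecreasing_cvg_mu _ _ _ m (fun n => A `&` rect (fun=> E n)).
rewrite -setI_bigcupr rect_cover setIT; apply => //.
- by move=> n; exact: measurableI.
- move=> i j ij; apply/subsetPset; apply: setIS.
  exact/subsetPset/nondecreasing_rect.
Qed.

(** Rectangles are stable under intersection and generate, so agreement on them suffices given
    finiteness on an exhausting sequence. Agreement is asked only within some [E n], where
    expectations over a Poisson measure reduce to counts; continuity from below extends it to all
    rectangles. *)
Lemma tuple_measure_unique (m1 m2 : {measure set (k.-tuple T) -> \bar R}) :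
  (forall B, (forall i, measurable (B i)) ->
    (exists n, forall i, B i `<=` E n) -> m1 (rect B) = m2 (rect B)) ->
  (forall n, m1 (rect (fun=> E n)) < +oo) ->
  forall A, measurable A -> m1 A = m2 A.
Proof.
move=> m12 m1oo A mA.
have rE n : measurable (rect (fun=> E n)) by exact: measurable_rect.
have m12r B : (forall i, measurable (B i)) -> m1 (rect B) = m2 (rect B).
  move=> mB.
  have cvgm (m : {measure set (k.-tuple T) -> \bar R}) :
      m (rect (fun i => B i `&` E n)) @[n --> \oo] --> m (rect B).
    have rBE n : rect (fun i => B i `&` E n) = rect B `&` rect (fun=> E n).
      by apply/seteqP; split=> t; [move=> h; split=> i; have [] := h i|move=> [? ?] i].
    under eq_fun do rewrite rBE.
    by apply: cvg_measure_rect; exact: measurable_rect.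
  rewrite -(cvg_lim _ (cvgm m1))// -(cvg_lim _ (cvgm m2))//.
  congr (limn _); apply/funext => n; apply: m12.
    by move=> i; exact: measurableI.
  by exists n => i.
apply: (@g_sigma_algebra_measure_unique _ _ _ rects _ (fun n => rect (fun=> E n))).
- by move=> _ [B mB <-]; exact: measurable_rect.
- by move=> n; exists (fun=> E n).
- exact: rect_cover.
- exact: rectsI.
- by move=> _ [B mB <-]; exact: m12r.
- exact: m1oo.
- by rewrite -measurable_tuple_rect.
Qed.

(** A lambda-system argument run inside [rect (fun=> E n)], where finiteness makes the measure of a
    proper difference the difference of the measures; then [n] grows. *)
Lemma tuple_kernel_measurable d' (X : measurableType d')
    (l : X -> {measure set (k.-tuple T) -> \bar R}) :
  (forall B, (forall i, measurable (B i)) ->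
    (exists n, forall i, B i `<=` E n) ->
    measurable_fun setT (fun x => l x (rect B))) ->
  (forall x n, l x (rect (fun=> E n)) < +oo) ->
  forall A, measurable A -> measurable_fun setT (fun x => l x A).
Proof.
move=> ml loo A mA.
have rE n : measurable (rect (fun=> E n)) by exact: measurable_rect.
apply: (emeasurable_fun_cvg (fun n x => l x (A `&` rect (fun=> E n)))); last first.
  by move=> x _; exact: cvg_measure_rect.
move=> n.
pose H : set (set (k.-tuple T)) := [set A | measurable A /\
  measurable_fun setT (fun x => l x (A `&` rect (fun=> E n)))].
suff : measurable `<=` H by move=> /(_ _ mA)[].
rewrite measurable_tuple_rect; apply: lambda_system_subset => //.
- have HT : H setT.
    split=> //.
    rewrite (_ : (fun x => _) = fun x => l x (rect (fun=> E n))).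
      by refine (ml _ _ _); [move=> _|exists n => i t].
    by apply/funext => x; rewrite setTI.
  split => // [U V VU [mU hU] [mV hV]|F ndF HF].
    split; first exact: measurableD.
    rewrite (_ : (fun x => _) = (fun x => l x (U `&` rect (fun=> E n))
        - l x (V `&` rect (fun=> E n)))); first exact: emeasurable_funB.
    apply/funext => x.
    have -> : (U `\` V) `&` rect (fun=> E n) =
        (U `&` rect (fun=> E n)) `\` (V `&` rect (fun=> E n)).
      apply/seteqP; split=> t /=; last by tauto.
      by move=> [[? ?] ?]; split=> // -[].
    rewrite measureD; [|exact: measurableI|exact: measurableI|].
      congr (_ - l x _); apply/seteqP; split=> t /=; first by tauto.
      by move=> [Vt Et]; split=> //; split=> //; exact: VU.
    by rewrite (le_lt_trans _ (loo x n))// le_measure ?inE//; exact: measurableI.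
  have mF i : measurable (F i) by have [] := HF i.
  split; first exact: bigcupT_measurable.
  apply: (emeasurable_fun_cvg (fun i x => l x (F i `&` rect (fun=> E n)))).
    by move=> i; have [] := HF i.
  move=> x _; rewrite setI_bigcupl; apply: nondecreasing_cvg_mu.
  - by move=> i; exact: measurableI.
  - by apply: bigcupT_measurable => i; exact: measurableI.
  - by move=> i j ij; apply/subsetPset; apply: setSI; exact/subsetPset/ndF.
- move=> _ [B mB <-]; split; first exact: measurable_rect.
  rewrite (_ : (fun x => _) = (fun x => l x (rect (fun i => B i `&` E n)))).
    by refine (ml _ _ _); [move=> i; exact: measurableI|exists n => i t []].
  apply/funext => x; congr (l x _).
  by apply/seteqP; split=> t; [move=> [? ?] i|move=> h; split=> i; have [] := h i].
Qed.

End tuple_sigma_algebra.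

(** * Integer-valued measures as sums over their points *)

Section metric_borel.
Context {R : realType} {V : completeMetricType R}.

Lemma open_ball_metric (x : V) (r : R) : open (ball x r).
Proof.
rewrite openE => y; rewrite ballEmdist /= => xy.
apply/nbhs_ballP; exists (r - mdist x y)%R => /=; first by rewrite subr_gt0.
move=> z; rewrite !ballEmdist /= => yz.
by rewrite (le_lt_trans (metric_triangle x y z))// -ltrBrDl.
Qed.

Lemma measurable_ball (x : V) (r : R) : measurable (ball x r : set (borel V)).
Proof. by apply: sub_sigma_algebra; exact: open_ball_metric. Qed.

Lemma measurable_set1_borel (x : borel V) : measurable [set x].
Proof.
rewrite -[[set x]]setCK; apply: measurableC; apply: sub_sigma_algebra.
apply: closed_openC; apply: accessible_closed_set1.
by apply: hausdorff_accessible; exact: (@metric_hausdorff R V).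
Qed.

Definition big_ball (n : nat) : set (borel V) := ball (point : V) n.+1%:R.

Lemma measurable_big_ball n : measurable (big_ball n).
Proof. exact: measurable_ball. Qed.

Lemma bounded_big_ball n : @bounded_subset R V (big_ball n).
Proof. by exists point, n.+1%:R. Qed.

Lemma nondecreasing_big_ball : nondecreasing_seq big_ball.
Proof.
move=> i j ij; apply/subsetPset => x; apply: le_ball.
by rewrite ler_nat ltnS.
Qed.

Lemma bigcup_big_ball : \bigcup_n big_ball n = setT.
Proof.
rewrite -subTset => x _.
exists (Num.truncn (mdist (point : V) x)) => //.
by rewrite /big_ball ballEmdist /=; exact: truncnS_gt.
Qed.

Lemma sub_bounded (A B : set V) : A `<=` B -> bounded_subset B -> bounded_subset A.
Proof. by move=> AB [x [r Br]]; exists x, r; exact: subset_trans Br. Qed.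

End metric_borel.

Section point_measure.
Context {R : realType} {V : completeMetricType R}.
Hypothesis Vsep : separable V.
Variable m : {measure set (borel V) -> \bar R}.
Hypothesis m_int : forall A : set (borel V), measurable A ->
  @bounded_subset R V A -> exists k : nat, m A = k%:R%:E.

Let At : set (borel V) := [set x | 0 < m [set x]].

Let bset1 (x : borel V) : @bounded_subset R V [set x].
Proof. by exists x, 1%R => _ ->; exact: ballxx. Qed.

Let At_ge1 x : At x -> 1 <= m [set x].
Proof.
rewrite /At /=; have [k ->] := m_int (measurable_set1_borel x) (@bset1 x).
by rewrite lte_fin lee_fin ltr0n ler1n.
Qed.

Let size_le (s : seq (borel V)) : uniq s -> (forall x, x \in s -> At x) ->
  measurable [set` s] /\ (size s)%:R%:E <= m [set` s].
Proof.
elim: s => [_ _|x s IH /= /andP[xs us] sAt].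
  by rewrite set_nil; split => //; rewrite measure0.
have [|ms les] := IH us; first by move=> y ys; apply: sAt; rewrite inE ys orbT.
have mx := measurable_set1_borel x.
have -> : [set` x :: s] = [set x] `|` [set` s].
  apply/seteqP; split=> y /=; rewrite inE; first by move=> /orP[/eqP|]; [left|right].
  by move=> [->|->]; rewrite ?eqxx ?orbT.
split; first exact: measurableU.
rewrite measureU//; last first.
  by apply/seteqP; split=> // y [/= ->]; rewrite (negPf xs).
rewrite -natr1 EFinD addeC leeD//; apply: At_ge1; apply: sAt.
by rewrite inE eqxx.
Qed.

(** Each atom has mass at least one and a big ball has finite mass, so a big ball contains finitely
    many atoms. *)
Let countable_At : countable At.
Proof.
rewrite -[At]setIT -bigcup_big_ball setI_bigcupr.
apply: bigcup_countable => // n _; apply: finite_set_countable.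
apply: contrapT => /infinite_set_fset inf.
have [k mk] := m_int (measurable_big_ball n) (bounded_big_ball n).
have [B BA] := inf k.+1; rewrite leqNgt => /negP; apply.
have [||mB leB] := @size_le (enum_fset B); first exact: fset_uniq.
  by move=> x xB; have [] := BA x xB.
rewrite ltnS -(@ler_nat R) -lee_fin -mk (le_trans leB)// le_measure ?inE//.
  exact: measurable_big_ball.
by move=> x xB; have [] := BA x xB.
Qed.

Let measurable_At : measurable At.
Proof. by apply: countable_measurable => // x; exact: measurable_set1_borel. Qed.

(* Continuity from above along balls shrinking to [x] makes the mass of a small
   ball off its atoms less than one, hence null; countably many such balls cover
   by separability. *)
Let m_At0 : m (~` At) = 0.
Proof.
have mC : measurable (~` At) by exact: measurableC.
have small (x : V) : exists2 r : R, (0 < r)%R & m (ball x r `&` ~` At) = 0.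
  pose B (j : nat) : set (borel V) := ball x (j.+1%:R^-1)%R `&` ~` At.
  have mB j : measurable (B j) by apply: measurableI => //; exact: measurable_ball.
  have bB j : @bounded_subset R V (B j).
    by exists x, (j.+1%:R^-1)%R => y [].
  have mcB : measurable (\bigcap_j B j) by exact: bigcapT_measurable.
  have capB : m (\bigcap_j B j) = 0.
    have sB : \bigcap_j B j `<=` [set x].
      move=> y yB; have [_ _] := yB 0%N Logic.I.
      apply: contrapT => /eqP yx.
      have d0 : (0 < mdist x y)%R by rewrite mdist_gt0 eq_sym.
      have [N _ /(_ N (leqnn N))] := near_infty_natSinv_lt (PosNum d0).
      apply/negP; rewrite /= -leNgt ltW//.
      by have [+ _] := yB N Logic.I; rewrite ballEmdist.
    have [Ax|nAx] := pselect (At x).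
      rewrite (_ : \bigcap_j B j = set0) ?measure0//.
      apply/seteqP; split=> // y yB; have [_] := yB 0%N Logic.I.
      by rewrite (sB _ yB).
    apply/eqP; rewrite -measure_le0.
    apply: (@le_trans _ _ (m [set x])); last by rewrite leNgt; apply/negP.
    by apply: le_measure => //; rewrite inE//; exact: measurable_set1_borel.
  have : m (B n) @[n --> \oo] --> m (\bigcap_j B j).
    apply: nonincreasing_cvg_mu => //.
      by have [k ->] := m_int (mB 0%N) (bB 0%N); rewrite ltry.
    move=> i j ij; apply/subsetPset; apply: setSI; apply: le_ball.
    by rewrite lef_pV2 ?posrE ?ltr0n// ler_nat.
  rewrite capB => cv0.
  have [[N]|nB] := pselect (exists N, m (B N) < 1); last first.
    have : 1 <= 0 :> \bar R; last by rewrite leNgt lte01.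
    apply: (cvge_to_ge cv0); apply: nearW => n; rewrite leNgt; apply/negP => Bn.
    by apply: nB; exists n.
  have [k mBN] := m_int (mB N) (bB N); rewrite mBN lte_fin ltrn1 ltnS leqn0 => /eqP k0.
  by exists (N.+1%:R^-1)%R; rewrite ?invr_gt0 ?ltr0n// -/(B N) mBN k0.
have [D cD dD] := Vsep.
have /countable_injP[c cI] := cD.
(* [e] enumerates the dense set through the injection [c]; [F i k] keeps the ball about [e i] of
   radius 1/(k+1) only if that ball is null off the atoms. *)
pose e i : V := xget point [set d | D d /\ c d = i].
pose G i k : set (borel V) := ball (e i) (k.+1%:R^-1)%R `&` ~` At.
pose F i k : set (borel V) := if m (G i k) == 0 then G i k else set0.
apply/negligibleP => //.
have FN : m.-negligible (\bigcup_i \bigcup_k F i k).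
  apply: negligible_bigcup => i; apply: negligible_bigcup => k.
  apply/negligibleP; rewrite /F; case: ifPn => [/eqP//|_]; last exact: measure0.
  - by move=> _; apply: measurableI => //; exact: measurable_ball.
  - by [].
apply: negligibleS FN => x xA; have [r r0 xr0] := small x.
(* With a radius below [r / 2], a ball about a dense point that contains [x] stays within
   [ball x r]. *)
have r20 : (0 < r / 2)%R by rewrite divr_gt0.
have [k _ /(_ k (leqnn k)) /= kr] := near_infty_natSinv_lt (PosNum r20).
have [||d [/= xd Dd]] := dD (ball x (k.+1%:R^-1)%R).
- by exists x; apply: ballxx; rewrite invr_gt0 ltr0n.
- exact: open_ball_metric.
have ed : e (c d) = d.
  have [De cE] : D (e (c d)) /\ c (e (c d)) = c d.
    by apply: (@xgetI _ _ [set d' | D d' /\ c d' = c d] d).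
  by apply: cI => //; rewrite inE.
have Gsub : G (c d) k `<=` ball x r `&` ~` At.
  move=> y [+ nAy]; rewrite ed => dy; split=> //.
  have xd2 : ball (x : V) (r / 2) d by apply: le_ball (ltW kr) _ xd.
  have dy2 : ball d (r / 2) (y : V) by apply: le_ball (ltW kr) _ dy.
  by rewrite [r]splitr; exact: (ball_triangle xd2 dy2).
exists (c d) => //; exists k => //; rewrite /F ifT.
  by split=> //; rewrite ed; exact: ball_sym.
rewrite -measure_le0 -xr0 le_measure// ?inE; apply: measurableI => //; exact: measurable_ball.
Qed.

(** There is no mass off the countably many atoms, so both sides split into a sum over atoms; an
    atom of mass [k] carries exactly the points with second component below [k]. *)
Lemma points_measure (A : set (borel V)) : measurable A ->
  m A = \esum_(q in points m) (\1_A q.1)%:E.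
Proof.
move=> mA; have /countable_injP[c cI] := countable_At.
pose F i : set (borel V) := [set x | At x /\ c x = i].
pose Q i : set (borel V * nat) := [set q | points m q /\ c q.1 = i].
have mF i : measurable (F i).
  apply: countable_measurable; first exact: measurable_set1_borel.
  by apply: sub_countable countable_At; apply: subset_card_le => x [].
have pAt q : points m q -> At q.1.
  by apply: le_lt_trans; rewrite lee_fin.
have -> : m A = \sum_(i <oo) m (A `&` F i).
  have -> : m A = m (A `&` At).
    rewrite (measureDI _ mA measurable_At) [X in X + _](_ : _ = 0) ?add0e//.
    apply/eqP; rewrite -measure_le0 -m_At0 le_measure ?inE//.
    - exact: measurableD.
    - exact: measurableC.
  have -> : A `&` At = \bigcup_i (A `&` F i).
    rewrite -setI_bigcupr; congr (_ `&` _).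
    by apply/seteqP; split=> [x Ax|x [i _ []//]]; exists (c x).
  apply/esym/cvg_lim => //; apply: measure_semi_sigma_additive.
  - by move=> i; exact: measurableI.
  - by move=> i j _ _ [x [[_ [_ <-]] [_ [_ <-]]]].
  - by apply: bigcupT_measurable => i; exact: measurableI.
have -> : points m = \bigcup_i Q i.
  by apply/seteqP; split=> [q Pq|q [i _ []//]]; exists (c q.1).
rewrite nneseries_sum_bigcup//; last first.
  by move=> i j _ _ [q [[_ <-] [_ <-]]].
apply: eq_eseriesr => i _.
have [[x [Ax cx]]|nF] := pselect (exists x, F i x); last first.
  rewrite (_ : F i = set0) ?setI0 ?measure0; last first.
    by apply/seteqP; split=> // x Fx; apply: nF; exists x.
  rewrite (_ : Q i = set0) ?esum_set0//.
  apply/seteqP; split=> // q [Pq cq]; apply: nF; exists q.1.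
  by split=> //; exact: pAt.
have [k mk] := m_int (measurable_set1_borel x) (@bset1 x).
have -> : F i = [set x].
  apply/seteqP; split=> [y [Ay cy]|_ ->//].
  by apply: cI; rewrite ?inE// cy cx.
have QE : Q i = (fun j => (x, j)) @` `I_k.
  apply/seteqP; split=> [[y j] /= [Pq /= cy]|_ [j /= jk <-]].
    have yx : y = x by apply: cI; rewrite ?inE//; [exact: (pAt _ Pq)|rewrite cy cx].
    exists j; last by rewrite yx.
    by move: Pq; rewrite /points /= yx mk lte_fin ltr_nat.
  by split=> //; rewrite /points /= mk lte_fin ltr_nat.
rewrite QE esum_image; last by move=> j1 j2 _ _ [].
rewrite /= esum_fset//=.
rewrite -fsbig_ord sumEFin sumr_const card_ord.
rewrite indicE; have [xA|xA] := boolP (x \in A).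
  rewrite (_ : A `&` [set x] = [set x]) ?mk; last first.
    by apply/setIidPr => _ ->; move: xA; rewrite inE.
  by [].
rewrite (_ : A `&` [set x] = set0) ?measure0; last first.
  by apply/seteqP; split=> // y [Ay /= yx]; move: xA; rewrite notin_setE -yx; apply.
by rewrite mul0rn.
Qed.

Lemma points_integral (g : borel V -> \bar R) : measurable_fun setT g ->
  (forall x, 0 <= g x) -> \int[m]_x g x = \esum_(q in points m) g q.1.
Proof.
move=> mg g0.
have [m' m'E] := @esum_measure _ (borel V) R _ (points m) fst.
rewrite -m'E//; apply: eq_measure_integral => A mA _.
rewrite points_measure// measure_integral// m'E//.
exact/measurable_EFinP/measurable_indic.
Qed.

End point_measure.

(** * Tuples of distinct points and Poisson counts *)

Definition tuples_in (T : Type) (Q : set T) k : set (k.-tuple T) :=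
  [set s | forall i, Q (tnth s i)].
Arguments tuples_in {T} Q k.

(** Summed over [points (N om)] these give the factorial moment measures: an atom of mass [k] may be
    hit by up to [k] coordinates. *)
Definition dtuples (T : eqType) (Q : set T) k : set (k.-tuple T) :=
  [set s : k.-tuple T | uniq s /\ forall i, Q (tnth s i)].
Arguments dtuples {T} Q k.

Section tuple_sums.
Context {R : realType}.

Lemma esum_tuples0 (T : choiceType) (D : set (0.-tuple T)) (g : 0.-tuple T -> \bar R) :
  D [tuple] -> 0 <= g [tuple] -> \esum_(s in D) g s = g [tuple].
Proof.
move=> Dn g0; rewrite (_ : D = [set [tuple]]) ?esum_set1//.
by apply/seteqP; split=> s /=; [rewrite tuple0|move=> ->].
Qed.

Lemma esum_tuplesS (T : choiceType) (Q : set T) k (g : k.+1.-tuple T -> \bar R) :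
  (forall s, 0 <= g s) ->
  \esum_(s in tuples_in Q k.+1) g s =
  \esum_(q in Q) \esum_(s in tuples_in Q k) g (cons_tuple q s).
Proof.
move=> g0; rewrite esum_esum//.
apply: (reindex_esum (Q `*`` (fun=> tuples_in Q k)) _
  (fun z : T * k.-tuple T => cons_tuple z.1 z.2) g); split.
- move=> [q s] [/= Qq Qs] i.
  by case: (unliftP ord0 i) => [j ->|->]; rewrite ?tnthS ?tnth0.
- move=> [q1 s1] [q2 s2] _ _ /= /(congr1 val) [-> ss].
  by congr pair; exact: val_inj.
- move=> s Qs; exists (thead s, behead_tuple s); last first.
    by rewrite /= [RHS]tuple_eta; exact: val_inj.
  split=> /=; first exact: Qs.
  move=> i; have := Qs (lift ord0 i).
  by rewrite [X in tnth X (lift _ _)]tuple_eta tnthS.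
Qed.

Lemma esum_dtuplesS (T : choiceType) (Q : set T) k (g : k.+1.-tuple T -> \bar R) :
  (forall s, 0 <= g s) ->
  \esum_(s in dtuples Q k.+1) g s =
  \esum_(q in Q) \esum_(s in dtuples (Q `\ q) k) g (cons_tuple q s).
Proof.
move=> g0; rewrite esum_esum//.
apply: (reindex_esum (Q `*`` (fun q => dtuples (Q `\ q) k)) _
  (fun z : T * k.-tuple T => cons_tuple z.1 z.2) g); split.
- move=> [q s] [/= Qq [us Qs]]; split.
    rewrite /= us andbT; apply/negP => /tnthP[i qi].
    by have [_] := Qs i; rewrite -qi; apply.
  move=> i; case: (unliftP ord0 i) => [j ->|->]; rewrite ?tnthS ?tnth0//.
  by have [] := Qs j.
- move=> [q1 s1] [q2 s2] _ _ /= /(congr1 val) [-> ss].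
  by congr pair; exact: val_inj.
- move=> s [us Qs]; exists (thead s, behead_tuple s); last first.
    by rewrite /= [RHS]tuple_eta; exact: val_inj.
  split=> /=; first exact: Qs.
  have : uniq (thead s :: behead s).
    by move: us; rewrite {1}(tuple_eta s).
  rewrite /= => /andP[sN us']; split => // i.
  have E : tnth (behead_tuple s) i = tnth s (lift ord0 i).
    by rewrite [X in _ = tnth X (lift _ _)]tuple_eta tnthS.
  rewrite E; split; first exact: Qs.
  move=> e; move/negP: sN; apply; rewrite -e -E.
  exact: mem_tnth.
Qed.

Lemma esum_tuples_prod (T : choiceType) (Q : set T) k (g : 'I_k -> T -> \bar R) :
  (forall i q, 0 <= g i q) ->
  \esum_(s in tuples_in Q k) \prod_(i < k) g i (tnth s i) =
  \prod_(i < k) \esum_(q in Q) g i q.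
Proof.
elim: k g => [|k IH] g g0.
  by rewrite esum_tuples0 ?big_ord0// => -[].
have p0 j (h : 'I_j -> T -> \bar R) (s : j.-tuple T) : (forall i q, 0 <= h i q) ->
    0 <= \prod_(i < j) h i (tnth s i) by move=> h0; apply: prode_ge0.
rewrite esum_tuplesS; last by move=> s; exact: p0.
rewrite big_ord_recl -(IH (fun i => g (lift ord0 i)))// muleC -esumZl//; last first.
  by apply: esum_ge0 => s _; exact: (p0 _ (fun i => g (lift ord0 i))).
apply: eq_esum => q _; rewrite muleC -esumZl//; last first.
  by move=> s _; exact: (p0 _ (fun i => g (lift ord0 i))).
apply: eq_esum => s _; rewrite big_ord_recl tnth0; congr (_ * _).
by apply: eq_bigr => i _; rewrite tnthS.
Qed.

End tuple_sums.

Section counting_tuples.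
Context {R : realType} (T : choiceType).

(** Removes one point of type [t]. Subtraction truncates at 0, which is harmless because the terms
    in [dec_count t n] carry the weight [n t]. *)
Definition dec_count m (t : 'I_m) (n : 'I_m -> nat) : 'I_m -> nat :=
  fun s => (n s - (s == t))%N.

(* The weighted number of [k]-tuples of distinct points among [n t] points of
   each type [t], the [i]-th point having weight [b i t]. *)
Fixpoint tuple_count m k : ('I_k -> 'I_m -> R) -> ('I_m -> nat) -> R :=
  match k with
  | 0 => fun _ _ => 1%R
  | k'.+1 => fun b n => (\sum_t b ord0 t * (n t)%:R *
      tuple_count (fun i => b (lift ord0 i)) (dec_count t n))%R
  end.

Lemma tuple_count_ge0 m k (b : 'I_k -> 'I_m -> R) (n : 'I_m -> nat) :
  (forall i t, 0 <= b i t)%R -> (0 <= tuple_count b n)%R.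
Proof.
elim: k b n => [|k IH] b n b0 //=.
by apply: sumr_ge0 => t _; rewrite mulr_ge0 ?mulr_ge0 ?IH.
Qed.

(** Peel off the first point [q]: if it has type [t], the remaining points have the counts
    [dec_count t n], whichever [q] it is, and there are [n t] such [q]. Points of no type contribute
    nothing. *)
Lemma esum_tuple_count m k (D : 'I_m -> set T) (b : 'I_k -> 'I_m -> R)
    (Q : set T) (n : 'I_m -> nat) :
  trivIset setT D -> (forall i t, 0 <= b i t)%R ->
  (forall t, \esum_(q in Q) (\1_(D t) q)%:E = (n t)%:R%:E :> \bar R) ->
  \esum_(s in dtuples Q k)
    (\prod_(i < k) \sum_t b i t * \1_(D t) (tnth s i))%:E =
  (tuple_count b n)%:E.
Proof.
move=> tD; elim: k b Q n => [|k IH] b Q n b0 nE.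
  by rewrite esum_tuples0 ?big_ord0//; split => // -[].
have p0 j (c : 'I_j -> 'I_m -> R) (s : j.-tuple T) : (forall i t, 0 <= c i t)%R ->
    (0 <= \prod_(i < j) \sum_t c i t * \1_(D t) (tnth s i))%R.
  move=> c0; apply: prodr_ge0 => i _; apply: sumr_ge0 => t _.
  by rewrite mulr_ge0.
rewrite esum_dtuplesS; last by move=> s; rewrite lee_fin; exact: p0.
pose b' (i : 'I_k) := b (lift ord0 i).
have b'0 i t : (0 <= b' i t)%R by exact: b0.
pose I q : \bar R := \esum_(s in dtuples (Q `\ q) k)
  (\prod_(i < k) \sum_t b' i t * \1_(D t) (tnth s i))%:E.
have I0 q : 0 <= I q by apply: esum_ge0 => s _; rewrite lee_fin; apply: p0.
transitivity (\esum_(q in Q) \sum_t (b ord0 t)%:E * ((\1_(D t) q)%:E * I q)).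
  apply: eq_esum => q _.
  rewrite /= (_ : \sum_t _ = (\sum_t b ord0 t * \1_(D t) q)%:E * I q); last first.
    rewrite -sumEFin ge0_sume_distrl; last first.
      by move=> t _; rewrite lee_fin mulr_ge0.
    by apply: eq_bigr => t _; rewrite EFinM muleA.
  rewrite -esumZl; last 2 first.
  - by rewrite lee_fin; apply: sumr_ge0 => t _; rewrite mulr_ge0.
  - by move=> s _; rewrite lee_fin; exact: p0.
  apply: eq_esum => s _; rewrite big_ord_recl EFinM tnth0; congr (_ * _%:E).
  by apply: eq_bigr => i _; rewrite tnthS.
rewrite esum_sum; last first.
  by move=> q t _ _; rewrite mule_ge0 ?lee_fin// mule_ge0 ?lee_fin.
rewrite /= -sumEFin; apply: eq_bigr => t _.
rewrite esumZl ?lee_fin//; last by move=> q _; rewrite mule_ge0 ?lee_fin.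
rewrite -mulrA EFinM; congr (_ * _).
transitivity (\esum_(q in Q) ((tuple_count b' (dec_count t n))%:E * (\1_(D t) q)%:E)).
  apply: eq_esum => q Qq; rewrite muleC !indicE.
  case: (boolP (q \in D t)) => [qD|_]; last by rewrite !mule0.
  rewrite !mule1; apply: IH => // u.
  have := nE u; rewrite (esumID [set q]); last by move=> *; rewrite lee_fin.
  rewrite (_ : Q `&` [set q] = [set q]); last by apply/setIidPr => _ ->.
  rewrite esum_set1 ?lee_fin// -setDE => E.
  (* By disjointness [q] is counted among the points of type [u] only for [u = t]. *)
  have uq : (\1_(D u) q = (u == t)%:R :> R)%R.
    rewrite indicE; congr (_%:R); congr nat_of_bool.
    apply/idP/eqP => [qDu|->//].
    by apply: tD => //; exists q; rewrite !inE in qD qDu.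
  move: E; rewrite uq /dec_count; set S := esum _ _.
  have S0 : 0 <= S by apply: esum_ge0 => *; rewrite lee_fin.
  move=> E; have Sfin : S \is a fin_num.
    rewrite ge0_fin_numE//; apply: (@le_lt_trans _ _ (n u)%:R%:E); last exact: ltry.
    by rewrite -E leeDr// lee_fin.
  rewrite -(fineK Sfin); move: E; rewrite -(fineK Sfin) -EFinD => -[E].
  have nu : ((u == t) <= n u)%N.
    rewrite -(@ler_nat R) -E lerDl; exact: fine_ge0.
  by rewrite natrB// -E addrAC subrr add0r.
rewrite esumZl; last 2 first.
- by rewrite lee_fin; apply: tuple_count_ge0.
- by move=> q _; rewrite lee_fin.
by rewrite nE muleC.
Qed.

End counting_tuples.

(** * Expectations over independent Poisson counts *)

Section poisson_sums.
Context {R : realType}.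

(** At rate 0 this is the point mass at 0, because [0 ^+ 0 = 1]. *)
Definition pois (l : R) (k : nat) : R := (l ^+ k / k`!%:R * expR (- l))%R.

Lemma pois_ge0 l k : (0 <= l -> 0 <= pois l k)%R.
Proof. by move=> l0; rewrite /pois !mulr_ge0 ?exprn_ge0 ?invr_ge0 ?expR_ge0. Qed.

Lemma pois_succ l k : (k.+1%:R * pois l k.+1 = l * pois l k)%R.
Proof.
rewrite /pois factS natrM exprS.
have k1 : (k.+1%:R != 0 :> R)%R by rewrite pnatr_eq0.
have kf : (k`!%:R != 0 :> R)%R by rewrite pnatr_eq0 -lt0n fact_gt0.
by field; rewrite kf/= -natr1 in k1 *.
Qed.

Lemma esum_pois_pow (l z : R) : (0 <= l)%R -> (0 <= z)%R ->
  \esum_(k in [set: nat]) (z ^+ k * pois l k)%:E = (expR ((z - 1) * l))%:E.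
Proof.
move=> l0 z0; rewrite -nneseries_esumT; last first.
  by move=> k; rewrite lee_fin mulr_ge0 ?pois_ge0 ?exprn_ge0.
transitivity (\sum_(k <oo) ((expR (- l))%:E * (exp_coeff (z * l) k)%:E)).
  apply: eq_eseriesr => k _; rewrite -EFinM; congr EFin.
  by rewrite /pois /exp_coeff /= exprMn; ring.
rewrite nneseriesZl; last first.
  by move=> k _; rewrite lee_fin /exp_coeff/= divr_ge0 ?exprn_ge0// mulr_ge0.
rewrite mulrBl mul1r addrC expRD EFinM; congr (_ * _).
rewrite /expR -EFin_lim; last exact: is_cvg_series_exp_coeff.
by apply/congr_lim/funext => n /=; rewrite /series /= -sumEFin.
Qed.

Variables (m : nat) (l : 'I_m -> R).
Hypothesis l0 : forall t, (0 <= l t)%R.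

Definition pois_sum (F : ('I_m -> nat) -> R) : \bar R :=
  \esum_(s in [set: m.-tuple nat])
    (F (tnth s) * \prod_(t < m) pois (l t) (tnth s t))%:E.

Let pp0 (s : m.-tuple nat) : (0 <= \prod_(t < m) pois (l t) (tnth s t))%R.
Proof. by apply: prodr_ge0 => t _; exact: pois_ge0. Qed.

(** Configurations without a point of type [t] have weight zero; adding one such point maps all
    configurations bijectively onto the others, and [pois_succ] trades the factor [k.+1] for
    [l t]. *)
Lemma pois_sum_dec (t : 'I_m) (F : ('I_m -> nat) -> R) : (forall n, 0 <= F n)%R ->
  pois_sum (fun n => (n t)%:R * F (dec_count t n))%R = (l t)%:E * pois_sum F.
Proof.
move=> F0; rewrite /pois_sum -esumZl ?lee_fin//; last first.
  by move=> s _; rewrite lee_fin mulr_ge0.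
rewrite (esumID [set s : m.-tuple nat | (0 < tnth s t)%N]); last first.
  by move=> s _; rewrite lee_fin !mulr_ge0.
rewrite [X in _ + X]esum1 ?adde0; last first.
  by move=> s [_ /= /negP]; rewrite -eqn0Ngt => /eqP ->; rewrite !mul0r.
pose e (s : m.-tuple nat) : m.-tuple nat := [tuple (tnth s u + (u == t))%N | u < m].
rewrite (reindex_esum [set: m.-tuple nat] _ e); last first.
  split.
  - by move=> s _ /=; split=> //; rewrite /e /= tnth_mktuple eqxx addn1.
  - move=> s1 s2 _ _ es; apply: eq_from_tnth => u.
    have := congr1 (fun s => tnth s u) es; rewrite !tnth_mktuple.
    by move/addIn.
  - move=> s [_ /= st]; exists [tuple (tnth s u - (u == t))%N | u < m] => //.
    apply: eq_from_tnth => u; rewrite !tnth_mktuple subnK//.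
    by case: eqP => // ->.
apply: eq_esum => s _; rewrite -EFinM; congr EFin.
have -> : dec_count t (tnth (e s)) = tnth s.
  by apply/funext => u; rewrite /dec_count tnth_mktuple addnK.
rewrite (bigD1 t)//= [in RHS](bigD1 t)//= tnth_mktuple eqxx addn1.
rewrite (eq_bigr (fun u => pois (l u) (tnth s u))); last first.
  by move=> u /negPf ut; rewrite tnth_mktuple ut addn0.
by have := pois_succ (l t) (tnth s t); set p := bigop _ _ _; set x := pois _ _; set y := pois _ _; move=> E; rewrite mulrACA mulrA E; ring.
Qed.

Lemma pois_sum_pow (z : 'I_m -> R) : (forall t, 0 <= z t)%R ->
  pois_sum (fun n => \prod_(t < m) z t ^+ n t)%R =
  (expR (\sum_(t < m) (z t - 1) * l t))%:E.
Proof.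
move=> z0; rewrite /pois_sum.
transitivity (\esum_(s in tuples_in [set: nat] m)
    \prod_(t < m) (z t ^+ tnth s t * pois (l t) (tnth s t))%:E).
  rewrite (_ : tuples_in _ _ = setT); last by apply/seteqP; split.
  by apply: eq_esum => s _; rewrite -big_split/= prodEFin.
rewrite (@esum_tuples_prod _ _ _ _ (fun t k => (z t ^+ k * pois (l t) k)%:E)); last first.
  by move=> t k; rewrite lee_fin mulr_ge0 ?pois_ge0 ?exprn_ge0.
under eq_bigr do rewrite esum_pois_pow//.
by rewrite prodEFin expR_sum.
Qed.

(** Induction on [k]: each removed point brings out [z t] from the powers and [l t] from
    [pois_sum_dec]; what remains for [k = 0] is the generating function of the counts. It is meant
    for [z t = expR (- a t)], the tilt. *)
Lemma pois_sum_tuple_count k (b : 'I_k -> 'I_m -> R) (z : 'I_m -> R) :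
  (forall i t, 0 <= b i t)%R -> (forall t, 0 <= z t)%R ->
  pois_sum (fun n => tuple_count b n * \prod_(t < m) z t ^+ n t)%R =
  ((\prod_(i < k) \sum_t b i t * z t * l t) *
   expR (\sum_(t < m) (z t - 1) * l t))%:E.
Proof.
move=> + z0; elim: k b => [|k IH] b b0 /=.
  rewrite big_ord0 mul1r -pois_sum_pow//.
  by apply: eq_esum => s _; rewrite mul1r.
have zn0 (n : 'I_m -> nat) : (0 <= \prod_(t < m) z t ^+ n t)%R.
  by apply: prodr_ge0 => t _; rewrite exprn_ge0.
pose b' (i : 'I_k) := b (lift ord0 i).
pose F n := (tuple_count b' n * \prod_(t < m) z t ^+ n t)%R.
have F0 n : (0 <= F n)%R by rewrite mulr_ge0//; apply: tuple_count_ge0 => i t; exact: b0.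
transitivity (\sum_(t < m) (b ord0 t * z t)%:E *
    pois_sum (fun n => (n t)%:R * F (dec_count t n))%R).
  rewrite /pois_sum.
  rewrite [RHS](eq_bigr (fun t => \esum_(s in [set: m.-tuple nat])
      ((b ord0 t * z t)%:E * ((tnth s t)%:R * F (dec_count t (tnth s)) *
        \prod_(u < m) pois (l u) (tnth s u))%:E))); last first.
    move=> t _; rewrite esumZl//; first by rewrite lee_fin mulr_ge0.
    by move=> s _; rewrite lee_fin; apply: mulr_ge0 => //; exact: mulr_ge0.
  rewrite -esum_sum; last first.
    move=> s t _ _; rewrite mule_ge0// lee_fin; first exact: mulr_ge0.
    by apply: mulr_ge0 => //; exact: mulr_ge0.
  apply: eq_esum => s _; rewrite !mulr_suml -sumEFin.
  apply: eq_bigr => t _; rewrite -EFinM; congr EFin.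
  rewrite /F -/b'.
  (* A power of [z t] splits off only for a positive count; for a zero count the factor [n t] kills
     both sides. *)
  case: (posnP (tnth s t)) => [->|st]; first by rewrite !(mulr0, mul0r).
  have -> : (\prod_(u < m) z u ^+ tnth s u =
      z t * \prod_(u < m) z u ^+ dec_count t (tnth s) u)%R.
    rewrite (bigD1 t)//= [in RHS](bigD1 t)//= /dec_count eqxx subn1.
    rewrite mulrA -exprS prednK//; congr (_ * _)%R.
    by apply: eq_bigr => u /negPf ->; rewrite subn0.
  by ring.
have FE : pois_sum F = ((\prod_(i < k) \sum_t b' i t * z t * l t) *
    expR (\sum_(t < m) (z t - 1) * l t))%:E by apply: IH => i t; exact: b0.
transitivity (\sum_(t < m) (b ord0 t * z t)%:E * ((l t)%:E * pois_sum F)).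
  by apply: eq_bigr => t _; congr (_ * _); exact: (pois_sum_dec t F0).
rewrite FE.
rewrite big_ord_recl -mulrA mulr_suml -sumEFin; apply: eq_bigr => t _.
by rewrite -!EFinM !mulrA.
Qed.

End poisson_sums.

(** A series over codes, with value 0 at the codes that encode nothing, so that results on series
    apply. *)
Lemma esum_countType {R : realType} (I : countType) (a : I -> \bar R) :
  (forall i, 0 <= a i) ->
  \esum_(i in [set: I]) a i = \sum_(j <oo) oapp a 0 (pickle_inv j).
Proof.
move=> a0; have b0 j : 0 <= oapp a 0 (pickle_inv j :> option I) by case: pickle_inv.
rewrite nneseries_esumT// (esumID (range (fun i : I => choice.pickle i)))//.
rewrite [X in _ + X]esum1 ?adde0; last first.
  move=> j [_ nj]; case E : (pickle_inv j) => [i|//]; exfalso; apply: nj.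
  by exists i => //; have := @pickle_invK I j; rewrite E.
rewrite setTI esum_image; last first.
  by move=> i j _ _; exact: (pcan_inj pickleK_inv).
by apply: eq_esum => i _; rewrite pickleK_inv.
Qed.

Lemma ge0_integral_esum d (T : measurableType d) (R : realType)
    (mu : {measure set T -> \bar R}) (I : countType) (f : I -> T -> \bar R) :
  (forall i, measurable_fun setT (f i)) -> (forall i x, 0 <= f i x) ->
  \int[mu]_x (\esum_(i in [set: I]) f i x) = \esum_(i in [set: I]) \int[mu]_x f i x.
Proof.
move=> mf f0.
rewrite esum_countType; last by move=> i; apply: integral_ge0 => x _; exact: f0.
transitivity (\int[mu]_x \sum_(j <oo) oapp (f ^~ x) 0 (pickle_inv j)).
  by apply: eq_integral => x _; rewrite esum_countType.
rewrite (@integral_nneseries _ _ _ mu setT measurableT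
    (fun j x => oapp (f ^~ x) 0 (pickle_inv j))).
- by apply: eq_eseriesr => j _; case: pickle_inv => [i|] //=; rewrite integral0.
- by move=> j; case: pickle_inv => [i|] //=; exact: measurable_cst.
- by move=> j x _; case: pickle_inv => [i|] /=.
Qed.

Lemma measurable_esum d (T : measurableType d) (R : realType) (I : countType)
    (f : I -> T -> \bar R) :
  (forall i, measurable_fun setT (f i)) -> (forall i x, 0 <= f i x) ->
  measurable_fun setT (fun x => \esum_(i in [set: I]) f i x).
Proof.
move=> mf f0; under eq_fun do rewrite esum_countType//.
apply: (@ge0_emeasurable_sum _ _ _ setT (fun j x => oapp (f ^~ x) 0 (pickle_inv j)) xpredT).
- by move=> j x _ _; case: pickle_inv => [i|] /=.
- by move=> j _; case: pickle_inv => [i|] //=; exact: measurable_cst.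
Qed.

(** * Functions of finitely many counts of the Poisson measure *)

Section prm_finite.
Context {R : realType} {V : completeMetricType R}.
Hypothesis Vsep : separable V.
Variable nu : {measure set (borel V) -> \bar R}.
Hypothesis nu_bf : @boundedly_finite R V nu.
Context d (Om : measurableType d) (P : probability Om R) (N : R.-ker Om ~> borel V).
Hypothesis N_prm : poisson_random_measure P nu N.
Variables (m : nat) (D : 'I_m -> set (borel V)).
Hypothesis mD : forall t, measurable (D t).
Hypothesis bD : forall t, @bounded_subset R V (D t).
Hypothesis tD : trivIset setT D.

Let l t : R := fine (nu (D t)).
Let l0 t : (0 <= l t)%R. Proof. exact: fine_ge0. Qed.

Let E (s : m.-tuple nat) : set Om :=
  [set om | forall t, N om (D t) = (tnth s t)%:R%:E].

Let mE s : measurable (E s).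
Proof.
have -> : E s = \bigcap_(t in [set: 'I_m])
    ((fun om => N om (D t)) @^-1` [set (tnth s t)%:R%:E]).
  by apply/seteqP; split=> om h t; [move=> _; exact: h|exact: (h t Logic.I)].
apply: fin_bigcap_measurable => // t _; rewrite -[X in measurable X]setTI.
by apply: (measurable_kernel N (D t) (mD t)) => //.
Qed.

Section function_of_counts.
Variables (F : ('I_m -> nat) -> R) (W : Om -> \bar R).
Hypothesis F0 : forall n, (0 <= F n)%R.
Hypothesis WF : forall om n,
  (forall t, N om (D t) = (n t)%:R%:E) -> W om = (F n)%:E.

(** Exactly one configuration [s] occurs at each [om]. From this countable sum both the
    measurability and the expectation of [W] follow. *)
Let WE : W = fun om => \esum_(s in [set: m.-tuple nat]) (F (tnth s) * \1_(E s) om)%:E.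
Proof.
apply/funext => om.
have /choice[n nE] t : exists k : nat, N om (D t) = k%:R%:E.
  exact: (prm_integer N_prm).
pose s0 : m.-tuple nat := [tuple n t | t < m].
have s0E t : N om (D t) = (tnth s0 t)%:R%:E by rewrite tnth_mktuple.
rewrite (esumID [set s0]); last by move=> s _; rewrite lee_fin mulr_ge0.
rewrite setTI esum_set1; last by rewrite lee_fin mulr_ge0.
rewrite [X in _ + X]esum1 ?adde0; last first.
  move=> s [_ ss0]; rewrite indicE memNset ?mulr0// => Es; apply: ss0 => /=.
  apply: eq_from_tnth => t; apply/eqP; rewrite -(@eqr_nat R); apply/eqP.
  by have := s0E t; rewrite Es => -[].
by rewrite indicE mem_set// mulr1; exact: WF.
Qed.

Let mFE (s : m.-tuple nat) :
  measurable_fun setT (fun om => (F (tnth s) * \1_(E s) om)%:E).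
Proof. by apply/measurable_EFinP; apply: measurable_funM. Qed.

Lemma measurable_prm_counts : measurable_fun setT W.
Proof.
rewrite WE; apply: measurable_esum => //.
by move=> s om; rewrite lee_fin mulr_ge0.
Qed.

Lemma prm_expectation : \int[P]_om W om = pois_sum l F.
Proof.
rewrite WE ge0_integral_esum//; last first.
  by move=> s om; rewrite lee_fin mulr_ge0.
apply: eq_esum => s _; under eq_integral do rewrite EFinM.
rewrite ge0_integralZl//; last 2 first.
- exact/measurable_EFinP/measurable_indic.
- by rewrite lee_fin.
rewrite integral_indic// setIT EFinM; congr (_ * _).
rewrite [LHS](_ : _ = \prod_(t < m) P [set om | N om (D t) = (tnth s t)%:R%:E]).
  by rewrite -prodEFin; apply: eq_bigr => t _; rewrite (prm_poisson N_prm).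
exact: (prm_indep N_prm (tnth s) mD bD tD).
Qed.

End function_of_counts.

Lemma points_count om (n : 'I_m -> nat) (t : 'I_m) : N om (D t) = (n t)%:R%:E ->
  \esum_(q in points (N om)) (\1_(fst @^-1` D t) q)%:E = (n t)%:R%:E :> \bar R.
Proof.
move=> <-; rewrite (points_measure Vsep)// => A mA bA.
exact: (prm_integer N_prm).
Qed.

Lemma prm_points_count k (b : 'I_k -> 'I_m -> R) om (n : 'I_m -> nat) :
  (forall i t, 0 <= b i t)%R -> (forall t, N om (D t) = (n t)%:R%:E) ->
  \esum_(s in dtuples (points (N om)) k)
    (\prod_(i < k) \sum_t b i t * \1_(D t) (tnth s i).1)%:E = (tuple_count b n)%:E.
Proof.
move=> b0 Nn.
rewrite -(@esum_tuple_count R (borel V * nat)%type m k (fun t => fst @^-1` D t) b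
  (points (N om)))//.
- by move=> i j _ _ [q [qi qj]]; apply: tD => //; exists q.1.
- by move=> t; exact: points_count.
Qed.

(** Everything here is a function of the counts: the exponential is a product of powers of
    [expR (- a t)], and the tuple sum is [tuple_count]. *)
Lemma prm_atoms k (b : 'I_k -> 'I_m -> R) (a : 'I_m -> R) :
  (forall i t, 0 <= b i t)%R ->
  \int[P]_om ((expR (- \sum_t a t * fine (N om (D t))))%:E *
    \esum_(s in dtuples (points (N om)) k)
      (\prod_(i < k) \sum_t b i t * \1_(D t) (tnth s i).1)%:E) =
  ((\prod_(i < k) \sum_t b i t * expR (- a t) * l t) *
    expR (- \sum_t (1 - expR (- a t)) * l t))%:E.
Proof.
move=> b0.
rewrite (@prm_expectation (fun n => tuple_count b n * \prod_(t < m) expR (- a t) ^+ n t)%R).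
- rewrite pois_sum_tuple_count//.
  congr ((_ * expR _)%:E); rewrite -sumrN; apply: eq_bigr => t _.
  by rewrite -mulNr opprB.
- move=> n; rewrite mulr_ge0 ?tuple_count_ge0//.
  by apply: prodr_ge0 => t _; rewrite exprn_ge0 ?expR_ge0.
- move=> om n Nn; rewrite muleC EFinM (prm_points_count b0 Nn); congr (_ * _%:E).
  rewrite -sumrN expR_sum; apply: eq_bigr => t _.
  by rewrite Nn /= -mulNr -expRM_natr.
Qed.

Lemma measurable_prm_atoms k (b : 'I_k -> 'I_m -> R) : (forall i t, 0 <= b i t)%R ->
  measurable_fun setT (fun om => \esum_(s in dtuples (points (N om)) k)
      (\prod_(i < k) \sum_t b i t * \1_(D t) (tnth s i).1)%:E).
Proof.
move=> b0; apply: (@measurable_prm_counts (tuple_count b)).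
- by move=> n; exact: tuple_count_ge0.
- by move=> om n; exact: prm_points_count.
Qed.

Lemma prm_atoms_lty k (b : 'I_k -> 'I_m -> R) om : (forall i t, 0 <= b i t)%R ->
  \esum_(s in dtuples (points (N om)) k)
      (\prod_(i < k) \sum_t b i t * \1_(D t) (tnth s i).1)%:E < +oo.
Proof.
move=> b0; have /choice[n nE] t : exists k : nat, N om (D t) = k%:R%:E.
  exact: (prm_integer N_prm).
by rewrite (prm_points_count b0 nE) ltry.
Qed.

End prm_finite.

Section atoms.
Context d (T : measurableType d) (R : realType).
Import HBNNSimple.

(** Points of [F] with the same membership pattern in the [B i] and the same value of [h] form one
    atom. The patterns make up a finite type, and some atoms may be empty. *)
Lemma common_atoms k (B : 'I_k -> set T) (h : {nnsfun T >-> R}) (F : set T) :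
  (forall i, measurable (B i)) -> measurable F ->
  exists m (D : 'I_m -> set T) (b : 'I_k -> 'I_m -> R) (a : 'I_m -> R),
    [/\ forall t, measurable (D t), forall t, D t `<=` F, trivIset setT D &
        forall x, F x -> exists t, D t x] /\
    [/\ forall i t, (0 <= b i t)%R, forall t, (0 <= a t)%R,
        forall i t x, D t x -> \1_(B i) x = b i t &
        forall t x, D t x -> h x = a t].
Proof.
move=> mB mF.
pose s : seq R := fset_set (range h).
(* [inord] needs the successor; at the spare index [nth 0%R s] is 0, so [a] is nonnegative there as
   well. *)
pose J : finType := ({ffun 'I_k -> bool} * 'I_(size s).+1)%type.
pose key (x : T) : J := ([ffun i => x \in B i], inord (index (h x) s)).
have hs x : h x \in s by rewrite in_fset_set// inE; exists x.
pose ev (t : 'I_#|J|) : {ffun 'I_k -> bool} * 'I_(size s).+1 := enum_val t.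
pose D (t : 'I_#|J|) := F `&` (key @^-1` [set ev t]).
have hE t x : D t x -> h x = nth 0%R s (ev t).2.
  move=> [_ <-] /=; rewrite inordK ?nth_index//.
  by rewrite ltnS ltnW// index_mem.
exists #|J|, D, (fun i t => ((ev t).1 i)%:R%R), (fun t => nth 0%R s (ev t).2).
split; split.
- move=> t; apply: measurableI => //.
  have -> : key @^-1` [set ev t] =
      (\bigcap_(i in [set: 'I_k]) (if (ev t).1 i then B i else ~` B i)) `&`
      \bigcup_(y in [set y | y \in s /\ inord (index y s) = (ev t).2]) (h @^-1` [set y]).
    apply/seteqP; split=> x /=.
      move=> <-; split=> [i _|]; last by exists (h x).
      by rewrite ffunE; case: (boolP (x \in B i)); [rewrite inE|rewrite notin_setE].
    move=> [hB [y [ys yE] hxy]]; rewrite [RHS]surjective_pairing; congr pair; last first.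
      by rewrite -yE -hxy.
    apply/ffunP => i; rewrite ffunE; have := hB i Logic.I; case: ((ev t).1 i) => Bx.
      exact/mem_set.
    exact/memNset.
  apply: measurableI.
    apply: fin_bigcap_measurable => // i _.
    by case: ifP => _ //; exact: measurableC.
  apply: fin_bigcup_measurable => [|y _].
    by apply: (@sub_finite_set _ _ [set` s]) => [y []|].
  exact: measurable_funPTI.
- by move=> t x [].
- move=> t u _ _ [x [[_ tx] [_ ux]]].
  by apply: enum_val_inj; rewrite -/(ev t) -/(ev u) -tx -ux.
- move=> x Fx; exists (enum_rank (key x)); split=> //=.
  by rewrite /ev enum_rankK.
- by move=> i t; rewrite ler0n.
- move=> t; have [lt|ge] := ltnP (ev t).2 (size s); last by rewrite nth_default.
  have : nth 0%R s (ev t).2 \in s by exact: mem_nth.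
  by rewrite in_fset_set// inE => -[x _ <-].
- by move=> i t x [_ <-] /=; rewrite ffunE indicE.
- exact: hE.
Qed.

End atoms.

(** * Exponentials with possibly infinite exponents, and their limits *)

Section expeR_limits.
Context {R : realType}.

(** Monotonicity allows [x = +oo]. The decreasing sequence tends to its infimum, which is [expeR z]
    for some [z]; then [- z] is an upper bound of all the [u n], hence of [x]. *)
Lemma cvg_expeRN (u : (\bar R)^nat) (x : \bar R) :
  nondecreasing_seq u -> u @ \oo --> x ->
  expeR (- u n) @[n --> \oo] --> expeR (- x).
Proof.
move=> ndu ux.
have ni : nonincreasing_seq (fun n => expeR (- u n)).
  by move=> i j ij; rewrite lee_expeR leeN2; exact: ndu.
have le_x n : u n <= x.
  by apply: (cvge_to_ge ux); exists n => // k /= nk; exact: ndu.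
have := ereal_nonincreasing_cvgn ni; set I := ereal_inf _.
rewrite (_ : I = expeR (- x))//; apply/eqP; rewrite eq_le; apply/andP; split; last first.
  by apply: le_ereal_inf_tmp => _ [n _ <-]; rewrite lee_expeR leeN2.
have I0 : 0 <= I by apply: le_ereal_inf_tmp => _ [n _ <-]; exact: expeR_ge0.
have [z zE] := expeR_total I0.
rewrite -zE lee_expeR leeNr; apply: (cvge_to_le ux); apply: nearW => n.
rewrite leeNr -lee_expeR zE; apply: ereal_inf_lbound; by exists n.
Qed.

(** The boolean factor accounts for [x = +oo], where [fine] returns 0 but the exponential
    vanishes. *)
Lemma expeRN_EFin (x : \bar R) : 0 <= x ->
  expeR (- x) = ((x < +oo)%E%:R * expR (- fine x))%:E.
Proof. by case: x => [r| |] //= _; rewrite ?ltry ?ltxx ?mul1r ?mul0r. Qed.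

Lemma measurable_expeRN d (T : measurableType d) (f : T -> \bar R) :
  measurable_fun setT f -> (forall x, 0 <= f x) ->
  measurable_fun setT (fun x => expeR (- f x)).
Proof.
move=> mf f0; rewrite (_ : (fun x => _) =
    (fun x => (\1_[set y | (f y < +oo)%E] x * expR (- fine (f x)))%:E)).
  apply/measurable_EFinP; apply: measurable_funM.
    apply: measurable_indic; rewrite -[X in measurable X]setTI.
    by apply: measurable_lte => //; exact: measurable_cst.
  apply: measurableT_comp => //; apply: measurableT_comp => //.
  exact: measurableT_comp.
apply/funext => x; rewrite expeRN_EFin// indicE; congr ((_%:R * _)%:E).
by congr nat_of_bool; apply/idP/idP; rewrite !inE.
Qed.

Lemma cvge_mul_fin (u v : (\bar R)^nat) (a b : \bar R) :
  (forall n, u n \is a fin_num) -> (forall n, v n \is a fin_num) ->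
  a \is a fin_num -> b \is a fin_num ->
  u @ \oo --> a -> v @ \oo --> b -> u n * v n @[n --> \oo] --> a * b.
Proof.
move=> uf vf /fineK <- /fineK <- /fine_cvg ua /fine_cvg vb.
rewrite -EFinM; apply: cvg_EFin.
  by apply: nearW => n; rewrite fin_numM.
rewrite (_ : fine \o _ = (fine \o u) \* (fine \o v))%R; first exact: cvgM.
by apply/funext => n /=; rewrite fineM.
Qed.

Lemma cvge_prod_fin (I : Type) (s : seq I) (u : I -> (\bar R)^nat) (l : I -> \bar R) :
  (forall i n, u i n \is a fin_num) -> (forall i, l i \is a fin_num) ->
  (forall i, u i @ \oo --> l i) ->
  \prod_(i <- s) u i n @[n --> \oo] --> \prod_(i <- s) l i.
Proof.
move=> uf lf ul.
have pf (w : I -> \bar R) (r : seq I) : (forall i, w i \is a fin_num) ->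
    \prod_(i <- r) w i \is a fin_num.
  by move=> wf; elim/big_rec : _ => // i x _ xf; rewrite fin_numM.
elim: s => [|i s IH].
  under eq_fun do rewrite big_nil.
  by rewrite big_nil; exact: cvg_cst.
under eq_fun do rewrite big_cons.
rewrite big_cons; apply: cvge_mul_fin => //; last exact: pf.
by move=> n; exact: pf.
Qed.

End expeR_limits.

Section atoms_sum.
Context d (T : measurableType d) (R : realType) (F : set T) (m : nat).
Variables (D : 'I_m -> set T) (u : 'I_m -> R) (w : T -> R).
Hypotheses (mD : forall t, measurable (D t)) (DF : forall t, D t `<=` F).
Hypotheses (tD : trivIset setT D) (FD : forall x, F x -> exists t, D t x).
Hypotheses (wD : forall t x, D t x -> w x = u t) (w0 : forall x, ~ F x -> w x = 0%R).

Lemma atoms_sum x : w x = (\sum_t u t * \1_(D t) x)%R.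
Proof.
have [Fx|nFx] := pselect (F x); last first.
  rewrite w0// big1// => t _; rewrite indicE memNset ?mulr0//.
  by move=> /DF.
have [t Dtx] := FD Fx.
rewrite (bigD1 t)//= indicE mem_set// mulr1 big1 ?addr0; first exact: wD.
move=> s st; rewrite indicE memNset ?mulr0// => Dsx; move/eqP: st; apply.
by apply: tD => //; exists x.
Qed.

Lemma atoms_integral (mu : {measure set T -> \bar R}) : (forall t, 0 <= u t)%R ->
  measurable F -> mu F < +oo ->
  \int[mu]_x (w x)%:E = (\sum_t u t * fine (mu (D t)))%:E.
Proof.
move=> u0 mF muF.
transitivity (\int[mu]_x (\sum_t (u t)%:E * (\1_(D t) x)%:E)).
  by apply: eq_integral => x _; rewrite atoms_sum -sumEFin.
rewrite ge0_integral_sum//; last 2 first.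
- by move=> t; apply: measurable_funeM; exact/measurable_EFinP/measurable_indic.
- by move=> t x _; rewrite mule_ge0 ?lee_fin.
rewrite -sumEFin; apply: eq_bigr => t _.
rewrite ge0_integralZl ?lee_fin//; last exact/measurable_EFinP/measurable_indic.
rewrite integral_indic// setIT EFinM fineK// ge0_fin_numE//.
by rewrite (le_lt_trans _ muF)// le_measure ?inE.
Qed.

End atoms_sum.

(** * The Mecke formula *)

Section mecke.
Context {R : realType} {V : completeMetricType R}.
Hypothesis Vsep : separable V.
Variable nu : {measure set (borel V) -> \bar R}.
Hypothesis nu_bf : @boundedly_finite R V nu.
Context d (Om : measurableType d) (P : probability Om R) (N : R.-ker Om ~> borel V).
Hypothesis N_prm : poisson_random_measure P nu N.
Variable k : nat.
Import HBNNSimple.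

Section bounded_rectangle.
Variables (B : 'I_k -> set (borel V)) (n : nat).
Hypotheses (mB : forall i, measurable (B i)) (Bn : forall i, B i `<=` big_ball n).

Let S (om : Om) : \bar R := \esum_(s in dtuples (points (N om)) k)
  (\prod_(i < k) \1_(B i) (tnth s i).1)%:E.

(** The sets [B i] and the function [h] cut to the ball are constant on common atoms, so [prm_atoms]
    applies. In the product over [i] the cut disappears because [B i] lies in the ball. The three
    conclusions are bundled since they rest on the same atoms. *)
Lemma mecke_rect_simple (h : {nnsfun borel V >-> R}) :
  [/\ measurable_fun setT S, (forall om, S om < +oo) &
  \int[P]_om (expeR (- \int[N om]_v (h v * \1_(big_ball n) v)%:E) * S om) =
  (\prod_(i < k) \int[nu]_v (\1_(B i) v * expR (- h v))%:E) *
  expeR (- \int[nu]_v (1 - expR (- (h v * \1_(big_ball n) v)))%:E)].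
Proof.
have mF := @measurable_big_ball R V n.
have [m [D [b [a [[mD DF tD FD] [b0 a0 bE aE]]]]]] := common_atoms h mB mF.
have bD t : @bounded_subset R V (D t).
  exact: sub_bounded (DF t) (bounded_big_ball n).
have BE i x : \1_(B i) x = (\sum_t b i t * \1_(D t) x)%R.
  apply: (atoms_sum DF tD FD) => [t y|y nFy]; first exact: bE.
  by rewrite indicE memNset// => /Bn.
have SE om : S om = \esum_(s in dtuples (points (N om)) k)
    (\prod_(i < k) \sum_t b i t * \1_(D t) (tnth s i).1)%:E.
  by apply: eq_esum => s _; congr EFin; apply: eq_bigr => i _.
have NF om : N om (big_ball n) < +oo.
  have [j ->] := prm_integer N_prm om mF (bounded_big_ball n).
  by rewrite ltry.
have nuF : nu (big_ball n) < +oo.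
  exact: nu_bf (bounded_big_ball n).
have indF (x : borel V) : ~ big_ball n x -> \1_(big_ball n) x = 0%R :> R.
  by move=> nx; rewrite indicE memNset.
have indD t x : D t x -> \1_(big_ball n) x = 1%R :> R.
  by move=> Dx; rewrite indicE mem_set//; exact: DF Dx.
split.
- rewrite (funext SE).
  exact: (measurable_prm_atoms Vsep N_prm).
- by move=> om; rewrite SE; exact: (prm_atoms_lty Vsep N_prm).
transitivity (\int[P]_om ((expR (- \sum_t a t * fine (N om (D t))))%:E * S om)).
  apply: eq_integral => om _; congr (_ * _).
  rewrite (@atoms_integral _ _ _ (big_ball n) m D a)//.
    by move=> t x Dx; rewrite (indD _ _ Dx) mulr1; exact: aE.
  by move=> x nx; rewrite indF// mulr0.
under eq_integral do rewrite SE.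
rewrite (prm_atoms Vsep N_prm)// EFinM; congr (_ * _).
  rewrite -prodEFin; apply: eq_bigr => i _.
  rewrite (@atoms_integral _ _ _ (big_ball n) m D (fun t => b i t * expR (- a t))%R)//.
  - by move=> t x Dx; rewrite (bE _ _ _ Dx) (aE _ _ Dx).
  - by move=> x nx; rewrite indicE memNset ?mul0r// => /Bn.
  - by move=> t; rewrite mulr_ge0 ?expR_ge0.
rewrite (@atoms_integral _ _ _ (big_ball n) m D (fun t => 1 - expR (- a t))%R)//.
- by move=> t x Dx; rewrite (indD _ _ Dx) (aE _ _ Dx) mulr1.
- by move=> x nx; rewrite indF// mulr0 oppr0 expR0 subrr.
- by move=> t; rewrite subr_ge0 -expR0 ler_expR oppr_le0.
Qed.

Lemma integral_rect : \int[P]_om S om = \prod_(i < k) nu (B i).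
Proof.
have [_ _] := mecke_rect_simple nnsfun0.
under eq_integral => om _.
  rewrite integral0_eq; last by move=> v _; rewrite /= mul0r.
  rewrite oppe0 expeR0 mul1e; over.
move=> ->; rewrite [X in expeR (- X)]integral0_eq ?oppe0 ?expeR0 ?mule1; last first.
  by move=> v _; rewrite /= mul0r oppr0 expR0 subrr.
apply: eq_bigr => i _; under eq_integral do rewrite /= oppr0 expR0 mulr1.
by rewrite integral_indic// setIT.
Qed.

End bounded_rectangle.
End mecke.

Section mecke_rect.
Context {R : realType} {V : completeMetricType R}.
Hypothesis Vsep : separable V.
Variable nu : {measure set (borel V) -> \bar R}.
Hypothesis nu_bf : @boundedly_finite R V nu.
Context d (Om : measurableType d) (P : probability Om R) (N : R.-ker Om ~> borel V).
Hypothesis N_prm : poisson_random_measure P nu N.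
Variables (w : borel V -> R).
Hypotheses (mw : measurable_fun setT w) (w0 : forall v, (0 <= w v)%R).
Import HBNNSimple.

Lemma expeRN_le1 (x : \bar R) : 0 <= x -> expeR (- x) <= 1.
Proof. by move=> x0; rewrite -expeR0 lee_expeR oppe_le0. Qed.

Lemma expeRN_fin_num (x : \bar R) : 0 <= x -> expeR (- x) \is a fin_num.
Proof. by move=> x0; rewrite expeRN_EFin. Qed.

(** [h j] increases to [w] and is cut to growing balls [F j]. The left side is dominated by [S],
    integrable by [integral_rect]; the integrals over the [B i] are dominated by indicators of sets
    of finite measure. *)
Lemma mecke_rect k (B : 'I_k -> set (borel V)) n :
  (forall i, measurable (B i)) -> (forall i, B i `<=` big_ball n) ->
  \int[P]_om (expeR (- \int[N om]_v (w v)%:E) *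
    \esum_(s in dtuples (points (N om)) k) (\prod_(i < k) \1_(B i) (tnth s i).1)%:E) =
  (\prod_(i < k) \int[nu]_v (\1_(B i) v * expR (- w v))%:E) * expeR (- Lambda nu w).
Proof.
move=> mB Bn.
pose S (om : Om) : \bar R := \esum_(s in dtuples (points (N om)) k)
  (\prod_(i < k) \1_(B i) (tnth s i).1)%:E.
have mwE : measurable_fun setT (fun v => (w v)%:E) by exact/measurable_EFinP.
pose h := nnsfun_approx measurableT mwE.
have hnd i j v : (i <= j)%N -> (h i v <= h j v)%R.
  by move=> ij; exact/lefP/nd_nnsfun_approx.
have hcvE v : (h j v)%:E @[j --> \oo] --> (w v)%:E.
  by apply: cvg_nnsfun_approx => // x _; rewrite lee_fin.
have hcv v : h j v @[j --> \oo] --> w v by exact: (fine_cvg (hcvE v)).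
have hle j v : (h j v <= w v)%R.
  rewrite -lee_fin; apply: (cvge_to_ge (hcvE v)); exists j => // i /= ji.
  by rewrite lee_fin hnd.
(* Starting at index [n] keeps every [B i] inside every [F j]. *)
pose F j : set (borel V) := big_ball (n + j)%N.
have mF j : measurable (F j) by exact: measurable_big_ball.
have FS i j : (i <= j)%N -> F i `<=` F j.
  move=> ij; apply/subsetPset; apply: nondecreasing_big_ball.
  by rewrite leq_add2l.
pose g j v : R := (h j v * \1_(F j) v)%R.
have g0 j v : (0 <= g j v)%R by rewrite mulr_ge0.
have mgr j : measurable_fun setT (g j) by apply: measurable_funM.
have mg j : measurable_fun setT (fun v => (g j v)%:E) by exact/measurable_EFinP.
have gnd v i j : (i <= j)%N -> (g i v)%:E <= (g j v)%:E.
  move=> ij; rewrite lee_fin /g ler_pM ?hnd// !indicE ler_nat.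
  by case: (boolP (v \in F i)) => // /set_mem /(FS _ _ ij) /mem_set ->.
have gcv v : (g j v)%:E @[j --> \oo] --> (w v)%:E.
  apply: cvg_trans (hcvE v); apply: near_eq_cvg.
  have : setT v by []; rewrite -bigcup_big_ball => -[i _ Bi].
  exists i => // j /= ij; rewrite /g indicE mem_set ?mulr1//.
  apply: (subsetPset _ _ (nondecreasing_big_ball _)) Bi.
  by rewrite (leq_trans ij)// leq_addl.
have intg_cv (mu : {measure set (borel V) -> \bar R}) :
    \int[mu]_v (g j v)%:E @[j --> \oo] --> \int[mu]_v (w v)%:E.
  rewrite (_ : \int[mu]_v (w v)%:E = \int[mu]_v limn (fun j => (g j v)%:E)).
    apply: cvg_monotone_convergence => //.
    - by move=> j v _; rewrite lee_fin.
    - by move=> v _ i j; exact: gnd.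
  by apply: eq_integral => v _; apply/esym/cvg_lim.
have intg_nd (mu : {measure set (borel V) -> \bar R}) :
    nondecreasing_seq (fun j => \int[mu]_v (g j v)%:E).
  move=> i j ij; apply: ge0_le_integral => //.
  - by move=> v _; rewrite lee_fin.
  - by move=> v _; exact: gnd.
have intg0 (mu : {measure set (borel V) -> \bar R}) j : 0 <= \int[mu]_v (g j v)%:E.
  by apply: integral_ge0 => v _; rewrite lee_fin.
have intw0 (mu : {measure set (borel V) -> \bar R}) : 0 <= \int[mu]_v (w v)%:E.
  by apply: integral_ge0 => v _; rewrite lee_fin.
have BF j i : B i `<=` F j.
  apply: (subset_trans (Bn i)); apply/subsetPset; apply: nondecreasing_big_ball.
  exact: leq_addr.
have simple j := mecke_rect_simple Vsep nu_bf N_prm mB (BF j) (h j).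
have [mS Soo _] := simple 0%N.
have Sfin om : S om < +oo := Soo om.
have S0 om : 0 <= S om.
  by apply: esum_ge0 => s _; rewrite lee_fin; apply: prodr_ge0.
have Sfn om : S om \is a fin_num by rewrite ge0_fin_numE.
have nuBfin i : nu (B i) < +oo.
  rewrite (@le_lt_trans _ _ (nu (big_ball n)))//.
    by rewrite le_measure ?inE//; exact: measurable_big_ball.
  by apply: nu_bf; [exact: measurable_big_ball|exact: bounded_big_ball].
have mintN (f : borel V -> \bar R) : measurable_fun setT f -> (forall v, 0 <= f v) ->
    measurable_fun setT (fun om => \int[N om]_v f v).
  move=> mf f0; apply: (@measurable_fun_integral_kernel _ _ _ _ _ N) => //.
  by move=> U mU; exact: measurable_kernel.
have LHS : \int[P]_om (expeR (- \int[N om]_v (g j v)%:E) * S om) @[j --> \oo] -->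
    \int[P]_om (expeR (- \int[N om]_v (w v)%:E) * S om).
  have [|||||_ _] := @dominated_convergence _ _ R P setT measurableT
    (fun j om => expeR (- \int[N om]_v (g j v)%:E) * S om)
    (fun om => expeR (- \int[N om]_v (w v)%:E) * S om) S => //.
  - move=> j; apply: emeasurable_funM => //; apply: measurable_expeRN => //.
    by apply: mintN => // v; rewrite lee_fin.
  - apply: emeasurable_funM => //; apply: measurable_expeRN => //.
    by apply: mintN => // v; rewrite lee_fin.
  - apply: aeW => om _; apply: cvge_mul_fin.
    + by move=> j; exact: expeRN_fin_num.
    + by [].
    + exact: expeRN_fin_num.
    + exact: Sfn.
    + by apply: cvg_expeRN.
    + exact: cvg_cst.
  - apply/integrableP; split => //.
    under eq_integral do rewrite gee0_abs//.
    rewrite (integral_rect Vsep nu_bf N_prm mB Bn).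
    rewrite -ge0_fin_numE; last by apply: prode_ge0.
    by apply: prode_fin_num => i _; rewrite ge0_fin_numE.
  - apply: aeW => om j _; rewrite gee0_abs; last by rewrite mule_ge0 ?expeR_ge0.
    by rewrite -[leRHS]mul1e lee_wpmul2r// expeRN_le1.
pose X i j := \int[nu]_v (\1_(B i) v * expR (- h j v))%:E.
pose Xl i := \int[nu]_v (\1_(B i) v * expR (- w v))%:E.
have dom_int (f : borel V -> R) i : (forall v, 0 <= f v)%R -> measurable_fun setT f ->
    \int[nu]_v (\1_(B i) v * expR (- f v))%:E \is a fin_num.
  move=> f0 mf; rewrite ge0_fin_numE; last first.
    by apply: integral_ge0 => v _; rewrite lee_fin mulr_ge0 ?expR_ge0.
  rewrite (le_lt_trans _ (nuBfin i))// measure_integral//.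
  apply: ge0_le_integral => //.
  - apply/measurable_EFinP; apply: measurable_funM => //.
    by apply: measurableT_comp => //; exact: measurableT_comp.
  - exact/measurable_EFinP/measurable_indic.
  - move=> v _; rewrite lee_fin -[leRHS]mulr1 ler_wpM2l//.
    by rewrite -expR0 ler_expR oppr_le0.
have Xcv i : X i @ \oo --> Xl i.
  have [|||||_ _] := @dominated_convergence _ _ R nu setT measurableT
    (fun j v => (\1_(B i) v * expR (- h j v))%:E)
    (fun v => (\1_(B i) v * expR (- w v))%:E) (fun v => (\1_(B i) v)%:E) => //.
  - move=> j; apply/measurable_EFinP; apply: measurable_funM => //.
    by apply: measurableT_comp => //; exact: measurableT_comp.
  - apply/measurable_EFinP; apply: measurable_funM => //.
    by apply: measurableT_comp => //; exact: measurableT_comp.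
  - apply: aeW => v _; apply: cvg_EFin; first exact: nearW.
    apply: cvgMl_tmp.
    apply: (@continuous_cvg _ _ _ _ _ _ (fun x : R => expR (- x))) => //.
    apply: continuous_comp; first exact: opp_continuous.
    exact: continuous_expR.
  - apply/integrableP; split; first exact/measurable_EFinP/measurable_indic.
    under eq_integral do rewrite gee0_abs ?lee_fin//.
    by rewrite integral_indic// setIT.
  - apply: aeW => v j _; rewrite gee0_abs ?lee_fin ?mulr_ge0 ?expR_ge0//.
    rewrite -[leRHS]mulr1 ler_wpM2l//.
    by rewrite -expR0 ler_expR oppr_le0.
have L0 j : 0 <= \int[nu]_v (1 - expR (- g j v))%:E.
  apply: integral_ge0 => v _; rewrite lee_fin subr_ge0 -expR0 ler_expR.
  by rewrite oppr_le0.
(* Monotone, not dominated, convergence: [Lambda nu w] may be infinite here, and [cvg_expeRN] then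
   gives the limit 0. *)
have Lcv : \int[nu]_v (1 - expR (- g j v))%:E @[j --> \oo] --> Lambda nu w.
  rewrite /Lambda (_ : \int[nu]_v (1 - expR (- w v))%:E =
     \int[nu]_v limn (fun j => (1 - expR (- g j v))%:E)).
    apply: cvg_monotone_convergence => //.
    - move=> j; apply/measurable_EFinP; apply: measurable_funB => //.
      apply: measurableT_comp => //; apply: measurableT_comp => //.
    - move=> j v _; rewrite lee_fin subr_ge0 -expR0 ler_expR.
      by rewrite oppr_le0.
    - move=> v _ i j ij; rewrite lee_fin lerB// ler_expR lerN2 -lee_fin.
      exact: gnd.
  apply: eq_integral => v _; apply/esym/cvg_lim => //.
  apply: cvg_EFin; first exact: nearW.
  apply: (@continuous_cvg _ _ _ _ _ _ (fun x : R => 1 - expR (- x))%R).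
    apply: continuousB; first exact: cst_continuous.
    apply: continuous_comp; first exact: opp_continuous.
    exact: continuous_expR.
  exact: (fine_cvg (gcv v)).
have Lnd : nondecreasing_seq (fun j => \int[nu]_v (1 - expR (- g j v))%:E).
  move=> i j ij; apply: ge0_le_integral => //.
  - by move=> v _; rewrite lee_fin subr_ge0 -expR0 ler_expR oppr_le0.
  - apply/measurable_EFinP; apply: measurable_funB => //.
    apply: measurableT_comp => //; apply: measurableT_comp => //.
  - apply/measurable_EFinP; apply: measurable_funB => //.
    apply: measurableT_comp => //; apply: measurableT_comp => //.
  - move=> v _; rewrite lee_fin lerB// ler_expR lerN2 -lee_fin.
    exact: gnd.
have RHS : (\prod_(i < k) X i j) * expeR (- \int[nu]_v (1 - expR (- g j v))%:E)
    @[j --> \oo] --> (\prod_(i < k) Xl i) * expeR (- Lambda nu w).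
  have Lw0 : 0 <= Lambda nu w.
    apply: integral_ge0 => v _; rewrite lee_fin subr_ge0 -expR0 ler_expR.
    by rewrite oppr_le0.
  apply: cvge_mul_fin.
  - by move=> j; apply: prode_fin_num => i _; exact: dom_int.
  - by move=> j; exact: expeRN_fin_num.
  - by apply: prode_fin_num => i _; exact: dom_int.
  - exact: expeRN_fin_num.
  - by apply: cvge_prod_fin => // [i j|i]; exact: dom_int.
  - exact: cvg_expeRN.
rewrite -(cvg_lim _ LHS)// -(cvg_lim _ RHS)//; congr (limn _); apply/funext => j.
by have [_ _] := simple j.
Qed.

End mecke_rect.

Lemma indic_rect d (T : measurableType d) (R : realType) k (B : 'I_k -> set T) v :
  \1_(rect B) v = (\prod_(i < k) \1_(B i) (tnth v i))%R :> R.
Proof.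
have [Bv|nBv] := pselect (rect B v).
  rewrite indicE mem_set//; apply/esym; rewrite big1// => i _.
  by have := Bv i; rewrite indicE => /mem_set ->.
rewrite indicE memNset//=; apply/esym.
have /existsNP[i nBi] : ~ forall i, B i (tnth v i) by [].
by rewrite (bigD1 i)//= indicE memNset ?mul0r.
Qed.

Section mecke_formula.
Context {R : realType} {V : completeMetricType R}.
Hypothesis Vsep : separable V.
Variable nu : {measure set (borel V) -> \bar R}.
Hypothesis nu_bf : @boundedly_finite R V nu.

Lemma boundedly_finite_sigma_finite :
  exists mu : {sigma_finite_measure set (borel V) -> \bar R},
    (nu : set (borel V) -> \bar R) = mu.
Proof.
have [|mu muE] := @sigma_finite_measureP _ _ _ nu.
  exists big_ball; first by rewrite bigcup_big_ball.
  move=> i; split; first exact: measurable_big_ball.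
  by apply: nu_bf; [exact: measurable_big_ball|exact: bounded_big_ball].
by exists mu; apply/funext => A; rewrite muE.
Qed.

Context d (Om : measurableType d) (P : probability Om R) (N : R.-ker Om ~> borel V).
Hypothesis N_prm : poisson_random_measure P nu N.
Import HBNNSimple.

(** The random factorial measure as a kernel. Counts give access to bounded rectangles only;
    [tuple_kernel_measurable] carries measurability to all sets. *)
Lemma dtuples_measure k :
  exists S : Om -> {measure set (k.-tuple (borel V)) -> \bar R},
  [/\ forall om (g : k.-tuple (borel V) -> \bar R), measurable_fun setT g ->
        (forall v, 0 <= g v) ->
        \int[S om]_v g v = \esum_(s in dtuples (points (N om)) k) g (map_tuple fst s),
      forall A, measurable A -> measurable_fun setT (S ^~ A) &
      forall om n, S om (rect (fun=> big_ball n)) < +oo].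
Proof.
have /choice[S SE] om : exists m : {measure set (k.-tuple (borel V)) -> \bar R},
    forall g : k.-tuple (borel V) -> \bar R, measurable_fun setT g ->
    (forall v, 0 <= g v) ->
    \int[m]_v g v = \esum_(s in dtuples (points (N om)) k) g (map_tuple fst s).
  exact: esum_measure.
have SrE om B : (forall i, measurable (B i)) -> S om (rect B) =
    \esum_(s in dtuples (points (N om)) k) (\prod_(i < k) \1_(B i) (tnth s i).1)%:E.
  move=> mB; have mrB := measurable_rect mB.
  rewrite measure_integral// SE//; last exact/measurable_EFinP/measurable_indic.
  apply: eq_esum => s _; congr EFin.
  by rewrite indic_rect; apply: eq_bigr => i _; rewrite tnth_map.
have Sfin om n : S om (rect (fun=> big_ball n)) < +oo.
  rewrite SrE//; last by move=> _; exact: measurable_big_ball.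
  have [|//|_ + _] := @mecke_rect_simple R V Vsep nu nu_bf _ Om P N N_prm k
    (fun=> big_ball n) n _ _ nnsfun0; first by move=> _; exact: measurable_big_ball.
    by move=> _.
  exact.
exists S; split => //.
apply: (@tuple_kernel_measurable _ _ R _ big_ball) => //.
- exact: measurable_big_ball.
- exact: nondecreasing_big_ball.
- exact: bigcup_big_ball.
- move=> B mB [n Bn]; under eq_fun do rewrite SrE//.
  by have [] := mecke_rect_simple Vsep nu_bf N_prm mB Bn nnsfun0.
Qed.

(* The Slivnyak-Mecke formula, tilted by [expeR (- N w)]. *)
Lemma mecke (w : borel V -> R) k (g : k.-tuple (borel V) -> \bar R) :
  measurable_fun setT w -> (forall v, 0 <= w v)%R ->
  measurable_fun setT g -> (forall v, 0 <= g v) ->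
  \int[P]_om (expeR (- \int[N om]_v (w v)%:E) *
    \esum_(s in dtuples (points (N om)) k) g (map_tuple fst s)) =
  expeR (- Lambda nu w) * iter_integral nu setT
    (fun v => (\prod_(j < k) (expR (- w (tnth v j)))%:E) * g v).
Proof.
move=> mw w0.
have [S [SE mS Soo]] := dtuples_measure k.
have [mu nuE] := boundedly_finite_sigma_finite.
have [m mE] := @iter_measure _ _ R mu setT k measurableT.
have mNw : measurable_fun setT (fun om => \int[N om]_v (w v)%:E).
  apply: (@measurable_fun_integral_kernel _ _ _ _ _ N) => //.
  - by move=> U mU; exact: measurable_kernel.
  - exact/measurable_EFinP.
have Nw0 om : 0 <= \int[N om]_v (w v)%:E.
  by apply: integral_ge0 => v _; rewrite lee_fin.
have Lw0 : 0 <= Lambda nu w.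
  apply: integral_ge0 => v _; rewrite lee_fin subr_ge0 -expR0 ler_expR.
  by rewrite oppr_le0.
pose h om : R := fine (expeR (- \int[N om]_v (w v)%:E)).
have hE om : expeR (- \int[N om]_v (w v)%:E) = (h om)%:E.
  by rewrite /h fineK// expeRN_fin_num.
have h0 om : (0 <= h om)%R by rewrite -lee_fin -hE expeR_ge0.
have mh : measurable_fun setT h.
  by apply: measurableT_comp => //; exact: measurable_expeRN.
pose e : R := fine (expeR (- Lambda nu w)).
have eE : expeR (- Lambda nu w) = e%:E by rewrite /e fineK// expeRN_fin_num.
have e0 : (0 <= e)%R by rewrite -lee_fin -eE expeR_ge0.
have me : measurable_fun setT (fun v : borel V => expR (- w v)).
  by apply: measurableT_comp => //; exact: measurableT_comp.
have mp : measurable_fun setT (fun v : k.-tuple (borel V) =>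
    \prod_(j < k) (expR (- w (tnth v j)))%:E).
  apply: (@measurable_prod_tnth _ _ _ _ (fun=> fun v => (expR (- w v))%:E)) => [i|i x].
    exact/measurable_EFinP.
  by rewrite lee_fin expR_ge0.
have p0 (v : k.-tuple (borel V)) : 0 <= \prod_(j < k) (expR (- w (tnth v j)))%:E.
  by apply: prode_ge0 => i _; rewrite lee_fin expR_ge0.
pose p (v : k.-tuple (borel V)) : R := (e * \prod_(j < k) expR (- w (tnth v j)))%R.
have pE v : (p v)%:E = e%:E * \prod_(j < k) (expR (- w (tnth v j)))%:E.
  by rewrite prodEFin.
have p00 v : (0 <= p v)%R by rewrite -lee_fin pE mule_ge0 ?lee_fin.
have mpr : measurable_fun setT p.
  apply/measurable_EFinP; rewrite (_ : _ \o _ = fun v => (p v)%:E)//.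
  by under eq_fun do rewrite pE; exact: measurable_funeM.
(* [m1] and [m2] are the two sides of the formula as measures: a mixture over [om], and a density
   against the [k]-fold power of [nu]. *)
have [m1 m1E] := mixture_measure P mh h0 mS.
have [m2 m2E] := density_measure m mpr p00.
have m12 : forall A, measurable A -> m1 A = m2 A.
  apply: (@tuple_measure_unique _ _ R k big_ball).
  - exact: measurable_big_ball.
  - exact: nondecreasing_big_ball.
  - exact: bigcup_big_ball.
  - move=> B mB [n Bn]; have mrB := measurable_rect mB.
    have m1r : measurable_fun setT (fun v => (\1_(rect B) v)%:E : \bar R).
      exact/measurable_EFinP/measurable_indic.
    rewrite !measure_integral// m1E// m2E//.
    transitivity (\int[P]_om (expeR (- \int[N om]_v (w v)%:E) *
        \esum_(s in dtuples (points (N om)) k) (\prod_(i < k) \1_(B i) (tnth s i).1)%:E)).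
      apply: eq_integral => om _; rewrite SE// hE; congr (_ * _).
      apply: eq_esum => s _; rewrite indic_rect.
      by under eq_bigr do rewrite tnth_map.
    rewrite (mecke_rect Vsep nu_bf N_prm mw w0 mB Bn) eE muleC nuE.
    have mBw i : measurable_fun setT (fun v => (\1_(B i) v * expR (- w v))%:E).
      by apply/measurable_EFinP; apply: measurable_funM.
    have Bw0 i v : 0 <= (\1_(B i) v * expR (- w v))%:E.
      by rewrite lee_fin mulr_ge0 ?expR_ge0.
    rewrite -(@iter_integral_prod _ _ _ mu setT k
      (fun i v => (\1_(B i) v * expR (- w v))%:E))//.
    have mpB := measurable_prod_tnth mBw Bw0.
    have pB0 (t : k.-tuple (borel V)) :
        0 <= \prod_(i < k) (\1_(B i) (tnth t i) * expR (- w (tnth t i)))%:E.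
      by apply: prode_ge0 => i _; exact: Bw0.
    rewrite mE// -ge0_integralZl//.
    apply: eq_integral => v _; rewrite indic_rect pE -muleA; congr (_ * _).
    by rewrite !prodEFin -EFinM -big_split/=; congr EFin; apply: eq_bigr => i _; rewrite mulrC.
  (* Uniqueness needs finiteness on an exhausting sequence: bounding the exponential by 1 leaves a
     factorial moment, which is a power of [nu (big_ball n)]. *)
  - move=> n; have mbb (i : 'I_k) : measurable (big_ball n : set (borel V)).
      exact: measurable_big_ball.
    have mr := @measurable_rect _ _ k (fun=> big_ball n) mbb.
    rewrite measure_integral// m1E//; last exact/measurable_EFinP/measurable_indic.
    apply: (@le_lt_trans _ _ (\int[P]_om
        \esum_(s in dtuples (points (N om)) k) (\prod_(i < k) \1_(big_ball n) (tnth s i).1)%:E)).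
      apply: ge0_le_integral => //.
      + by move=> om _; rewrite mule_ge0 ?lee_fin ?integral_ge0.
      + apply: emeasurable_funM; first exact/measurable_EFinP.
        under eq_fun do rewrite integral_indic// setIT.
        exact: mS.
      + by have [] := mecke_rect_simple Vsep nu_bf N_prm mbb (fun=> @subset_refl _ _) nnsfun0.
      + move=> om _; rewrite SE//; last exact/measurable_EFinP/measurable_indic.
        rewrite -[leRHS]mul1e; apply: lee_pmul.
        * by rewrite lee_fin.
        * by apply: esum_ge0 => s _; rewrite lee_fin.
        * by rewrite -hE expeRN_le1.
        * by apply: le_esum => s _; rewrite indic_rect; under eq_bigr do rewrite tnth_map.
    rewrite (integral_rect Vsep nu_bf N_prm mbb (fun=> @subset_refl _ _)).
    rewrite -ge0_fin_numE; last by apply: prode_ge0.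
    apply: prode_fin_num => i _; rewrite ge0_fin_numE//.
    by apply: nu_bf; [exact: measurable_big_ball|exact: bounded_big_ball].
move=> mg g0.
transitivity (\int[m1]_v g v).
  by rewrite m1E//; apply: eq_integral => om _; rewrite SE// hE.
transitivity (\int[m2]_v g v).
  by apply: eq_measure_integral => A mA _; exact: m12.
rewrite m2E// nuE eE.
rewrite mE; last 2 first.
- exact: emeasurable_funM.
- by move=> v; rewrite mule_ge0.
rewrite -ge0_integralZl//; last 2 first.
- exact: emeasurable_funM.
- by move=> v _; rewrite mule_ge0.
by apply: eq_integral => v _; rewrite pE muleA.
Qed.

End mecke_formula.

(** * Partitions *)

Section partition_cells.
Variable n : nat.
Implicit Types (p : set_partition n).

Lemma cover_set_partition p i : i \in finset.cover (val p).
Proof. by have /and3P[/eqP-> _ _] := valP p; rewrite finset.in_setT. Qed.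

Lemma cell_subproof p i :
  (index (finset.pblock (val p) i) (enum (val p)) < #|val p|)%N.
Proof.
by rewrite cardE index_mem mem_enum finset.pblock_mem// cover_set_partition.
Qed.

Definition cell p i : 'I_#|val p| := Ordinal (cell_subproof p i).

Lemma enum_val_cell p i : enum_val (cell p i) = finset.pblock (val p) i.
Proof.
rewrite (enum_val_nth (finset.pblock (val p) i)) /= nth_index//.
by rewrite mem_enum finset.pblock_mem// cover_set_partition.
Qed.

Lemma mem_cell p (i : 'I_n) (j : 'I_#|val p|) :
  (i \in (enum_val j : {set 'I_n})) = (cell p i == j).
Proof.
have /and3P[_ tp _] := valP p.
apply/idP/eqP => [ij|<-].
  apply: enum_val_inj; rewrite enum_val_cell.
  by apply: finset.def_pblock => //; exact: enum_valP.
by rewrite enum_val_cell finset.mem_pblock cover_set_partition.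
Qed.

Lemma cell_surj p j : exists i, cell p i = j.
Proof.
have /and3P[_ _ p0] := valP p.
have /finset.set0Pn[i ij] : enum_val j != finset.set0.
  by apply: contraNneq p0 => <-; exact: enum_valP.
by exists i; apply/eqP; rewrite -mem_cell.
Qed.

Lemma induced_partitionE (T : eqType) (s : n.-tuple T) p :
  (induced_partition s = p) <->
  (forall i i', (tnth s i == tnth s i') = (cell p i == cell p i')).
Proof.
have Rs : {in [set: 'I_n]%SET & &, equivalence_rel (fun i i' => tnth s i == tnth s i')}.
  by split=> // /eqP->.
split=> [<- i i'|h].
  rewrite [RHS]eq_sym -[RHS]mem_cell enum_val_cell /=.
  by rewrite finset.pblock_equivalence_partition ?finset.in_setT.
apply: val_inj; rewrite /= -[RHS](finset.preim_partition_pblock (valP p)).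
apply: finset.eq_imset => i; apply/finset.setP => i'; rewrite !inE; f_equal.
rewrite h; apply/eqP/eqP => [e|e]; last by apply: enum_val_inj; rewrite !enum_val_cell.
by rewrite -!enum_val_cell e.
Qed.

(** [spread] without a default element: as it needs no structure on [T], it also acts on tuples of
    points with multiplicity. *)
Definition spread_tuple (T : Type) p (t : #|val p|.-tuple T) : n.-tuple T :=
  [tuple tnth t (cell p i) | i < n].
Arguments spread_tuple {T} p t.

Lemma tnth_spread_tuple (T : Type) p (t : #|val p|.-tuple T) i :
  tnth (spread_tuple p t) i = tnth t (cell p i).
Proof. by rewrite tnth_mktuple. Qed.

Lemma spreadE d (T : measurableType d) p (t : #|val p|.-tuple T) :
  spread t = spread_tuple p t.
Proof.
by apply: eq_from_tnth => i; rewrite !tnth_mktuple (tnth_nth point).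
Qed.

Lemma map_spread_tuple (T U : Type) (h : T -> U) p (t : #|val p|.-tuple T) :
  map_tuple h (spread_tuple p t) = spread_tuple p (map_tuple h t).
Proof.
by apply: eq_from_tnth => i; rewrite tnth_map !tnth_spread_tuple tnth_map.
Qed.

(** Distinct values placed on the cells of [p] give a tuple whose equal coordinates are exactly
    those in a common cell; reading a tuple at one representative of each cell is the inverse. *)
Lemma spread_tuple_bij (T : eqType) (Q : set T) p :
  set_bij (dtuples Q #|val p|)
    (tuples_in Q n `&` [set s | induced_partition s = p]) (spread_tuple p).
Proof.
split.
- move=> t [ut Qt]; split=> [i|/=]; first by rewrite tnth_spread_tuple.
  apply/induced_partitionE => i i'.
  by rewrite !tnth_spread_tuple; apply/(inj_eq (tuple_uniqP _ ut)).
- move=> t t' _ _ tt'; apply: eq_from_tnth => j.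
  by have [i <-] := cell_surj j; rewrite -!tnth_spread_tuple tt'.
- move=> s [Qs /induced_partitionE sp].
  have /choice[r rK] := @cell_surj p.
  exists [tuple tnth s (r j) | j < #|val p|].
    split=> [|j]; last by rewrite tnth_mktuple.
    apply/tuple_uniqP => j j'; rewrite !tnth_mktuple => /eqP.
    by rewrite sp !rK => /eqP.
  apply: eq_from_tnth => i; rewrite tnth_spread_tuple tnth_mktuple.
  by apply/eqP; rewrite sp rK.
Qed.

Lemma esum_tuples_partition (R : realType) (T : choiceType) (Q : set T)
    (G : set_partition n -> n.-tuple T -> \bar R) : (forall p s, 0 <= G p s) ->
  \esum_(s in tuples_in Q n) G (induced_partition s) s =
  \sum_(p : set_partition n) \esum_(t in dtuples Q #|val p|) G p (spread_tuple p t).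
Proof.
move=> G0; transitivity (\sum_(p : set_partition n) \esum_(s in tuples_in Q n)
    (if s \in [set s | induced_partition s = p] then G p s else 0)).
  rewrite -esum_sum//; last by move=> s p _ _; case: ifP.
  apply: eq_esum => s _; rewrite (bigD1 (induced_partition s))//= mem_set//.
  rewrite big1 ?adde0// => p /eqP np.
  by rewrite memNset//= => /esym.
apply: eq_bigr => p _; rewrite -esum_mkcondr.
exact: reindex_esum (spread_tuple_bij Q p).
Qed.

Lemma eq_spread_cell (T : Type) p (t : #|val p|.-tuple T) (C : {set 'I_n}) i k :
  C \in val p -> i \in C -> k \in C ->
  tnth (spread_tuple p t) i = tnth (spread_tuple p t) k.
Proof.
move=> Cp iC kC; rewrite !tnth_spread_tuple.
have ij l : l \in C -> cell p l = enum_rank_in Cp C.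
  by move=> lC; apply/eqP; rewrite -mem_cell enum_rankK_in.
by rewrite !ij.
Qed.

Lemma at_cell_spread d (T : measurableType d) (U : Type) (u0 : U) (h : T -> U) p
    (t : #|val p|.-tuple T) (C : {set 'I_n}) i :
  C \in val p -> i \in C ->
  at_cell u0 h (spread_tuple p t) C = h (tnth (spread_tuple p t) i).
Proof.
move=> Cp iC; rewrite /at_cell; case: pickP => [k kC|/(_ i)]; last by rewrite iC.
by rewrite /= (eq_spread_cell t Cp kC iC).
Qed.

Lemma at_cell_enum_val d (T : measurableType d) (U : Type) (u0 : U) (h : T -> U) p
    (t : #|val p|.-tuple T) j :
  at_cell u0 h (spread_tuple p t) (enum_val j) = h (tnth t j).
Proof.
have [i ij] := cell_surj j.
rewrite (@at_cell_spread _ _ _ _ _ _ _ _ i) ?enum_valP//.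
  by rewrite tnth_spread_tuple ij.
by rewrite mem_cell ij.
Qed.

Lemma prod_cells (R : realType) (E : 'I_n -> R) p :
  (\prod_(C in val p) \prod_(i in C) E i = \prod_(i < n) E i)%R.
Proof.
have /and3P[/eqP cp tp _] := valP p.
rewrite -(finset.big_trivIset _ tp) cp; apply: eq_bigl => i.
by rewrite finset.in_setT.
Qed.

Lemma measurable_spread_tuple d (T : measurableType d) p :
  measurable_fun setT (@spread_tuple T p).
Proof.
apply: (measurability _ (measurable_tuple_rect T n)) => //.
move=> _ [_ [B mB <-] <-]; rewrite setTI.
rewrite (_ : _ @^-1` _ = \bigcap_(i in [set: 'I_n]) ((tnth (T := T))^~ (cell p i) @^-1` B i)).
  apply: fin_bigcap_measurable => // i _.
  by rewrite -[X in measurable X]setTI; exact: measurable_tnth.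
apply/seteqP; split=> t /= h i; first by move=> _; have := h i; rewrite tnth_spread_tuple.
by rewrite tnth_spread_tuple; exact: (h i Logic.I).
Qed.

End partition_cells.
Arguments spread_tuple {n T} p t.

(** * Bayes' rule *)

(** [moment_integral] takes a bare set function such as [nu_Omega]. To use that very function as a
    measure, equality is needed on all sets, while it is comparable with a known measure on
    measurable sets only. *)
Lemma measure_of_set_fun d (T : measurableType d) (R : realType)
    (m : {measure set T -> \bar R}) (m0 : set T -> \bar R) :
  (forall A, 0 <= m0 A) -> (forall A, measurable A -> m0 A = m A) ->
  exists m' : {measure set T -> \bar R}, (m' : set T -> \bar R) = m0.
Proof.
move=> ge0 mE.
have m00 : m0 set0 = 0 by rewrite mE// measure0.
have sa : semi_sigma_additive m0.
  move=> F mF tF mUF; rewrite mE//.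
  rewrite (_ : (fun n => \sum_(0 <= i < n) m0 (F i)) = fun n => \sum_(0 <= i < n) m (F i)).
    exact: measure_semi_sigma_additive.
  by apply/funext => n; apply: eq_bigr => i _; exact: mE.
pose m' : {measure set T -> \bar R} :=
  HB.pack m0 (isMeasure.Build d T R m0 m00 ge0 sa).
by exists m'.
Qed.

Lemma mnormalizeE d (T : measurableType d) (R : realType)
    (m : {measure set T -> \bar R}) (P : probability T R) A :
  m setT != 0 -> m setT != +oo -> mnormalize m P A = (fine (m setT))^-1%:E * m A.
Proof.
by move=> m0 moo; rewrite /mnormalize/= (negbTE m0) (negbTE moo)/= muleC.
Qed.

Lemma normalized_measure d (T : measurableType d) (R : realType)
    (m : {measure set T -> \bar R}) : 0 < m setT -> m setT < +oo ->
  exists Q : probability T R,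
    (forall A, Q A = (fine (m setT))^-1%:E * m A) /\
    (forall g : T -> \bar R, measurable_fun setT g -> (forall x, 0 <= g x) ->
      \int[Q]_x g x = (fine (m setT))^-1%:E * \int[m]_x g x).
Proof.
move=> m0 moo; exists (mnormalize m (\d_(point : T))).
have nE A : mnormalize m (\d_(point : T)) A = (fine (m setT))^-1%:E * m A.
  by rewrite mnormalizeE//; [rewrite gt_eqF|rewrite lt_eqF].
split=> // g mg g0.
have c0 : (0 <= (fine (m setT))^-1)%R by rewrite invr_ge0 fine_ge0// ltW.
transitivity (\int[mscale (NngNum c0) m]_x g x); last by rewrite ge0_integral_mscale.
by apply: eq_measure_integral => A mA _; exact: nE.
Qed.

Section bayes.
Context d dX dY (Z : measurableType d) (X : measurableType dX) (Y : measurableType dY).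
Context (R : realType).
Variables (rho : {sigma_finite_measure set X -> \bar R}).
Variables (lambda : {sigma_finite_measure set Y -> \bar R}).
Variables (H : X * Y -> R) (mH : measurable_fun setT H) (H0 : forall z, (0 <= H z)%R).
Variables (Q : probability Z R) (a : Z -> X) (b : Z -> Y).
Hypotheses (ma : measurable_fun setT a) (mb : measurable_fun setT b).
Hypothesis QE : forall g : X * Y -> \bar R, measurable_fun setT g ->
  (forall z, 0 <= g z) ->
  \int[Q]_z g (a z, b z) = \int[rho]_x \int[lambda]_y ((H (x, y))%:E * g (x, y)).

(** The kernel normalises [H (x, y)] times [lambda]. Its total mass [l x setT] is, in [x], the
    density of the law of [a] against [rho]: it is finite almost everywhere because it integrates to
    1, and the [x] where it is zero have probability zero. Where normalisation is impossible the
    kernel is an arbitrary Dirac mass. The maps [a] and [b] are abstract so that both orders of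
    conditioning are covered. *)
Lemma bayes_kernel : exists k : R.-pker X ~> Y,
  (forall A B, measurable A -> measurable B ->
    Q (a @^-1` A `&` b @^-1` B) = \int[Q]_(z in a @^-1` A) k (a z) B) /\
  {ae Q, forall z, propto (k (a z))
    (fun B => \int[lambda]_y ((H (a z, y))%:E * (\1_B y)%:E))}.
Proof.
have mHx x : measurable_fun setT (fun y => H (x, y)).
  exact: (measurableT_comp mH (pair1_measurable x)).
have /choice[l lE] x : exists m : {measure set Y -> \bar R},
    forall g : Y -> \bar R, measurable_fun setT g -> (forall y, 0 <= g y) ->
    \int[m]_y g y = \int[lambda]_y ((H (x, y))%:E * g y).
  exact: density_measure.
have lB x B : measurable B ->
    l x B = \int[lambda]_y ((H (x, y))%:E * (\1_B y)%:E).
  move=> mB; rewrite measure_integral// lE//.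
  exact/measurable_EFinP/measurable_indic.
have mHB B : measurable B -> measurable_fun setT
    (fun z : X * Y => (H z)%:E * (\1_B z.2)%:E).
  move=> mB; apply: emeasurable_funM; first exact/measurable_EFinP.
  apply/measurable_EFinP; apply: (measurableT_comp _ measurable_snd).
  exact: measurable_indic.
have ml B : measurable B -> measurable_fun setT (l ^~ B).
  move=> mB; rewrite (_ : l ^~ B = fun x => \int[lambda]_y ((H (x, y))%:E * (\1_B y)%:E)).
    apply: (@measurable_fun_fubini_tonelli_F _ _ _ _ _ lambda
      (fun z : X * Y => (H z)%:E * (\1_B z.2)%:E)); first exact: mHB.
    by move=> z; rewrite mule_ge0 ?lee_fin.
  by apply/funext => x; exact: lB.
pose K : R.-ker X ~> Y := HB.pack l (isKernel.Build _ _ _ _ R l ml).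
pose k : R.-pker X ~> Y := knormalize K (\d_(point : Y)).
have kE x B : l x setT != 0 -> l x setT != +oo ->
    k x B = (fine (l x setT))^-1%:E * l x B.
  exact: mnormalizeE.
have Qint (g : X -> \bar R) : measurable_fun setT g -> (forall x, 0 <= g x) ->
    \int[Q]_z g (a z) = \int[rho]_x (g x * l x setT).
  move=> mg g0; rewrite (QE (g := fun z => g z.1))//; last first.
    exact: (measurableT_comp mg measurable_fst).
  apply: eq_integral => x _; rewrite lB// -ge0_integralZl//; last 2 first.
  - by apply: emeasurable_funM; apply/measurable_EFinP => //; exact: measurable_indic.
  - by move=> y _; rewrite mule_ge0 ?lee_fin.
  by apply: eq_integral => y _; rewrite indicT mule1 muleC.
have lfin : {ae rho, forall x, setT x -> l x setT \is a fin_num}.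
  apply: integrable_ae => //; apply/integrableP; split; first exact: (ml _ measurableT).
  under eq_integral do rewrite gee0_abs//.
  have := Qint (cst 1) (measurable_cst _) (fun=> lee01).
  under [in RHS]eq_integral do rewrite mul1e.
  move=> <-; rewrite (integral_cst _ _ 1%E)// mul1e.
  by rewrite [ltLHS](_ : _ = 1) ?ltry//; exact: probability_setT.
exists k; split.
- move=> A B mA mB.
  have maA : measurable (a @^-1` A) by rewrite -[X in measurable X]setTI; exact: ma.
  have mbB : measurable (b @^-1` B) by rewrite -[X in measurable X]setTI; exact: mb.
  have mA1 : measurable_fun setT (fun x => (\1_A x)%:E : \bar R).
    exact/measurable_EFinP/measurable_indic.
  have mB1 : measurable_fun setT (fun x => (\1_B x)%:E : \bar R).
    exact/measurable_EFinP/measurable_indic.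
  transitivity (\int[rho]_x ((\1_A x)%:E * l x B)).
    rewrite measure_integral; last exact: measurableI.
    transitivity (\int[Q]_z (fun z : X * Y => (\1_A z.1)%:E * (\1_B z.2)%:E) (a z, b z)).
      apply: eq_integral => z _ /=; rewrite -EFinM; congr EFin.
      by rewrite indicI.
    rewrite (QE (g := fun z : X * Y => (\1_A z.1)%:E * (\1_B z.2)%:E)); last 2 first.
    - apply: emeasurable_funM.
        exact: (measurableT_comp mA1 measurable_fst).
      exact: (measurableT_comp mB1 measurable_snd).
    - by move=> z; rewrite mule_ge0 ?lee_fin.
    apply: eq_integral => x _ /=; rewrite lB// -ge0_integralZl ?lee_fin//; last 2 first.
    - by apply: emeasurable_funM => //; exact/measurable_EFinP.
    - by move=> y _; rewrite mule_ge0 ?lee_fin.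
    by apply: eq_integral => y _; rewrite muleCA.
  rewrite [RHS]integral_mkcond epatch_indic.
  transitivity (\int[Q]_z ((\1_A (a z))%:E * k (a z) B)); last first.
    by apply: eq_integral => z _; rewrite muleC.
  have mk : measurable_fun setT (fun x => k x B) by exact: measurable_kernel.
  rewrite (Qint (fun x => (\1_A x)%:E * k x B)); last 2 first.
  - exact: emeasurable_funM.
  - by move=> x; rewrite mule_ge0 ?lee_fin.
  apply: ge0_ae_eq_integral => //.
  - by apply: emeasurable_funM => //; exact: (ml _ mB).
  - by apply: emeasurable_funM; [exact: emeasurable_funM|exact: (ml _ measurableT)].
  apply: filterS lfin => x + _ => /(_ Logic.I) xfin.
  rewrite -muleA; congr (_ * _).
  (* With zero total mass [l x B] vanishes too, so the default value of the kernel does not show. *)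
  have [x0|x0] := eqVneq (l x setT) 0.
    rewrite x0 mule0; apply/eqP; rewrite eq_le measure_ge0 andbT -x0.
    by apply: le_measure; rewrite ?inE.
  rewrite kE//; last by apply/eqP => xoo; rewrite xoo in xfin.
  rewrite muleAC -[l x setT in X in _ * X * _]fineK// -EFinM mulVf ?mul1e//.
  by rewrite fine_eq0.
(* The exceptional set, where the density of the law of [a] is zero or infinite. *)
pose N := [set x | l x setT = 0] `|` [set x | l x setT = +oo].
have mN : measurable N.
  apply: measurableU; rewrite -[X in measurable X]setTI.
    exact: (ml _ measurableT measurableT [set 0%E]).
  exact: (ml _ measurableT measurableT [set +oo%E]).
have maN : measurable (a @^-1` N) by rewrite -[X in measurable X]setTI; exact: ma.
exists (a @^-1` N); split => //.
  rewrite measure_integral// (Qint (fun x => (\1_N x)%:E)); last 2 first.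
  - exact/measurable_EFinP/measurable_indic.
  - by move=> x; rewrite lee_fin.
  rewrite (@ge0_ae_eq_integral _ _ _ _ _ _ (cst 0))//; first by rewrite integral0.
  - apply: emeasurable_funM; last exact: (ml _ measurableT).
    exact/measurable_EFinP/measurable_indic.
  apply: filterS lfin => x + _ => /(_ Logic.I) xfin.
  have [[x0|xoo]|nN] := pselect (N x).
  - by rewrite x0 mule0.
  - by rewrite xoo in xfin.
  - by rewrite indicE memNset// mul0e.
move=> z /=; apply: contra_notP => nN.
have [x0 xoo] : l (a z) setT != 0 /\ l (a z) setT != +oo.
  by split; apply/eqP => h; apply: nN; [left|right].
exists (fine (l (a z) setT))^-1%R.
  rewrite invr_gt0 fine_gt0// lt0e x0 measure_ge0/=.
  by rewrite ltey.
by move=> B mB; rewrite -lB//; exact: kE.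
Qed.

End bayes.

Lemma measurable_fun_partition n d d' (T : measurableType d) (U : measurableType d')
    (g : set_partition n * T -> U) :
  (forall p, measurable_fun setT (fun t => g (p, t))) -> measurable_fun setT g.
Proof.
move=> mg _ B mB; rewrite setTI.
rewrite (_ : g @^-1` B = \bigcup_(p in [set: set_partition n])
    ([set p] `*` ((fun t => g (p, t)) @^-1` B))).
  apply: fin_bigcup_measurable => // p _; apply: measurableX => //.
  by rewrite -[X in measurable X]setTI; exact: mg.
by apply/seteqP; split => [[p t]|[p t] [q _ []]] /=; [exists p|move=> <-].
Qed.

Lemma measurable_indic_EFin d (T : measurableType d) (R : realType) (A : set T) :
  measurable A -> measurable_fun setT (fun x => (\1_A x)%:E : \bar R).
Proof. by move=> mA; exact/measurable_EFinP/measurable_indic. Qed.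

Lemma propto_trans (R : realType) d (T : measurableType d) (m1 m2 m3 : set T -> \bar R) :
  propto m1 m2 -> propto m2 m3 -> propto m1 m3.
Proof.
move=> [c c0 cE] [e e0 eE]; exists (c * e)%R; first exact: mulr_gt0.
by move=> A mA; rewrite cE// eE// muleA -EFinM.
Qed.

Section bayes_posterior.
Context dX dY (X : measurableType dX) (Y : measurableType dY) (R : realType).
Variables (rho : {sigma_finite_measure set X -> \bar R}).
Variables (lambda : {sigma_finite_measure set Y -> \bar R}).
Variables (H : X * Y -> R) (mH : measurable_fun setT H) (H0 : forall z, (0 <= H z)%R).
Let D (B : set (X * Y)) : \bar R :=
  \int[lambda]_y \int[rho]_x ((H (x, y))%:E * (\1_B (x, y))%:E).
Hypotheses (D0 : 0 < D setT) (Doo : D setT < +oo).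

Let c : R := (fine (D setT))^-1%R.

Let c0 : (0 < c)%R.
Proof. by rewrite invr_gt0 fine_gt0// D0. Qed.

(** Both kernels come from [bayes_kernel], the second with the coordinates exchanged; the
    normalising constant [c] is absorbed by [propto]. *)
Lemma bayes_posterior : exists Q : probability (X * Y)%type R,
  [/\ forall B, measurable B -> Q B = c%:E * D B,
      exists2 k : R.-pker X ~> Y, cond_law_snd Q k &
        {ae Q, forall z, propto (k z.1)
          (fun B => \int[lambda]_y ((H (z.1, y))%:E * (\1_B y)%:E))} &
      exists2 k : R.-pker Y ~> X, cond_law_fst Q k &
        {ae Q, forall z, propto (k z.2)
          (fun A => \int[rho]_x ((H (x, z.2))%:E * (\1_A x)%:E))}].
Proof.
have mHg (g : X * Y -> \bar R) : measurable_fun setT g ->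
    measurable_fun setT (fun z => (H z)%:E * g z).
  by move=> mg; apply: emeasurable_funM => //; exact/measurable_EFinP.
have Hg0 (g : X * Y -> \bar R) : (forall z, 0 <= g z) -> forall z, 0 <= (H z)%:E * g z.
  by move=> g0 z; rewrite mule_ge0 ?lee_fin.
have [m mE] := density_measure (rho \x lambda) mH H0.
have mD B : measurable B -> m B = D B.
  move=> mB; have mB1 := @measurable_indic_EFin _ _ R _ mB.
  rewrite measure_integral// mE//.
  have B0 z : 0 <= (\1_B z)%:E :> \bar R by rewrite lee_fin.
  by rewrite (@fubini_tonelli2 _ _ _ _ _ rho lambda _ (mHg _ mB1) (Hg0 _ B0)).
have [||Q [QE Qint]] := @normalized_measure _ _ _ m; rewrite ?mD//.
rewrite mD// -/c in QE Qint.
have QB B : measurable B -> Q B = c%:E * D B by move=> mB; rewrite QE mD.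
pose Hc z : R := (c * H z)%R.
have Hc0 z : (0 <= Hc z)%R by rewrite mulr_ge0// ltW.
have mHc : measurable_fun setT Hc by exact: measurable_funM.
have Qint2 (g : X * Y -> \bar R) : measurable_fun setT g -> (forall z, 0 <= g z) ->
    \int[Q]_z g z = \int[rho \x lambda]_z ((Hc z)%:E * g z).
  move=> mg g0; rewrite Qint// mE// -ge0_integralZl//; last 3 first.
  - exact: mHg.
  - by move=> z _; exact: Hg0.
  - by rewrite lee_fin ltW.
  by apply: eq_integral => z _; rewrite muleA -EFinM.
have mHcg (g : X * Y -> \bar R) : measurable_fun setT g ->
    measurable_fun setT (fun z => (Hc z)%:E * g z).
  by move=> mg; apply: emeasurable_funM => //; exact/measurable_EFinP.
have Hcg0 (g : X * Y -> \bar R) : (forall z, 0 <= g z) -> forall z, 0 <= (Hc z)%:E * g z.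
  by move=> g0 z; rewrite mule_ge0 ?lee_fin.
exists Q; split => //.
- have [|k [kE kae]] := bayes_kernel (rho := rho) (lambda := lambda) mHc Hc0
    (Q := Q) (a := fst) (b := snd) measurable_fst measurable_snd.
    move=> g mg g0; rewrite -(@fubini_tonelli1 _ _ _ _ _ rho lambda
      (fun z => (Hc z)%:E * g z)); [|exact: mHcg|exact: Hcg0].
    by rewrite -Qint2//; apply: eq_integral => -[].
  exists k.
    move=> A B mA mB; rewrite [X in Q X](_ : _ = fst @^-1` A `&` snd @^-1` B).
      rewrite kE//; congr (integral _ _ _).
      by apply/seteqP; split=> -[x y]; [|case].
    by apply/seteqP; split=> -[x y].
  apply: filterS kae => z kz; apply: (propto_trans kz); exists c => // B mB.
  rewrite -ge0_integralZl//; last 3 first.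
  - apply: emeasurable_funM; last exact: measurable_indic_EFin.
    by apply/measurable_EFinP; exact: (measurableT_comp mH (pair1_measurable z.1)).
  - by move=> y _; rewrite mule_ge0 ?lee_fin.
  - by rewrite lee_fin ltW.
  by apply: eq_integral => y _; rewrite muleA -EFinM.
- have msw : measurable_fun setT (fun z : Y * X => (z.2, z.1)).
    exact: measurable_fun_pair.
  have [|||k [kE kae]] := bayes_kernel (rho := lambda) (lambda := rho)
    (H := fun z => Hc (z.2, z.1))
    (Q := Q) (a := snd) (b := fst) _ _ measurable_snd measurable_fst.
  + exact: (measurableT_comp mHc msw).
  + by [].
  + move=> g mg g0.
    have msw' : measurable_fun setT (fun z : X * Y => (z.2, z.1)).
      exact: measurable_fun_pair.
    have mg' : measurable_fun setT (fun z : X * Y => g (z.2, z.1)).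
      exact: (measurableT_comp mg msw').
    rewrite Qint2//; exact: (@fubini_tonelli2 _ _ _ _ _ rho lambda
      (fun z => (Hc z)%:E * g (z.2, z.1)) (mHcg _ mg') (Hcg0 _ (fun z => g0 _))).
  exists k.
    move=> A B mA mB; rewrite [X in Q X](_ : _ = snd @^-1` B `&` fst @^-1` A).
      rewrite kE//; congr (integral _ _ _).
      by apply/seteqP; split=> -[x y]; [|case].
    by apply/seteqP; split=> -[x y] [].
  apply: filterS kae => z kz; apply: (propto_trans kz); exists c => // B mB.
  rewrite -ge0_integralZl//; last 3 first.
  - apply: emeasurable_funM; last exact: measurable_indic_EFin.
    by apply/measurable_EFinP; exact: (measurableT_comp mH (pair2_measurable z.2)).
  - by move=> y _; rewrite mule_ge0 ?lee_fin.
  - by rewrite lee_fin ltW.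
  by apply: eq_integral => y _; rewrite muleA -EFinM.
Qed.

End bayes_posterior.

Lemma prode_fin_num_lty (R : realType) (I : Type) (s : seq I) (a : I -> \bar R) :
  (forall i, 0 <= a i) -> (forall i, a i < +oo) -> \prod_(i <- s) a i < +oo.
Proof.
move=> a0 aoo; rewrite -ge0_fin_numE; last by apply: prode_ge0.
by apply: prode_fin_num => i _; rewrite ge0_fin_numE.
Qed.

(** * The reference measure on pairs of a partition and a vector *)

Section partition_measure.
Context d (T : measurableType d) (R : realType) (n : nat).
Variable mu : {sigma_finite_measure set T -> \bar R}.

Lemma measurable_at_partition d' (U : measurableType d')
    (g : set_partition n * n.-tuple T -> U) (p : set_partition n) :
  measurable_fun setT g ->
  measurable_fun setT (fun t : #|val p|.-tuple T => g (p, spread_tuple p t)).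
Proof.
move=> mg; apply: (measurableT_comp mg); apply: measurableT_comp.
  exact: pair1_measurable.
exact: measurable_spread_tuple.
Qed.

(** Taken with [nu], this measure carries densities for the moment measures of all the [nu_Omega w],
    so that one reference measure serves every [w]. Sigma-finiteness, which Tonelli needs, comes
    from the cubes [rect (fun=> E i)]: finitely many partitions, each of finite mass there. *)
Lemma partition_measure :
  exists rho : {sigma_finite_measure set (set_partition n * n.-tuple T)%type -> \bar R},
  forall g : set_partition n * n.-tuple T -> \bar R, measurable_fun setT g ->
    (forall z, 0 <= g z) ->
  \int[rho]_z g z = \sum_p iter_integral mu setT (fun t => g (p, spread_tuple p t)).
Proof.
have mex (p : set_partition n) :
    exists m : {sigma_finite_measure set (#|val p|.-tuple T) -> \bar R},
    forall g : #|val p|.-tuple T -> \bar R, measurable_fun setT g ->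
      (forall t, 0 <= g t) -> iter_integral mu setT g = \int[m]_t g t.
  exact: iter_measure.
pose m p := projT1 (cid (mex p)); have mE p := projT2 (cid (mex p)).
have [|||r rE] := @measure_of_functional _ (set_partition n * n.-tuple T)%type R
    (fun g => \sum_(p : set_partition n) \int[m p]_t g (p, spread_tuple p t)).
- by move=> g mg g0; apply: sume_ge0 => p _; apply: integral_ge0.
- move=> g mg g0; rewrite nneseries_sum; last by move=> p i _; apply: integral_ge0.
  apply: eq_bigr => p _; rewrite -integral_nneseries//.
  by move=> i; exact: measurable_at_partition.
- move=> c g c0 mg g0; rewrite ge0_sume_distrr; last by move=> p _; apply: integral_ge0.
  apply: eq_bigr => p _; rewrite ge0_integralZl//.
  exact: measurable_at_partition.
have [E [EU ndE mEoo]] : exists F, [/\ setT = \bigcup_i F i,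
    nondecreasing_seq F & forall i, measurable (F i) /\ mu (F i) < +oo].
  exact/sigma_finiteP/sigma_finiteT.
have sr : sigma_finite setT r.
  exists (fun i => setT `*` rect (fun=> E i)).
    apply/esym; rewrite -subTset => -[p v] _.
    have : setT v by []; rewrite -(@rect_cover _ T n E ndE (esym EU)) => -[i _ vi].
    by exists i.
  move=> i; have mr : measurable (rect (fun _ : 'I_n => E i)).
    by apply: measurable_rect => _; exact: (mEoo i).1.
  split; first exact: measurableX.
  rewrite measure_integral; last exact: measurableX.
  rewrite -rE; last 2 first.
  - by apply/measurable_EFinP/measurable_indic; exact: measurableX.
  - by move=> z; rewrite lee_fin.
  apply: lte_sum_pinfty => p _.
  rewrite (eq_integral (fun t : #|val p|.-tuple T => (\1_(rect (fun=> E i)) t)%:E)).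
    have mrp : measurable (rect (fun _ : 'I_#|val p| => E i)).
      by apply: measurable_rect => _; exact: (mEoo i).1.
    have mi1 : measurable_fun setT (fun v => (\1_(E i) v)%:E : \bar R).
      exact/measurable_EFinP/measurable_indic/(mEoo i).1.
    rewrite -mE; last 2 first.
    - exact/measurable_EFinP/measurable_indic.
    - by move=> z; rewrite lee_fin.
    under eq_iter_integral do rewrite indic_rect -prodEFin.
    rewrite (@iter_integral_prod _ _ _ mu setT _ (fun=> fun v => (\1_(E i) v)%:E))//.
    apply: prode_fin_num_lty => j; first exact: integral_ge0.
    by rewrite -measure_integral; [exact: (mEoo i).2|exact: (mEoo i).1].
  move=> t _; rewrite !indicE; congr (_%:R%:E); congr nat_of_bool.
  (* Every cell is nonempty, so the spread vector lies in the cube exactly when [t] does. *)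
  apply/idP/idP; rewrite !inE => h.
    by move=> j; have [l <-] := cell_surj j; rewrite -tnth_spread_tuple; exact: h.2.
  by split=> // l; rewrite tnth_spread_tuple.
have [rho rhoE] := sigma_finite_measureP sr.
exists rho => g mg g0.
transitivity (\int[r]_z g z); first by apply: eq_measure_integral => A _ _; exact: rhoE.
rewrite -rE//; apply: eq_bigr => p _; rewrite mE//.
exact: measurable_at_partition.
Qed.

End partition_measure.

(** * The Mecke formula summed over partitions *)

Section mecke_point_tuples.
Context {R : realType} {V : completeMetricType R}.
Hypothesis Vsep : separable V.
Variable nu : {measure set (borel V) -> \bar R}.
Hypothesis nu_bf : @boundedly_finite R V nu.
Context d (Om : measurableType d) (P : probability Om R) (N : R.-ker Om ~> borel V).
Hypothesis N_prm : poisson_random_measure P nu N.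
Variable n : nat.

(** Joint measurability in the outcome and a further variable is what allows the expectation to be
    exchanged with the integral over the weights. *)
Lemma measurable_esum_point_tuples d' (Y : measurableType d')
    (k : (set_partition n * n.-tuple (borel V)) * Y -> \bar R) :
  measurable_fun setT k -> (forall z, 0 <= k z) ->
  measurable_fun setT (fun z : Om * Y => \esum_(s in point_tuples (N z.1))
    k ((induced_partition s, map_tuple fst s), z.2)).
Proof.
move=> mk k0.
rewrite (_ : (fun z => _) = fun z : Om * Y => \sum_(p : set_partition n)
    \esum_(t in dtuples (points (N z.1)) #|val p|)
      k ((p, spread_tuple p (map_tuple fst t)), z.2)).
  apply: emeasurable_sum => p.
  have [S [SE mS Soo]] := dtuples_measure Vsep nu_bf N_prm #|val p|.
  have mkp : measurable_fun setT (fun z : (Om * Y) * #|val p|.-tuple (borel V) =>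
      k ((p, spread_tuple p z.2), z.1.2)).
    apply: (measurableT_comp mk); apply: measurable_fun_pair.
      apply: measurable_fun_pair; first exact: measurable_cst.
      apply: (measurableT_comp (f := @spread_tuple n (borel V) p)).
        exact: measurable_spread_tuple.
      exact: measurable_snd.
    exact: (measurableT_comp measurable_snd measurable_fst).
  rewrite (_ : (fun z => _) = fun z : Om * Y => \int[S z.1]_t k ((p, spread_tuple p t), z.2)).
    apply: (@measurable_fun_integral_cover _ _ _ _ R (fun z : Om * Y => S z.1)
      (fun n => rect (fun=> big_ball n)) _ _ _ _ _
      (fun z => k ((p, spread_tuple p z.2), z.1.2))) => //.
    - by move=> U mU; exact: (measurableT_comp (mS _ mU) measurable_fst).
    - by move=> i; apply: measurable_rect => _; exact: measurable_big_ball.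
    - by apply: nondecreasing_rect; exact: nondecreasing_big_ball.
    - by apply: rect_cover; [exact: nondecreasing_big_ball|exact: bigcup_big_ball].
  apply/funext => z; rewrite SE//.
  exact: (measurableT_comp mkp (pair1_measurable z)).
apply/funext => z.
rewrite (@esum_tuples_partition _ _ _ _ (fun p s => k ((p, map_tuple fst s), z.2)))//.
by under eq_bigr do under eq_esum do rewrite map_spread_tuple.
Qed.

(** For each [p], [mecke] is used with [k] the number of cells. The tilt thus contributes one
    exponential for each cell, not for each index, and this is what produces the moment measure of
    the tilted intensity. *)
Lemma mecke_point_tuples (w : borel V -> R)
    (G : set_partition n * n.-tuple (borel V) -> \bar R) :
  measurable_fun setT w -> (forall v, 0 <= w v)%R ->
  measurable_fun setT G -> (forall z, 0 <= G z) ->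
  \int[P]_om (expeR (- \int[N om]_v (w v)%:E) *
    \esum_(s in point_tuples (N om)) G (induced_partition s, map_tuple fst s)) =
  expeR (- Lambda nu w) * \sum_p iter_integral nu setT
    (fun t => (\prod_j (expR (- w (tnth t j)))%:E) * G (p, spread_tuple p t)).
Proof.
move=> mw w0 mG G0.
have E0 (p : set_partition n) om :
    0 <= \esum_(t in dtuples (points (N om)) #|val p|) G (p, spread_tuple p (map_tuple fst t)).
  by apply: esum_ge0.
transitivity (\int[P]_om \sum_(p : set_partition n) (expeR (- \int[N om]_v (w v)%:E) *
    \esum_(t in dtuples (points (N om)) #|val p|) G (p, spread_tuple p (map_tuple fst t)))).
  apply: eq_integral => om _; rewrite -ge0_sume_distrr//; congr (_ * _).
  rewrite (@esum_tuples_partition _ _ _ _ (fun p s => G (p, map_tuple fst s)))//.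
  by under eq_bigr do under eq_esum do rewrite map_spread_tuple.
have mNw : measurable_fun setT (fun om => expeR (- \int[N om]_v (w v)%:E)).
  apply: measurable_expeRN; last first.
    by move=> om; apply: integral_ge0 => v _; rewrite lee_fin.
  apply: (@measurable_fun_integral_kernel _ _ _ _ _ N) => //.
  - by move=> U mU; exact: measurable_kernel.
  - exact/measurable_EFinP.
rewrite ge0_integral_sum//; last 2 first.
- move=> p; apply: emeasurable_funM => //.
  have [S [SE mS Soo]] := dtuples_measure Vsep nu_bf N_prm #|val p|.
  under eq_fun.
    move=> om; rewrite -(SE om (fun t => G (p, spread_tuple p t)))//; last first.
      exact: measurable_at_partition.
    over.
  apply: measurable_fun_integral_kernel => //.
  exact: measurable_at_partition.
- by move=> p om _; rewrite mule_ge0 ?expeR_ge0.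
rewrite ge0_sume_distrr; last first.
  move=> p _; have [mu ->] := boundedly_finite_sigma_finite nu_bf.
  have [m mE] := @iter_measure _ _ R mu setT #|val p| measurableT.
  have p0 (t : #|val p|.-tuple (borel V)) :
      0 <= (\prod_j (expR (- w (tnth t j)))%:E) * G (p, spread_tuple p t).
    by rewrite mule_ge0// prode_ge0// => j _; rewrite lee_fin expR_ge0.
  rewrite mE//; first by apply: integral_ge0.
  apply: emeasurable_funM; last exact: measurable_at_partition.
  apply: (@measurable_prod_tnth _ _ _ _ (fun=> fun v => (expR (- w v))%:E)) => [i|i x].
    by apply/measurable_EFinP; apply: measurableT_comp => //; exact: measurableT_comp.
  by rewrite lee_fin expR_ge0.
apply: eq_bigr => p _.
rewrite (mecke Vsep nu_bf N_prm mw w0 (g := fun t => G (p, spread_tuple p t)))//.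
exact: measurable_at_partition.
Qed.

End mecke_point_tuples.

(** * Generalized inverse Gaussian densities *)

Section gig.
Context {R : realType}.
Local Open Scope ring_scope.
Notation leb := (@lebesgue_measure R).

(** The square makes the base nonnegative, where [powR] with exponent -1 is the inverse; at 0 both
    expressions are 0. *)
Lemma measurable_fun_inv : measurable_fun setT (fun x : R => x^-1).
Proof.
rewrite (_ : (fun x => _) = fun x : R => x * powR (x ^+ 2) (-1)).
  apply: measurable_funM => //.
  apply: (measurableT_comp (measurable_powR (-1))).
  exact: measurable_funX.
apply/funext => x; rewrite powR_inv1 ?sqr_ge0//.
have [->|x0] := eqVneq x 0; first by rewrite invr0 mul0r.
by field.
Qed.

Lemma measurable_gig_kernel (l delta v : R) : measurable_fun setT (gig_kernel l delta v).
Proof.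
apply: measurable_funM; first exact: measurable_powR.
apply: measurableT_comp => //; apply: measurable_funM => //.
apply: measurableT_comp => //; apply: measurable_funD; last exact: measurable_funM.
by apply: measurable_funM => //; exact: measurable_fun_inv.
Qed.

Lemma gig_kernel_ge0 (l delta v t : R) : 0 <= gig_kernel l delta v t.
Proof. by rewrite mulr_ge0 ?powR_ge0 ?expR_ge0. Qed.

Lemma gig_kernel_gt0 (l delta v t : R) : 0 < t -> 0 < gig_kernel l delta v t.
Proof. by move=> t0; rewrite mulr_gt0 ?powR_gt0 ?expR_gt0. Qed.

Lemma gig_kernel_tilt (l delta v s t : R) : 0 <= v ^+ 2 + 2 * s ->
  gig_kernel l delta v t * expR (- (t * s)) =
  gig_kernel l delta (Num.sqrt (v ^+ 2 + 2 * s)) t.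
Proof.
move=> vs; rewrite /gig_kernel -mulrA -expRD; congr (_ * expR _).
rewrite sqr_sqrtr//; move: (delta ^+ 2 / t) => u.
by field.
Qed.

(** A real-valued integral is [fine] of an extended one, and would be 0 if that were infinite. So
    positivity takes both a lower bound on an interval and domination by a multiple of an
    exponential density. *)
Lemma Rintegral_gt0 (D : set R) (f : R -> R) (c r C : R) :
  measurable D -> measurable_fun D f -> (forall x, D x -> 0 <= f x) ->
  `[1, 2] `<=` D -> D `<=` `[0, +oo[ -> 0 < c -> (forall x, `[1, 2]%classic x -> c <= f x) ->
  0 < r -> 0 <= C -> (forall x, D x -> f x <= C * expR (- r * x)) ->
  0 < \int[leb]_(x in D) f x.
Proof.
move=> mD mf f0 D12 D0 c0 cf r0 C0 fC.
have mfE : measurable_fun D (fun x => (f x)%:E) by exact/measurable_EFinP.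
apply: fine_gt0; apply/andP; split.
  apply: (@lt_le_trans _ _ (\int[leb]_(x in `[1%R, 2%R]) (c%:E))%E).
    rewrite integral_cst//= lebesgue_measure_itv/= lte_fin ltr1n -EFinB -EFinM lte_fin.
    by rewrite mulr_gt0// subr_gt0 ltr1n.
  apply: (@le_trans _ _ (\int[leb]_(x in `[1%R, 2%R]) ((f x)%:E))%E).
    apply: ge0_le_integral => //.
    - by move=> x _; rewrite lee_fin ltW.
    - exact: measurable_funS mfE.
  apply: ge0_subset_integral => //.
have mexp : measurable_fun setT (exponential_pdf r) := measurable_exponential_pdf r.
apply: (@le_lt_trans _ _ (\int[leb]_(x in D) ((C / r)%:E * (exponential_pdf r x)%:E))%E).
  apply: ge0_le_integral => //.
  - apply: measurable_funTS; apply: emeasurable_funM; first exact: measurable_cst.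
    exact/measurable_EFinP.
  - move=> x Dx; rewrite -EFinM lee_fin exponential_pdfE; last first.
      by have := D0 _ Dx; rewrite /= in_itv/= andbT.
    rewrite mulrA divfK ?gt_eqF//; exact: fC.
apply: (@le_lt_trans _ _ (\int[leb]_x ((C / r)%:E * (exponential_pdf r x)%:E))%E).
  apply: ge0_subset_integral => //.
  - by apply: emeasurable_funM; [exact: measurable_cst|exact/measurable_EFinP].
  - by move=> x _; rewrite mule_ge0 ?lee_fin ?divr_ge0 ?exponential_pdf_ge0 ?(ltW r0).
rewrite ge0_integralZl//; last 3 first.
- exact/measurable_EFinP.
- by move=> x _; rewrite lee_fin exponential_pdf_ge0// ltW.
- by rewrite lee_fin divr_ge0 ?(ltW r0).
by rewrite integral_exponential_pdf// mule1 ltry.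
Qed.

(** The inequality [1 + y <= expR y] at [y = a * x / k], raised to the power [k]. *)
Lemma pow_le_expR (k : nat) (a x : R) : 0 < a -> 0 <= x -> (0 < k)%N ->
  x ^+ k <= (k%:R / a) ^+ k * expR (a * x).
Proof.
move=> a0 x0 k0; have kr : 0 < k%:R :> R by rewrite ltr0n.
have -> : expR (a * x) = expR (a * x / k%:R) ^+ k.
  by rewrite -expRM_natr divfK// gt_eqF.
rewrite -exprMn; apply: lerXn2r; rewrite ?nnegrE//.
  by rewrite mulr_ge0 ?expR_ge0 ?divr_ge0 ?ltW.
rewrite [leLHS](_ : x = k%:R / a * (a * x / k%:R)); last by field; rewrite !gt_eqF.
rewrite ler_wpM2l//; first by rewrite divr_ge0 ?ltW.
by apply: le_trans (expR_ge1Dx _); rewrite lerDr.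
Qed.

Lemma besselK_gt0 (z : R) : 0 < z -> 0 < besselK (3 / 2) z.
Proof.
move=> z0; rewrite /besselK.
have mf : measurable_fun setT (fun t : R =>
    expR (- (z * ((expR t + expR (- t)) / 2))) *
    ((expR (3 / 2 * t) + expR (- (3 / 2 * t))) / 2)).
  apply: measurable_funM.
    apply: measurableT_comp => //; apply: measurableT_comp => //.
    apply: measurable_funM => //; apply: measurable_funM => //.
    apply: measurable_funD => //; exact: measurableT_comp.
  apply: measurable_funM => //; apply: measurable_funD; apply: measurableT_comp => //.
  by apply: measurableT_comp => //; exact: measurable_funM.
(* On [1, 2], cosh t <= exp 2 and cosh (3t/2) >= 1/2. For t >= 0 the integrand is at most exp (3t)
   exp (-(z/2) exp t) exp (-t), using cosh t >= exp t / 2 and cosh (3t/2) <= exp (2t); [pow_le_expR]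
   with exponent 3 at exp t bounds the first two factors. *)
apply: (@Rintegral_gt0 _ _ (expR (- (z * expR 2)) / 2) 1 ((3 / (z / 2)) ^+ 3)) => //.
- exact: measurable_funTS.
- by move=> t /=; rewrite !in_itv/= => /andP[t1 _]; rewrite andbT (le_trans ler01).
- by rewrite divr_gt0 ?expR_gt0.
- move=> t /=; rewrite in_itv/= => /andP[t1 t2].
  have t0 : 0 <= t by rewrite (le_trans ler01).
  apply: ler_pM; rewrite ?expR_ge0 ?invr_ge0//.
    rewrite ler_expR lerN2 ler_pM2l// ler_pdivrMr// mulr_natr mulr2n.
    rewrite lerD// ler_expR// (le_trans _ t2)// (le_trans _ t0)// oppr_le0//.
  rewrite -[leLHS]mul1r ler_wpM2r// -[leLHS]addr0 lerD ?expR_ge0//.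
  by rewrite -[leLHS]expR0 ler_expR mulr_ge0.
- by rewrite exprn_ge0// divr_ge0// divr_ge0// ltW.
- move=> t /=; rewrite in_itv/= andbT => t0; rewrite mulN1r.
  have e1 : 1 <= expR t by rewrite -expR0 ler_expR.
  have := @pow_le_expR 3 (z / 2) (expR t) _ (expR_ge0 _) isT.
  rewrite divr_gt0// => /(_ isT) h.
  have le2 : (expR (3 / 2 * t) + expR (- (3 / 2 * t))) / 2 <= expR t ^+ 2.
    rewrite ler_pdivrMr// mulr_natr [_ ^+ 2 *+ 2]mulr2n -expRM_natr.
    by apply: lerD; rewrite ler_expR; lra.
  have le1 : expR (- (z * ((expR t + expR (- t)) / 2))) <= expR (- (z / 2 * expR t)).
    rewrite ler_expR lerN2 -mulrA ler_pM2l// mulrC ler_pM2r ?invr_gt0//.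
    by rewrite lerDl expR_ge0.
  apply: (le_trans (ler_pM _ _ le1 le2)); rewrite ?expR_ge0//.
  rewrite [expR (- t)]expRN ler_pdivlMr ?expR_gt0// [leLHS](_ : _ = expR t ^+ 3 / expR (z / 2 * expR t)).
    by rewrite ler_pdivrMr ?expR_gt0.
  by rewrite expRN; ring.
Qed.

Lemma gamma_kernel_gt0 (v : R) : 0 < v ->
  0 < \int[leb]_(s in `]0, +oo[) gig_kernel (3 / 2) 0 v s.
Proof.
move=> v0; have v20 : 0 < v ^+ 2 / 4 by rewrite divr_gt0// exprn_gt0.
(* On [1, 2] the power is at least 1 and the exponential is smallest at 2, which gives
   [gig_kernel 1 0 v 2]. For the upper bound, half of the decay rate [v ^+ 2 / 2] pays for the
   square root, which is at most [1 + t]; the other half is the rate [v ^+ 2 / 4]. *)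
apply: (@Rintegral_gt0 _ _ (gig_kernel 1 0 v 2) (v ^+ 2 / 4)
  (1 + (1 / (v ^+ 2 / 4)) ^+ 1)) => //.
- by apply: measurable_funTS; exact: measurable_gig_kernel.
- by move=> t _; exact: gig_kernel_ge0.
- by move=> t /=; rewrite !in_itv/= => /andP[t1 _]; rewrite andbT (lt_le_trans ltr01).
- by move=> t /=; rewrite !in_itv/= !andbT; exact: ltW.
- exact: gig_kernel_gt0.
- move=> t /=; rewrite in_itv/= => /andP[t1 t2].
  have t0 : 0 < t by rewrite (lt_le_trans ltr01).
  apply: ler_pM; rewrite ?expR_ge0 ?powR_ge0//.
    rewrite subrr powRr0 (@le_trans _ _ (powR 1 (3 / 2 - 1)))//.
      by rewrite powR1.
    by rewrite ge0_ler_powR ?nnegrE//; lra.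
  rewrite ler_expR ler_pM2r ?invr_gt0// lerN2 !expr0n/= !mul0r !add0r.
  by rewrite ler_wpM2l ?sqr_ge0.
- by rewrite addr_ge0// exprn_ge0// divr_ge0// ltW.
- move=> t /=; rewrite in_itv/= andbT => t0.
  have := @pow_le_expR 1 (v ^+ 2 / 4) t v20 (ltW t0) isT; rewrite expr1 => h.
  have le1 : powR t (3 / 2 - 1) <= 1 + t.
    have [t1|t1] := lerP t 1.
      rewrite (@le_trans _ _ (powR 1 (3 / 2 - 1)))//.
        rewrite ge0_ler_powR ?nnegrE ?(ltW t0)//; lra.
      by rewrite powR1 lerDl ltW.
    rewrite (@le_trans _ _ (powR t 1))//.
      rewrite ler_powR ?(ltW t1)//; lra.
    by rewrite powRr1 ?(ltW t0)// lerDr.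
  have e1 : 1 <= expR (v ^+ 2 / 4 * t) by rewrite -[leLHS]expR0 ler_expR ltW// mulr_gt0.
  have le2 : 1 + t <= (1 + (1 / (v ^+ 2 / 4)) ^+ 1) * expR (v ^+ 2 / 4 * t).
    by rewrite mulrDl mul1r lerD.
  apply: (@le_trans _ _ ((1 + (1 / (v ^+ 2 / 4)) ^+ 1) * expR (v ^+ 2 / 4 * t) *
      expR (- (0 ^+ 2 / t + v ^+ 2 * t) / 2))).
    by rewrite ler_wpM2r ?expR_ge0// (le_trans le1).
  rewrite -mulrA -expRD expr0n/= mul0r add0r.
  by rewrite (_ : v ^+ 2 / 4 * t + _ = - (v ^+ 2 / 4) * t)//; field.
Qed.

(** Laws matter up to a positive factor only, so what counts is that the normalising constant of
    each branch is positive. *)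
Lemma gig_pdfE (beta v : R) : 0 < v -> exists2 c : R, 0 < c &
  forall t, gig_pdf (3 / 2) `|beta| v t = c * gig_kernel (3 / 2) `|beta| v t.
Proof.
move=> v0; rewrite /gig_pdf; have [->|b0] := eqVneq `|beta| 0.
  exists (\int[leb]_(s in `]0, +oo[) gig_kernel (3 / 2) 0 v s)^-1.
    by rewrite invr_gt0 gamma_kernel_gt0.
  by move=> t; rewrite mulrC.
have bp : 0 < `|beta| by rewrite lt0r b0 normr_ge0.
exists (powR (v / `|beta|) (3 / 2) / (2 * besselK (3 / 2) (`|beta| * v))) => //.
by rewrite divr_gt0 ?powR_gt0 ?divr_gt0// mulr_gt0// besselK_gt0// mulr_gt0.
Qed.

(** The cross term of the square is the factor [expR ((x - m) * beta)]; the standard deviation in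
    the denominator gives the power 1/2 = 3/2 - 1 of [w]. *)
Lemma phi_gig_kernel (x m beta w : R) : 0 < w ->
  phi x (m + beta * w^-1) w^-1 =
  normal_peak 1 * expR ((x - m) * beta) * gig_kernel (3 / 2) `|beta| `|x - m| w.
Proof.
move=> w0; have w00 : w != 0 by rewrite gt_eqF.
have wi0 : 0 < w^-1 by rewrite invr_gt0.
have s0 : Num.sqrt w^-1 != 0 by rewrite gt_eqF// sqrtr_gt0.
rewrite /phi normal_pdfE// /normal_peak /normal_fun sqr_sqrtr ?ltW//.
rewrite /gig_kernel (_ : 3 / 2 - 1 = 2^-1 :> R); last by field.
rewrite powR12_sqrt ?(ltW w0)// expr1n mul1r !real_normK ?num_real//.
rewrite -mulrnAr sqrtrM ?(ltW wi0)// invfM sqrtrV ?(ltW w0)// invrK.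
rewrite (_ : expR (- (x - (m + beta / w)) ^+ 2 / (w^-1 *+ 2)) = expR ((x - m) * beta) *
    expR (- (beta ^+ 2 / w + (x - m) ^+ 2 * w) / 2)); first by ring.
by rewrite -expRD; congr expR; field.
Qed.

End gig.

(** * The posterior *)

Section intensity.
Context {R : realType} {V : completeMetricType R}.
Variable nu : {measure set (borel V) -> \bar R}.
Hypothesis nu_bf : @boundedly_finite R V nu.
Variables (n : nat) (f : 'I_n -> borel V -> R).
Hypotheses (f_meas : forall i, measurable_fun setT (f i)).
Hypotheses (f_ge0 : forall i v, (0 <= f i v)%R).
Notation Rn := (n.-tuple (measurableTypeR R)).
Notation Vn := (n.-tuple (borel V)).
Notation pos := (fun w : Rn => forall i, (0 < tnth w i :> R)%R).

Lemma measurable_Omega (w : Rn) : measurable_fun setT (Omega f w).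
Proof. by apply: measurable_sum => i; apply: measurable_funM. Qed.

Lemma Omega_ge0 (w : Rn) v : (forall i, 0 <= tnth w i :> R)%R -> (0 <= Omega f w v)%R.
Proof. by move=> w0; apply: sumr_ge0 => i _; rewrite mulr_ge0. Qed.

Let mexpO (w : Rn) : measurable_fun setT (fun v => expR (- Omega f w v)).
Proof.
by apply: measurableT_comp => //; apply: measurableT_comp => //; exact: measurable_Omega.
Qed.

Lemma nu_Omega_measure (w : Rn) : exists m : {measure set (borel V) -> \bar R},
  (m : set (borel V) -> \bar R) = nu_Omega nu f w /\
  forall g : borel V -> \bar R, measurable_fun setT g -> (forall v, 0 <= g v) ->
    \int[m]_v g v = \int[nu]_v ((expR (- Omega f w v))%:E * g v).
Proof.
have [|m mE] := density_measure nu (mexpO w); first by move=> v; exact: expR_ge0.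
have [||m' m'E] := @measure_of_set_fun _ _ _ m (nu_Omega nu f w).
- by move=> A; apply: integral_ge0 => v _; rewrite lee_fin expR_ge0.
- move=> A mA; rewrite measure_integral// mE//; last first.
    exact/measurable_EFinP/measurable_indic.
  by rewrite /nu_Omega [LHS]integral_mkcond epatch_indic; apply: eq_integral.
exists m'; split=> // g mg g0; rewrite -mE//.
apply: eq_measure_integral => A mA _; rewrite m'E measure_integral// mE//; last first.
  exact/measurable_EFinP/measurable_indic.
by rewrite /nu_Omega [LHS]integral_mkcond epatch_indic; apply: eq_integral.
Qed.

Lemma boundedly_finite_nu_Omega (w : Rn) : (forall i, 0 <= tnth w i :> R)%R ->
  boundedly_finite (nu_Omega nu f w).
Proof.
move=> w0 A mA bA; apply: le_lt_trans (nu_bf mA bA).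
rewrite /nu_Omega -[leRHS]mul1e -(integral_cst _ mA 1%E).
apply: ge0_le_integral => //.
- by apply: measurable_funTS; exact/measurable_EFinP.
- by move=> v _; rewrite lee_fin -[leRHS]expR0 ler_expR oppr_le0 Omega_ge0.
Qed.

Lemma moment_integral_nu_Omega (w : Rn) (G : set_partition n * Vn -> \bar R) :
  measurable_fun setT G -> (forall z, 0 <= G z) ->
  moment_integral (nu_Omega nu f w) G = \sum_p iter_integral nu setT
    (fun t => (\prod_j (expR (- Omega f w (tnth t j)))%:E) * G (p, spread_tuple p t)).
Proof.
move=> mG G0; have [m [<- mE]] := nu_Omega_measure w.
have [mu nuE] := boundedly_finite_sigma_finite nu_bf.
rewrite nuE in mE *.
apply: eq_bigr => p _.
transitivity (iter_integral m setT (fun t => G (p, spread_tuple p t))).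
  by apply: eq_iter_integral => t _; rewrite spreadE.
rewrite (@iter_integral_density _ _ _ mu m (fun v => expR (- Omega f w v)))//.
exact: measurable_at_partition.
Qed.

Lemma prod_f_cells_spread (p : set_partition n) (t : #|val p|.-tuple (borel V)) :
  prod_f f (spread_tuple p t) = prod_f_cells f p (spread_tuple p t).
Proof.
rewrite /prod_f -(prod_cells _ p); apply: eq_bigr => C Cp; apply: eq_bigr => i iC.
by rewrite (at_cell_spread _ _ _ Cp iC).
Qed.

Lemma measurable_prod_f : measurable_fun setT (prod_f f : Vn -> R).
Proof.
apply: measurable_prod => i _; apply: measurableT_comp => //.
exact: measurable_tnth.
Qed.

Lemma prod_f_ge0 (v : Vn) : (0 <= prod_f f v)%R.
Proof. by apply: prodr_ge0 => i _. Qed.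

(** For fixed [p] the integrand is a product over the cells of functions of one distinct value each,
    so the iterated integral factorises. The tilted intensity is again boundedly finite, which
    supplies the sigma-finiteness for this. *)
Lemma B_coefE (w : Rn) : (forall i, 0 <= tnth w i :> R)%R ->
  moment_integral (nu_Omega nu f w) (fun pv => (prod_f f pv.2)%:E) = B_coef nu f w.
Proof.
move=> w0; have [m [mE _]] := nu_Omega_measure w.
have bm : @boundedly_finite R V m by rewrite mE; exact: boundedly_finite_nu_Omega.
have [mu muE] := boundedly_finite_sigma_finite bm.
rewrite /moment_integral /B_coef -mE muE; apply: eq_bigr => p _.
under eq_iter_integral => t _ do rewrite /= spreadE prod_f_cells_spread /prod_f_cells
  big_enum_val/=.
transitivity (iter_integral mu setT (fun t : #|val p|.-tuple (borel V) =>
    \prod_(j < #|val p|) (\prod_(i in (enum_val j : {set 'I_n})) f i (tnth t j))%:E)).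
  apply: eq_iter_integral => t _; rewrite prodEFin; congr EFin; apply: eq_bigr => j _.
  by apply: eq_bigr => i _; rewrite at_cell_enum_val.
rewrite (@iter_integral_prod _ _ _ mu setT _
  (fun j v => (\prod_(i in (enum_val j : {set 'I_n})) f i v)%:E))//.
- by rewrite [RHS]big_enum_val.
- move=> j; apply/measurable_EFinP; under eq_fun do rewrite -big_enum.
  by apply: measurable_prod.
- by move=> j v; rewrite lee_fin prodr_ge0.
Qed.

Lemma v_formula_cellsE (w : Rn) A : v_formula nu f w A = v_formula_cells nu f w A.
Proof.
apply: eq_bigr => p _; apply: eq_iter_integral => t _.
by rewrite /= spreadE prod_f_cells_spread.
Qed.

(** The cell of [i] itself is one of the summands. This makes the sum in the GIG parameter positive
    wherever [prod_f] is. *)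
Lemma sum_f_cells_spread_ge (i : 'I_n) (p : set_partition n)
    (t : #|val p|.-tuple (borel V)) :
  (f i (tnth (spread_tuple p t) i) <= sum_f_cells f i p (spread_tuple p t))%R.
Proof.
rewrite /sum_f_cells big_enum_val/= (bigD1 (cell p i))//= at_cell_enum_val.
rewrite tnth_spread_tuple lerDl; apply: sumr_ge0 => j _.
by rewrite at_cell_enum_val.
Qed.

Lemma sum_f_cells_ge0 (i : 'I_n) (p : set_partition n) (v : Vn) :
  (0 <= sum_f_cells f i p v)%R.
Proof.
by apply: sumr_ge0 => C _; rewrite /at_cell; case: pickP => //= k _.
Qed.

Lemma measurable_at_cell d' (U : measurableType d') (u0 : U)
    d'' (Y : measurableType d'') (h : borel V * Y -> U) (C : {set 'I_n}) :
  measurable_fun setT h ->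
  measurable_fun setT (fun z : Vn * Y => at_cell u0 (fun v => h (v, z.2)) z.1 C).
Proof.
move=> mh; rewrite /at_cell; case: pickP => [k _|_] /=; last exact: measurable_cst.
apply: (measurableT_comp mh); apply: measurable_fun_pair => //.
exact: (measurableT_comp (measurable_tnth k) measurable_fst).
Qed.

(* Keeps the weights nonnegative off the orthant, where values are irrelevant. *)
Definition abs_tuple (w : Rn) : Rn := map_tuple Num.norm w.

Lemma abs_tuple_pos (w : Rn) : pos w -> abs_tuple w = w.
Proof.
by move=> w0; apply: eq_from_tnth => i; rewrite tnth_map ger0_norm// ltW.
Qed.

Lemma abs_tuple_ge0 (w : Rn) i : (0 <= tnth (abs_tuple w) i :> R)%R.
Proof. by rewrite tnth_map. Qed.

Lemma measurable_Omega_abs : measurable_fun setT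
  (fun z : borel V * Rn => Omega f (abs_tuple z.2) z.1).
Proof.
apply: measurable_sum => i; apply: measurable_funM.
  rewrite (_ : (fun _ => _) = fun z : borel V * Rn => `|tnth z.2 i|%R).
    apply: measurableT_comp => //.
    exact: (measurableT_comp (measurable_tnth i) measurable_snd).
  by apply/funext => z; rewrite tnth_map.
exact: (measurableT_comp (f_meas i) measurable_fst).
Qed.

(** The density of the moment measure of [nu_Omega] against that of [nu], one factor per cell,
    extended to all vectors and all weights. *)
Definition tilt (p : set_partition n) (v : Vn) (w : Rn) : R :=
  (\prod_(C in val p) at_cell 1 (fun x => expR (- Omega f (abs_tuple w) x)) v C)%R.

Lemma tilt_ge0 p v w : (0 <= tilt p v w)%R.
Proof.
apply: prodr_ge0 => C _; rewrite /at_cell; case: pickP => //= k _.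
Qed.

Lemma tilt_spread (p : set_partition n) (t : #|val p|.-tuple (borel V)) w :
  (tilt p (spread_tuple p t) w)%:E =
  \prod_j (expR (- Omega f (abs_tuple w) (tnth t j)))%:E.
Proof.
rewrite /tilt prodEFin; congr EFin; rewrite [LHS]big_enum_val/=.
by apply: eq_bigr => j _; rewrite at_cell_enum_val.
Qed.

Lemma measurable_tilt : measurable_fun setT
  (fun z : (set_partition n * Vn) * Rn => tilt z.1.1 z.1.2 z.2).
Proof.
apply: (measurableT_comp (f := fun z : set_partition n * (Vn * Rn) => tilt z.1 z.2.1 z.2.2)
  (g := fun z : (set_partition n * Vn) * Rn => (z.1.1, (z.1.2, z.2)))).
  apply: measurable_fun_partition => p; rewrite /tilt /=.
  under eq_fun do rewrite -big_enum.
  apply: measurable_prod => C _.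
  apply: (@measurable_at_cell _ (measurableTypeR R) 1%R _ Rn
    (fun z : borel V * Rn => expR (- Omega f (abs_tuple z.2) z.1)) C).
  apply: measurableT_comp => //; apply: measurableT_comp => //.
  exact: measurable_Omega_abs.
apply: measurable_fun_pair; first exact: (measurableT_comp measurable_fst measurable_fst).
apply: measurable_fun_pair => //.
exact: (measurableT_comp measurable_snd measurable_fst).
Qed.

Lemma measurable_sum_f_cells i : measurable_fun setT
  (fun z : set_partition n * Vn => sum_f_cells f i z.1 z.2).
Proof.
apply: measurable_fun_partition => p; rewrite /sum_f_cells /=.
under eq_fun do rewrite -big_enum.
apply: measurable_sum => C.
rewrite /at_cell; case: pickP => [k _|_] /=; last exact: measurable_cst.
exact: (measurableT_comp (f_meas i) (measurable_tnth k)).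
Qed.

(** Exchanging cells and indices pairs each weight with the values of [f i] at all cells. This is
    why the parameter in (i) sums [f i] over every distinct value and not only at the [i]-th
    point. *)
Lemma tilt_sum_f_cells p v (w : Rn) :
  tilt p v w = (\prod_(i < n) expR (- (`|tnth w i| * sum_f_cells f i p v)))%R.
Proof.
rewrite -expR_sum sumrN; under eq_bigr do rewrite mulr_sumr.
rewrite exchange_big/= -sumrN expR_sum; apply: eq_bigr => C _.
rewrite /at_cell; case: pickP => /= [k _|_].
  by congr (expR (- _)); apply: eq_bigr => i _; rewrite tnth_map.
by rewrite big1 ?oppr0 ?expR0// => i _; rewrite mulr0.
Qed.

Lemma Lambda_ge0 (h : borel V -> R) : (forall v, 0 <= h v)%R -> 0 <= Lambda nu h.
Proof.
move=> h0; apply: integral_ge0 => v _.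
by rewrite lee_fin subr_ge0 -expR0 ler_expR oppr_le0.
Qed.

Lemma measurable_Lambda_abs :
  measurable_fun setT (fun w : Rn => Lambda nu (Omega f (abs_tuple w))).
Proof.
have [mu nuE] := boundedly_finite_sigma_finite nu_bf; rewrite /Lambda nuE.
apply: (@measurable_fun_fubini_tonelli_G _ _ _ _ _ mu
  (fun z : borel V * Rn => (1 - expR (- Omega f (abs_tuple z.2) z.1))%:E)).
  apply/measurable_EFinP; apply: measurable_funB => //.
  apply: measurableT_comp => //; apply: measurableT_comp => //.
  exact: measurable_Omega_abs.
move=> z; rewrite lee_fin subr_ge0 -expR0 ler_expR oppr_le0.
by apply: Omega_ge0 => i; exact: abs_tuple_ge0.
Qed.

End intensity.

Lemma expeRN_sum (R : realType) (I : Type) (s : seq I) (a : I -> \bar R) :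
  (forall i, 0 <= a i) ->
  \prod_(i <- s) expeR (- a i) = expeR (- \sum_(i <- s) a i).
Proof.
move=> a0; elim: s => [|i s IH]; first by rewrite !big_nil oppe0 expeR0.
rewrite !big_cons IH oppeD ?expeRD//.
by rewrite ge0_adde_def// inE ?sume_ge0.
Qed.

Lemma eq_orthant_integral (R : realType) n
    (g h : n.-tuple (measurableTypeR R) -> \bar R) :
  (forall w, (forall i, 0 < tnth w i :> R)%R -> g w = h w) ->
  orthant_integral g = orthant_integral h.
Proof.
move=> gh; apply: eq_iter_integral => w wD; apply: gh => i.
by have := wD i; rewrite /= in_itv/= andbT.
Qed.

Section posterior_density.
Context {R : realType} {V : completeMetricType R}.
Variable nu : {measure set (borel V) -> \bar R}.
Hypothesis nu_bf : @boundedly_finite R V nu.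
Variables (n : nat) (f : 'I_n -> borel V -> R).
Hypotheses (f_meas : forall i, measurable_fun setT (f i)).
Hypotheses (f_ge0 : forall i v, (0 <= f i v)%R).
Notation Rn := (n.-tuple (measurableTypeR R)).
Notation Vn := (n.-tuple (borel V)).
Notation pos w := (forall i, (0 < tnth w i :> R)%R).
Hypothesis Lambda_fin : forall w : Rn,
  (forall i, (0 <= tnth w i :> R)%R) -> Lambda nu (Omega f w) < +oo.
Variables (mu Delta beta : R) (X : 'I_n -> R).

(* [normal_lik] on the orthant; unlike it, measurable by inspection elsewhere. *)
Definition lik (w : Rn) : R := (\prod_(i < n)
  (normal_peak 1 * expR ((X i - mu * Delta) * beta) *
   gig_kernel (3 / 2) `|beta| `|X i - mu * Delta| (tnth w i)))%R.

Lemma likE w : pos w -> normal_lik mu Delta beta X w = lik w.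
Proof. by move=> w0; apply: eq_bigr => i _; exact: phi_gig_kernel. Qed.

Lemma lik_ge0 w : (0 <= lik w)%R.
Proof.
apply: prodr_ge0 => i _; rewrite mulr_ge0 ?gig_kernel_ge0// mulr_ge0 ?expR_ge0//.
exact: normal_peak_ge0.
Qed.

Lemma lik_gt0 w : pos w -> (0 < lik w)%R.
Proof.
move=> w0; apply: prodr_gt0 => i _; rewrite mulr_gt0 ?gig_kernel_gt0//.
by rewrite mulr_gt0 ?expR_gt0// normal_peak_gt0// oner_neq0.
Qed.

Lemma measurable_lik : measurable_fun setT lik.
Proof.
apply: measurable_prod => i _; apply: measurable_funM; first exact: measurable_cst.
exact: (measurableT_comp (measurable_gig_kernel _ _ _) (measurable_tnth i)).
Qed.

(** Real-valued and measurable on the whole space; on the orthant it is the extended exponential,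
    thanks to [Lambda_fin]. *)
Definition exp_Lambda (w : Rn) : R := expR (- fine (Lambda nu (Omega f (abs_tuple w)))).

Lemma exp_LambdaE w : pos w -> expeR (- Lambda nu (Omega f w)) = (exp_Lambda w)%:E.
Proof.
move=> w0; rewrite /exp_Lambda abs_tuple_pos//.
have w0' i : (0 <= tnth w i :> R)%R by exact: ltW.
rewrite expeRN_EFin ?Lambda_fin ?mul1r//.
by apply: Lambda_ge0 => v; exact: Omega_ge0.
Qed.

Lemma measurable_exp_Lambda : measurable_fun setT exp_Lambda.
Proof.
apply: measurableT_comp => //; apply: measurableT_comp => //.
by apply: measurableT_comp => //; exact: measurable_Lambda_abs.
Qed.

Definition post_density (z : (set_partition n * Vn) * Rn) : R :=
  (prod_f f z.1.2 * tilt f z.1.1 z.1.2 z.2 * exp_Lambda z.2 * lik z.2)%R.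

Lemma post_density_ge0 z : (0 <= post_density z)%R.
Proof. by rewrite !mulr_ge0 ?expR_ge0 ?lik_ge0 ?tilt_ge0 ?prod_f_ge0. Qed.

Lemma measurable_post_density : measurable_fun setT post_density.
Proof.
apply: measurable_funM; last exact: (measurableT_comp measurable_lik measurable_snd).
apply: measurable_funM.
  apply: measurable_funM; last exact: measurable_tilt.
  apply: (measurableT_comp (measurable_prod_f f_meas)).
  exact: (measurableT_comp measurable_snd measurable_fst).
exact: (measurableT_comp measurable_exp_Lambda measurable_snd).
Qed.

Variable rho : {sigma_finite_measure set (set_partition n * Vn)%type -> \bar R}.
Hypothesis rhoE : forall g : set_partition n * Vn -> \bar R,
  measurable_fun setT g -> (forall z, 0 <= g z) ->
  \int[rho]_z g z = \sum_p iter_integral nu setT (fun t => g (p, spread_tuple p t)).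
Variable lam : {sigma_finite_measure set Rn -> \bar R}.
Hypothesis lamE : forall g : Rn -> \bar R, measurable_fun setT g ->
  (forall w, 0 <= g w) -> orthant_integral g = \int[lam]_w g w.

Lemma post_formula w (G : set_partition n * Vn -> \bar R) : pos w ->
  measurable_fun setT G -> (forall z, 0 <= G z) ->
  moment_integral (nu_Omega nu f w) (fun pv => (prod_f f pv.2)%:E * G pv) *
    expeR (- Lambda nu (Omega f w)) * (normal_lik mu Delta beta X w)%:E =
  \int[rho]_pv ((post_density (pv, w))%:E * G pv).
Proof.
move=> w0 mG G0.
have mfG : measurable_fun setT (fun pv : set_partition n * Vn => (prod_f f pv.2)%:E * G pv).
  apply: emeasurable_funM => //; apply/measurable_EFinP.
  exact: (measurableT_comp (measurable_prod_f f_meas) measurable_snd).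
have fG0 (pv : set_partition n * Vn) : 0 <= (prod_f f pv.2)%:E * G pv.
  by rewrite mule_ge0 ?lee_fin ?prod_f_ge0.
have mtw : measurable_fun setT (fun pv : set_partition n * Vn => tilt f pv.1 pv.2 w).
  exact: (measurableT_comp (measurable_tilt f_meas) (pair2_measurable w)).
rewrite moment_integral_nu_Omega// exp_LambdaE// likE//.
transitivity ((exp_Lambda w * lik w)%:E *
    \int[rho]_pv ((tilt f pv.1 pv.2 w)%:E * ((prod_f f pv.2)%:E * G pv))).
  rewrite rhoE//; last 2 first.
  - by apply: emeasurable_funM => //; exact/measurable_EFinP.
  - by move=> z; rewrite mule_ge0 ?lee_fin ?tilt_ge0.
  rewrite EFinM -muleA muleC; congr (_ * _); apply: eq_bigr => p _.
  by apply: eq_iter_integral => t _; rewrite /= tilt_spread abs_tuple_pos.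
rewrite -ge0_integralZl//; last 3 first.
- by apply: emeasurable_funM => //; exact/measurable_EFinP.
- by move=> z _; rewrite mule_ge0 ?lee_fin ?tilt_ge0.
- by rewrite lee_fin mulr_ge0 ?expR_ge0 ?lik_ge0.
apply: eq_integral => pv _; rewrite /post_density /= !muleA -!EFinM; congr (_%:E * _).
by ring.
Qed.

(** The meeting point of the proof: the claimed formula and the augmented joint measure are both
    shown equal to it, and its total mass is the likelihood. The inner integral is over [(p, v)], as
    in the formula. *)
Definition post_measure (B : set ((set_partition n * Vn) * Rn)) : \bar R :=
  \int[lam]_w \int[rho]_pv ((post_density (pv, w))%:E * (\1_B (pv, w))%:E).

Let mpost1 B : measurable B -> measurable_fun setT
  (fun z : (set_partition n * Vn) * Rn => (post_density z)%:E * (\1_B z)%:E).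
Proof.
move=> mB; apply: emeasurable_funM; first by apply/measurable_EFinP; exact: measurable_post_density.
exact/measurable_EFinP/measurable_indic.
Qed.

Let post10 B z : 0 <= (post_density z)%:E * (\1_B z)%:E.
Proof. by rewrite mule_ge0 ?lee_fin ?post_density_ge0. Qed.

Lemma orthant_post B : measurable B -> post_measure B =
  orthant_integral (fun w => \int[rho]_pv ((post_density (pv, w))%:E * (\1_B (pv, w))%:E)).
Proof.
move=> mB; rewrite lamE//.
- exact: (@measurable_fun_fubini_tonelli_G _ _ _ _ _ rho _ (mpost1 mB) (post10 B)).
- by move=> w; apply: integral_ge0.
Qed.

Let mB1 (B : set ((set_partition n * Vn) * Rn)) w : measurable B -> measurable_fun setT
  (fun pv : set_partition n * Vn => (\1_B (pv, w))%:E : \bar R).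
Proof.
move=> mB; apply: (measurableT_comp (f := fun z => (\1_B z)%:E)).
  exact/measurable_EFinP/measurable_indic.
exact: pair2_measurable.
Qed.

Lemma joint_formulaE B : measurable B ->
  joint_formula nu f mu Delta beta X B = post_measure B.
Proof.
move=> mB; rewrite orthant_post//; apply: eq_orthant_integral => w w0.
by rewrite (post_formula (G := fun pv => (\1_B (pv, w))%:E))//; exact: mB1.
Qed.

Hypothesis Vsep : separable V.
Context d (Om : measurableType d) (P : probability Om R) (N : R.-ker Om ~> borel V).
Hypothesis N_prm : poisson_random_measure P nu N.

Let tau_ge0 om i : 0 <= tau f N om i.
Proof. by apply: integral_ge0 => v _; rewrite lee_fin. Qed.

Let mtau i : measurable_fun setT (tau f N ^~ i).
Proof.
apply: (@measurable_fun_integral_kernel _ _ _ _ _ N).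
- by move=> U mU; exact: measurable_kernel.
- by move=> v; rewrite lee_fin.
- exact/measurable_EFinP.
Qed.

Lemma sum_tau om (w : Rn) : (forall i, 0 <= tnth w i :> R)%R ->
  \sum_(i < n) (tnth w i)%:E * tau f N om i = \int[N om]_v (Omega f w v)%:E.
Proof.
move=> w0; rewrite /Omega; under [RHS]eq_integral do rewrite -sumEFin.
rewrite ge0_integral_sum//; last 2 first.
- by move=> i; apply/measurable_EFinP; exact: measurable_funM.
- by move=> i v _; rewrite lee_fin mulr_ge0.
apply: eq_bigr => i _; under [RHS]eq_integral do rewrite EFinM.
rewrite ge0_integralZl ?lee_fin//; first exact/measurable_EFinP.
by move=> v _; rewrite lee_fin.
Qed.

Lemma prod_expeR_tau om (w : Rn) : (forall i, 0 <= tnth w i :> R)%R ->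
  \prod_(i < n) expeR (- ((tnth w i)%:E * tau f N om i)) =
  expeR (- \int[N om]_v (Omega f w v)%:E).
Proof.
move=> w0; rewrite expeRN_sum ?sum_tau// => i.
by rewrite mule_ge0 ?lee_fin.
Qed.

Lemma mecke_post w (G : set_partition n * Vn -> \bar R) : pos w ->
  measurable_fun setT G -> (forall z, 0 <= G z) ->
  (lik w)%:E * \int[P]_om (expeR (- \int[N om]_v (Omega f w v)%:E) *
    \esum_(s in point_tuples (N om))
      ((prod_f f (map_tuple fst s))%:E * G (induced_partition s, map_tuple fst s))) =
  \int[rho]_pv ((post_density (pv, w))%:E * G pv).
Proof.
move=> w0 mG G0.
have w0' i : (0 <= tnth w i :> R)%R by exact: ltW.
rewrite -post_formula// likE// muleC; congr (_ * _).
have mfG : measurable_fun setT (fun pv : set_partition n * Vn => (prod_f f pv.2)%:E * G pv).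
  apply: emeasurable_funM => //; apply/measurable_EFinP.
  exact: (measurableT_comp (measurable_prod_f f_meas) measurable_snd).
rewrite (mecke_point_tuples Vsep nu_bf N_prm
  (G := fun pv : set_partition n * Vn => (prod_f f pv.2)%:E * G pv))//.
- by rewrite muleC moment_integral_nu_Omega// => z; rewrite mule_ge0 ?lee_fin ?prod_f_ge0.
- exact: measurable_Omega.
- by move=> v; exact: Omega_ge0.
- by move=> z; rewrite mule_ge0 ?lee_fin ?prod_f_ge0.
Qed.

(** Identifies the normalising constant, so that positivity and finiteness of the likelihood become
    the hypotheses of Bayes' rule. *)
Lemma likelihoodE : likelihood f mu Delta beta X P N = post_measure setT.
Proof.
rewrite orthant_post//; apply: eq_orthant_integral => w w0.
have w0' i : (0 <= tnth w i :> R)%R by exact: ltW.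
under [RHS]eq_integral do rewrite indicT.
rewrite -(mecke_post (G := cst 1))// likE//; congr (_ * _).
apply: eq_integral => om _; rewrite big_split/= prod_expeR_tau//; congr (_ * _).
transitivity (\prod_(i < n) \esum_(q in points (N om)) (f i q.1)%:E).
  apply: eq_bigr => i _; rewrite /tau (points_integral Vsep)//.
  - by move=> A mA bA; exact: (prm_integer N_prm).
  - exact/measurable_EFinP.
  - by move=> v; rewrite lee_fin.
rewrite -(@esum_tuples_prod _ _ (points (N om)) n (fun i q => (f i q.1)%:E)); last first.
  by move=> i q; rewrite lee_fin.
apply: eq_esum => s _; rewrite mule1 prodEFin; congr EFin.
by apply: eq_bigr => i _; rewrite tnth_map.
Qed.

(** The augmented measure integrates over the weights inside the expectation, while the Mecke
    formula applies for fixed weights; Tonelli exchanges the two. *)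
Lemma joint_measureE B : measurable B ->
  joint_measure f mu Delta beta X P N B = post_measure B.
Proof.
move=> mB; rewrite orthant_post//.
(* Agrees with the integrand for positive weights; the absolute values keep the exponent
   nonpositive, so that [J] is measurable on all of [Om * Rn]. *)
pose J (z : Om * Rn) : \bar R := expeR (- \sum_(i < n) (`|tnth z.2 i|%R)%:E * tau f N z.1 i) *
  ((lik z.2)%:E * \esum_(s in point_tuples (N z.1))
    ((prod_f f (map_tuple fst s))%:E *
     (\1_B ((induced_partition s, map_tuple fst s), z.2))%:E)).
have E0 (z : Om * Rn) : 0 <= \esum_(s in point_tuples (N z.1))
    ((prod_f f (map_tuple fst s))%:E *
     (\1_B ((induced_partition s, map_tuple fst s), z.2))%:E).
  by apply: esum_ge0 => s _; rewrite mule_ge0 ?lee_fin ?prod_f_ge0.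
have J0 z : 0 <= J z.
  by rewrite mule_ge0 ?expeR_ge0// mule_ge0 ?lee_fin ?lik_ge0.
have mE : measurable_fun setT (fun z : Om * Rn => \esum_(s in point_tuples (N z.1))
    ((prod_f f (map_tuple fst s))%:E *
     (\1_B ((induced_partition s, map_tuple fst s), z.2))%:E)).
  apply: (measurable_esum_point_tuples Vsep nu_bf N_prm
    (k := fun z : (set_partition n * Vn) * Rn => (prod_f f z.1.2)%:E * (\1_B z)%:E)).
    apply: emeasurable_funM; last exact/measurable_EFinP/measurable_indic.
    apply/measurable_EFinP; apply: (measurableT_comp (measurable_prod_f f_meas)).
    exact: (measurableT_comp measurable_snd measurable_fst).
  by move=> z; rewrite mule_ge0 ?lee_fin ?prod_f_ge0.
have mJ : measurable_fun setT J.
  apply: emeasurable_funM.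
    apply: measurable_expeRN; last first.
      by move=> z; apply: sume_ge0 => i _; rewrite mule_ge0 ?lee_fin.
    apply: emeasurable_sum => i; apply: emeasurable_funM.
      apply/measurable_EFinP; apply: measurableT_comp => //.
      exact: (measurableT_comp (measurable_tnth i) measurable_snd).
    exact: (measurableT_comp (mtau i) measurable_fst).
  apply: emeasurable_funM => //.
  by apply/measurable_EFinP; exact: (measurableT_comp measurable_lik measurable_snd).
have mJw om : measurable_fun setT (fun w => J (om, w)).
  exact: (measurableT_comp mJ (pair1_measurable om)).
transitivity (\int[P]_om \int[lam]_w J (om, w)).
  apply: eq_integral => om _; rewrite -lamE//; apply: eq_orthant_integral => w w0.
  have w0' i : (0 <= tnth w i :> R)%R by exact: ltW.
  rewrite /J /= -(likE w0) muleA -esumZl; last 2 first.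
  - by rewrite mule_ge0 ?expeR_ge0// lee_fin likE// lik_ge0.
  - by move=> s _; rewrite mule_ge0 ?lee_fin ?prod_f_ge0.
  apply: eq_esum => s _; rewrite !big_split/= prod_expeR_tau// !muleA; congr (_ * _).
  under [in RHS]eq_bigr do rewrite ger0_norm//.
  rewrite sum_tau// -muleA muleC !prodEFin; congr (_ * _ * _%:E).
  by apply: eq_bigr => i _; rewrite tnth_map.
rewrite (fubini_tonelli J mJ J0) -lamE; last 2 first.
- exact: (@measurable_fun_fubini_tonelli_G _ _ _ _ _ P _ mJ J0).
- by move=> w; apply: integral_ge0.
apply: eq_orthant_integral => w w0.
have w0' i : (0 <= tnth w i :> R)%R by exact: ltW.
rewrite -(mecke_post (G := fun pv => (\1_B (pv, w))%:E))//; last exact: mB1.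
rewrite -ge0_integralZl ?lee_fin ?lik_ge0//; last 2 first.
- apply: emeasurable_funM; last exact: (measurableT_comp mE (pair2_measurable w)).
  apply: measurable_expeRN; last first.
    by move=> om; apply: integral_ge0 => v _; rewrite lee_fin Omega_ge0.
  apply: (@measurable_fun_integral_kernel _ _ _ _ _ N).
  + by move=> U mU; exact: measurable_kernel.
  + by move=> v; rewrite lee_fin Omega_ge0.
  + by apply/measurable_EFinP; exact: measurable_Omega.
- by move=> om _; rewrite mule_ge0 ?expeR_ge0//; exact: (E0 (om, w)).
apply: eq_integral => om _; rewrite /J /= muleCA; congr (_ * (expeR (- _) * _)).
by rewrite -sum_tau//; apply: eq_bigr => i _; rewrite ger0_norm.
Qed.

End posterior_density.

(** * The conditional density of the weights *)

Section positive_cells.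
Context {R : realType} {V : completeMetricType R}.
Variable nu : {measure set (borel V) -> \bar R}.
Variables (n : nat) (f : 'I_n -> borel V -> R).
Hypotheses (f_meas : forall i, measurable_fun setT (f i)).
Hypotheses (f_ge0 : forall i v, (0 <= f i v)%R).
Notation Rn := (n.-tuple (measurableTypeR R)).
Notation Vn := (n.-tuple (borel V)).
Notation pos w := (forall i, (0 < tnth w i :> R)%R).
Variables (mu Delta beta : R) (X : 'I_n -> R).

(* On this set the Gamma and GIG parameters of (i) are admissible even when
   [X i = mu * Delta]. *)
Definition positive_cells : set (set_partition n * Vn) :=
  [set pv | (0 < prod_f f pv.2)%R /\ forall i, (0 < sum_f_cells f i pv.1 pv.2)%R].

Lemma measurable_positive_cells : measurable positive_cells.
Proof.
rewrite (_ : positive_cells = [set pv | (0 < prod_f f pv.2)%R] `&`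
    \bigcap_(i in [set: 'I_n]) [set pv | (0 < sum_f_cells f i pv.1 pv.2)%R]).
  have mlt (g : set_partition n * Vn -> R) : measurable_fun setT g ->
      measurable [set pv | (0 < g pv)%R].
    move=> mg; rewrite (_ : [set pv | _] = g @^-1` `]0%R, +oo[%classic); last first.
      by apply/seteqP; split=> pv /=; rewrite in_itv/= andbT.
    by rewrite -[X in measurable X]setTI; exact: mg.
  apply: measurableI.
    apply: mlt; exact: (measurableT_comp (measurable_prod_f f_meas) measurable_snd).
  apply: fin_bigcap_measurable => // i _; apply: mlt.
  exact: measurable_sum_f_cells.
apply/seteqP; split=> pv /= [h1 h2]; split=> // i; first by move=> _; exact: h2.
exact: (h2 i Logic.I).
Qed.

Lemma prod_f_gt0 (v : Vn) i : (0 < prod_f f v)%R -> (0 < f i (tnth v i))%R.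
Proof.
move=> v0; rewrite lt0r f_ge0 andbT; apply: contraTneq v0 => fi0.
by rewrite /prod_f (bigD1 i)//= fi0 mul0r ltxx.
Qed.

Lemma positive_cells_spread (p : set_partition n) (t : #|val p|.-tuple (borel V)) :
  (0 < prod_f f (spread_tuple p t))%R -> positive_cells (p, spread_tuple p t).
Proof.
move=> pf0; split=> //= i.
by apply: lt_le_trans (prod_f_gt0 i pf0) _; exact: sum_f_cells_spread_ge.
Qed.

(** For fixed [pv] the tilt merges with the GIG kernels and turns [|A_i|] into the square root in
    (i); [prod_f] and the constants of the normal and GIG densities go into [c]. *)
Lemma post_density_gig (pv : set_partition n * Vn) : positive_cells pv ->
  exists2 c : R, (0 < c)%R & forall w : Rn, pos w ->
    post_density nu f mu Delta beta X (pv, w) = (c * (exp_Lambda nu f w *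
      \prod_(i < n) gig_pdf (3 / 2) `|beta| (Num.sqrt ((X i - mu * Delta) ^+ 2 +
        2 * sum_f_cells f i pv.1 pv.2)) (tnth w i)))%R.
Proof.
move=> [pf0 s0].
have /choice[d dE] (i : 'I_n) : exists d : R, (0 < d)%R /\ forall t,
    gig_pdf (3 / 2) `|beta| (Num.sqrt ((X i - mu * Delta) ^+ 2 +
      2 * sum_f_cells f i pv.1 pv.2)) t =
    (d * gig_kernel (3 / 2) `|beta| (Num.sqrt ((X i - mu * Delta) ^+ 2 +
      2 * sum_f_cells f i pv.1 pv.2)) t)%R.
  have [|c c0 cE] := @gig_pdfE R beta (Num.sqrt ((X i - mu * Delta) ^+ 2 +
      2 * sum_f_cells f i pv.1 pv.2)); last by exists c.
  by rewrite sqrtr_gt0 ltr_wpDl ?sqr_ge0// mulr_gt0.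
exists (prod_f f pv.2 *
  \prod_(i < n) (normal_peak 1 * expR ((X i - mu * Delta) * beta) / d i))%R.
  rewrite mulr_gt0// prodr_gt0// => i _; rewrite divr_gt0 ?(dE i).1//.
  by rewrite mulr_gt0 ?expR_gt0// normal_peak_gt0// oner_neq0.
move=> w w0; rewrite /post_density /= -!mulrA; congr (_ * _)%R.
rewrite mulrCA [RHS]mulrCA; congr (_ * _)%R.
rewrite tilt_sum_f_cells /lik -!big_split/=; apply: eq_bigr => i _.
have di0 : d i != 0%R by rewrite gt_eqF ?(dE i).1.
rewrite (dE i).2 -(real_normK (num_real (X i - mu * Delta))) -gig_kernel_tilt; last first.
  by rewrite addr_ge0 ?sqr_ge0// mulr_ge0 ?sum_f_cells_ge0.
rewrite (ger0_norm (ltW (w0 i))).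
by field.
Qed.

End positive_cells.

Lemma iter_integral0 d (T : measurableType d) (R : realType)
    (mu : {measure set T -> \bar R}) (D : set T) k :
  iter_integral mu D (fun _ : k.-tuple T => 0) = 0.
Proof.
by elim: k => //= k IH; apply: integral0_eq => x _.
Qed.

(** The Mecke formula with zero tilt, after the product of counts is expanded into a sum over tuples
    of points. It confirms that [moment_integral] is the moment measure also when [nu] has atoms. *)
Lemma moment_measure_prm (R : realType) (V : completeMetricType R) (Vsep : separable V)
    (nu : {measure set (borel V) -> \bar R}) (nu_bf : boundedly_finite nu)
    d (Om : measurableType d) (P : probability Om R) (N : R.-ker Om ~> borel V)
    (N_prm : poisson_random_measure P nu N) n (A : 'I_n -> set (borel V)) :
  (forall i, measurable (A i)) ->
  \int[P]_om \prod_(i < n) N om (A i) =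
  moment_integral nu (fun pv => (\prod_(i < n) \1_(A i) (tnth pv.2 i))%:E).
Proof.
move=> mA.
pose G (pv : set_partition n * n.-tuple (borel V)) : \bar R :=
  (\prod_(i < n) \1_(A i) (tnth pv.2 i))%:E.
have G0 pv : 0 <= G pv by rewrite lee_fin prodr_ge0.
have mG : measurable_fun setT G.
  apply/measurable_EFinP; apply: measurable_prod => i _.
  apply: (measurableT_comp (f := fun x : borel V => \1_(A i) x : R)).
    exact: measurable_indic.
  exact: (measurableT_comp (measurable_tnth i) measurable_snd).
have := @mecke_point_tuples R V Vsep nu nu_bf _ Om P N N_prm n (cst 0%R) G
  (measurable_cst _) (fun=> lexx _) mG G0.
rewrite /Lambda [in RHS]integral0_eq; last by move=> v _; rewrite /= oppr0 expR0 subrr.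
rewrite oppe0 expeR0 mul1e => h.
transitivity (\int[P]_om (expeR (- \int[N om]_v (cst 0%R v)%:E) *
    \esum_(s in point_tuples (N om)) G (induced_partition s, map_tuple fst s))).
  apply: eq_integral => om _; rewrite integral0_eq// oppe0 expeR0 mul1e.
  transitivity (\prod_(i < n) \esum_(q in points (N om)) (\1_(A i) q.1)%:E : \bar R).
    apply: eq_bigr => i _; rewrite (points_measure Vsep)// => B mB bB.
    exact: (prm_integer N_prm).
  rewrite -(@esum_tuples_prod _ _ (points (N om)) n (fun i q => (\1_(A i) q.1)%:E)); last first.
    by move=> i q; rewrite lee_fin.
  apply: eq_esum => s _; rewrite /G prodEFin; congr EFin.
  by apply: eq_bigr => i _; rewrite tnth_map.
rewrite h; apply: eq_bigr => p _; apply: eq_iter_integral => t _.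
by rewrite spreadE big1 ?mul1e// => j _; rewrite oppr0 expR0.
Qed.

Theorem theorem3p2 (R : realType) (V : completeMetricType R)
  (Vsep : separable V)
  (nu : {measure set (borel V) -> \bar R}) (nu_bf : boundedly_finite nu)
  (d : measure_display) (Om : measurableType d) (P : probability Om R)
  (N : R.-ker Om ~> borel V) (N_prm : poisson_random_measure P nu N)
  (n : nat) (n_gt0 : (0 < n)%N)
  (f : 'I_n -> borel V -> R)
  (f_meas : forall i, measurable_fun setT (f i))
  (f_ge0 : forall i v, (0 <= f i v)%R)
  (Lambda_fin : forall w : n.-tuple (measurableTypeR R),
     (forall i, (0 <= tnth w i :> R)%R) -> Lambda nu (Omega f w) < +oo)
  (mu Delta beta : R) (Delta_gt0 : (0 < Delta)%R) (X : 'I_n -> R)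
  (L_gt0 : 0 < likelihood f mu Delta beta X P N)
  (L_fin : likelihood f mu Delta beta X P N < +oo) :
  (* [v_formula] and [joint_formula] integrate against the [n]-th moment
     measure of a Poisson random measure with intensity [nu_Omega] *)
  (forall w : n.-tuple (measurableTypeR R),
     (forall i, (0 <= tnth w i :> R)%R) ->
     forall (d' : measure_display) (Om' : measurableType d')
       (P' : probability Om' R) (N' : R.-ker Om' ~> borel V),
     poisson_random_measure P' (nu_Omega nu f w) N' ->
     forall A : 'I_n -> set (borel V), (forall i, measurable (A i)) ->
       \int[P']_om \prod_(i < n) N' om (A i) =
       moment_integral (nu_Omega nu f w)
         (fun pv => (\prod_(i < n) \1_(A i) (tnth pv.2 i))%:E)) /\
  exists PX : probability
      ((set_partition n * n.-tuple (borel V))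
       * n.-tuple (measurableTypeR R))%type R,
    is_posterior f mu Delta beta X P N PX /\
    propto PX (joint_formula nu f mu Delta beta X) /\
    (* (i) *)
    (exists2 k : R.-pker (set_partition n * n.-tuple (borel V))%type
                   ~> n.-tuple (measurableTypeR R),
       cond_law_snd PX k &
       {ae PX, forall y, propto (k y.1) (w_formula nu f mu Delta beta X y.1)}) /\
    (* (ii) *)
    (exists2 k : R.-pker (n.-tuple (measurableTypeR R))
                   ~> (set_partition n * n.-tuple (borel V))%type,
       cond_law_fst PX k &
       {ae PX, forall y, propto (k y.2) (v_formula nu f y.2)}) /\
    (forall w A, measurable A -> v_formula nu f w A = v_formula_cells nu f w A) /\
    (* (iii) *)
    (forall B, measurable B ->
       PX (setT `*` B) =
       (fine (likelihood f mu Delta beta X P N))^-1%:E *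
       orthant_integral (fun w =>
         B_coef nu f w * expeR (- Lambda nu (Omega f w))
         * (normal_lik mu Delta beta X w)%:E * (\1_B w)%:E)).

Proof.
split.
  move=> w w0 d' Om' P' N' prm' A mA.
  have [m [mE _]] := nu_Omega_measure nu f_meas w.
  have bm : @boundedly_finite R V m.
    by rewrite mE; exact: boundedly_finite_nu_Omega.
  rewrite -mE in prm' *.
  exact: (moment_measure_prm Vsep bm prm').
have [nu' nuE] := boundedly_finite_sigma_finite nu_bf.
have [rho rhoE'] := partition_measure n nu'.
have rhoE (g : set_partition n * n.-tuple (borel V) -> \bar R) :
    measurable_fun setT g -> (forall z, 0 <= g z) ->
    \int[rho]_z g z = \sum_p iter_integral nu setT (fun t => g (p, spread_tuple p t)).
  by move=> mg g0; rewrite nuE; exact: rhoE'.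
have [lam lamE] := @iter_measure _ _ R lebesgue_measure `]0%R, +oo[%classic n
  (measurable_itv _).
have mH := @measurable_post_density R V nu nu_bf n f f_meas f_ge0 mu Delta beta X.
have H0 z : (0 <= post_density nu f mu Delta beta X z)%R by exact: post_density_ge0.
have LE := likelihoodE nu_bf f_meas f_ge0 Lambda_fin mu Delta beta X rhoE lamE Vsep N_prm.
have JE := joint_measureE nu_bf f_meas f_ge0 Lambda_fin mu Delta beta X rhoE lamE Vsep N_prm.
have FE := joint_formulaE nu_bf f_meas f_ge0 Lambda_fin mu Delta beta X rhoE lamE.
have OE := orthant_post nu_bf f_meas f_ge0 mu Delta beta X rho lamE.
rewrite LE in L_gt0 L_fin *.
have [Q [QE [k1 k1c k1ae] [k2 k2c k2ae]]] := bayes_posterior mH H0 L_gt0 L_fin.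
have c0 : (0 < (fine (post_measure nu f mu Delta beta X rho lam setT))^-1)%R.
  by rewrite invr_gt0 fine_gt0// L_gt0.
have pw0 (w : n.-tuple (measurableTypeR R)) : (forall i, 0 < tnth w i :> R)%R ->
    forall i, (0 <= tnth w i :> R)%R by move=> w0 i; exact: ltW.
exists Q; split; [|split; [|split; [|split; [|split]]]].
- by move=> B mB; rewrite !JE// QE.
- exists (fine (post_measure nu f mu Delta beta X rho lam setT))^-1%R => // B mB.
  by rewrite FE// QE.
- exists k1 => //.
  have mpc := measurable_positive_cells f_meas.
  (* [rho] charges only vectors constant on the cells of [p]; among these, either [prod_f] is
     positive and the pair lies in [positive_cells], or the density vanishes. *)
  have pc_ae : {ae Q, forall y, positive_cells f y.1}.
    exists (~` positive_cells f `*` setT); split.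
    + by apply: measurableX => //; exact: measurableC.
    + rewrite QE; last by apply: measurableX => //; exact: measurableC.
      rewrite [X in _ * X](_ : _ = 0) ?mule0// -[LHS]/(post_measure _ _ _ _ _ _ _ _ _).
      rewrite /post_measure; apply: integral0_eq => w _.
      have mC : measurable_fun setT (fun pv : set_partition n * n.-tuple (borel V) =>
          (post_density nu f mu Delta beta X (pv, w))%:E *
          (\1_(~` positive_cells f `*` [set: n.-tuple (measurableTypeR R)]) (pv, w))%:E).
        apply: emeasurable_funM.
          by apply/measurable_EFinP; exact: (measurableT_comp mH (pair2_measurable w)).
        apply: (measurableT_comp (f := fun z => (\1_(~` positive_cells f `*`
          [set: n.-tuple (measurableTypeR R)]) z)%:E) _ (pair2_measurable w)).
        by apply: measurable_indic_EFin; apply: measurableX => //; exact: measurableC.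
      rewrite rhoE//; last by move=> pv; rewrite mule_ge0 ?lee_fin.
      rewrite big1// => p _; rewrite -[RHS](iter_integral0 nu setT #|val p|).
      apply: eq_iter_integral => t _.
      have [pf0|pf0] := ltrP 0 (prod_f f (spread_tuple p t)).
        rewrite indicE memNset ?mule0// => -[/= npc _]; apply: npc.
        exact: positive_cells_spread.
      have -> : post_density nu f mu Delta beta X (p, spread_tuple p t, w) = 0%R.
        rewrite /post_density (_ : prod_f _ _ = 0%R) ?mul0r//.
        by apply/eqP; rewrite eq_le pf0 prod_f_ge0.
      by rewrite mul0e.
    + by move=> y /= npc; split.
  apply: filterS2 k1ae pc_ae => y ky pc; apply: (propto_trans ky).
  have [c cp cE] := post_density_gig nu f_ge0 mu Delta beta X pc.
  exists c => // B mB.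
  have mpB : measurable_fun setT (fun w : n.-tuple (measurableTypeR R) =>
      (post_density nu f mu Delta beta X (y.1, w))%:E * (\1_B w)%:E).
    apply: emeasurable_funM; last exact: measurable_indic_EFin.
    by apply/measurable_EFinP; exact: (measurableT_comp mH (pair1_measurable y.1)).
  have pB0 w : 0 <= (post_density nu f mu Delta beta X (y.1, w))%:E * (\1_B w)%:E.
    by rewrite mule_ge0 ?lee_fin.
  (* The factor [c] depends on [y.1] alone; dividing by it leaves the integrand of [w_formula] on
     the orthant. *)
  transitivity (c%:E * (c^-1%:E * \int[lam]_w
      ((post_density nu f mu Delta beta X (y.1, w))%:E * (\1_B w)%:E))).
    by rewrite muleA -EFinM divff ?gt_eqF// mul1e.
  congr (_ * _); rewrite -ge0_integralZl//; last by rewrite lee_fin invr_ge0 ltW.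
  rewrite -lamE; last 2 first.
  - exact: measurable_funeM.
  - by move=> w; rewrite mule_ge0// lee_fin invr_ge0 ltW.
  apply: eq_orthant_integral => w w0.
  rewrite (exp_LambdaE f_ge0 Lambda_fin w0) cE// muleA -!EFinM.
  by rewrite mulKf ?gt_eqF.
- exists k2 => //.
  pose O : set (n.-tuple (measurableTypeR R)) :=
    rect (T := measurableTypeR R) (fun=> `]0%R, +oo[%classic).
  have OP w : O w <-> forall i, (0 < tnth w i :> R)%R.
    by split=> h i; have := h i; rewrite /= in_itv/= andbT.
  have mO : measurable O by apply: measurable_rect => _; exact: measurable_itv.
  (* The weights are integrated over the open orthant only, so almost surely they are all
     positive. *)
  have pos_ae : {ae Q, forall y, O y.2}.
    exists (setT `*` ~` O); split.
    + by apply: measurableX => //; exact: measurableC.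
    + have mTO : measurable ([set: set_partition n * n.-tuple (borel V)] `*` ~` O).
        by apply: measurableX => //; exact: measurableC.
      rewrite QE//.
      rewrite [X in _ * X](_ : _ = 0) ?mule0// -[LHS]/(post_measure _ _ _ _ _ _ _ _ _).
      rewrite OE// -[RHS](iter_integral0 lebesgue_measure `]0%R, +oo[%classic n).
      apply: eq_orthant_integral => w /OP w0.
      by apply: integral0_eq => pv _; rewrite indicE memNset ?mule0// => -[].
    + by move=> y /= nO; split.
  apply: filterS2 k2ae pos_ae => y ky /OP w0; apply: (propto_trans ky).
  (* For given weights these factors of the joint density do not depend on [(p, v)]. *)
  exists (exp_Lambda nu f y.2 * lik mu Delta beta X y.2)%R.
    by rewrite mulr_gt0 ?expR_gt0 ?lik_gt0.
  move=> A mA; rewrite -(post_formula nu_bf f_meas f_ge0 Lambda_fin mu Delta beta X rhoE w0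
    (G := fun pv => (\1_A pv)%:E)).
  + by rewrite (exp_LambdaE f_ge0 Lambda_fin w0) likE// -muleA -EFinM muleC.
  + exact: measurable_indic_EFin.
  + by move=> z; rewrite lee_fin.
- by move=> w A _; exact: v_formula_cellsE.
- move=> B mB.
  have mTB : measurable ([set: set_partition n * n.-tuple (borel V)] `*` B).
    exact: measurableX.
  rewrite QE//; congr (_ * _).
  rewrite -[LHS]/(post_measure _ _ _ _ _ _ _ _ _) OE//.
  apply: eq_orthant_integral => w w0.
  rewrite -B_coefE//; last exact: pw0.
  (* The indicator depends on [w] only, so [(p, v)] is integrated out by [post_formula] with the
     constant 1, which leaves the moment integral equal to [B_coef]. *)
  transitivity ((\int[rho]_pv ((post_density nu f mu Delta beta X (pv, w))%:E * cst 1 pv)) *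
      (\1_B w)%:E).
    rewrite -ge0_integralZr//; last 2 first.
    - apply: emeasurable_funM => //; apply/measurable_EFinP.
      exact: (measurableT_comp mH (pair2_measurable w)).
    - by move=> pv _; rewrite mule_ge0 ?lee_fin.
    apply: eq_integral => pv _; rewrite mule1; congr (_ * _%:E).
    by rewrite !indicE in_setX in_setT.
  rewrite -(post_formula nu_bf f_meas f_ge0 Lambda_fin mu Delta beta X rhoE w0
    (G := cst 1))//.
  congr (_ * _ * _ * _); apply: eq_bigr => p _; apply: eq_iter_integral => t _.
  by rewrite mule1.
Qed.
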